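(* Let $m,n\in\mathbb{N}$ with $n\le m$ and let $\mathbf{A}=(a_{ij})\in\mathbb{R}^{n\times m}$ be such that the linear optimization problem $$\text{find } \mathbf{x}\in\mathbb{R}^m,\ \mathbf{x}\ge \mathbf{0},\ \text{such that } \mathbf{A}\mathbf{x}\ge\mathbf{1},\quad \sum_{i=1}^m x_i\to\min!$$ has a unique optimal solution $\boldsymbol{\kappa}=(\kappa_1,\ldots,\kappa_m)^T$ and this solution is non-degenerate (i.e. it has $n$ positive components). Denote by $\mathbf{A}_{\boldsymbol{\kappa}}\in\mathbb{R}^{n\times n}$ the matrix derived from $\mathbf{A}$ by deleting all columns $1\le j\le m$ for which $\kappa_j=0$. Then $\mathbf{A}_{\boldsymbol{\kappa}}$ is invertible. Let $X_1,\ldots,X_m$ be independent non-negative random variables and assume that there exists $\epsilon>0$ such that: (i) for all $1\le j\le m$ with $\kappa_j>0$, $X_j$ is regularly varying with index $-1$; (ii) for all $1\le j\le m$ with $\kappa_j=0$, $$E\left(X_j^{(\mathbf{1}^T\mathbf{A}_{\boldsymbol{\kappa}}^{-1}\mathbf{A})_j+\epsilon}\right)<\infty\quad\text{and}\quad E\left(X_j^{(\mathbf{1}^T\mathbf{A}_{\boldsymbol{\kappa}}^{-1}\mathbf{A})_j-\epsilon}\right)<\infty.$$ Then for all $c_i>0$, $1\le i\le n$, $$\lim_{x\to\infty}\frac{P\left(\prod_{j=1}^m X_j^{a_{ij}}>c_i x,\ 1\le i\le n\right)}{\prod_{\{1\le j\le m:\,\kappa_j>0\}}P(X_j>x^{\kappa_j})}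 =|\det\mathbf{A}_{\boldsymbol{\kappa}}|^{-1}\,\frac{\prod_{i=1}^n c_i^{-(\mathbf{1}^T\mathbf{A}_{\boldsymbol{\kappa}}^{-1})_i}}{\prod_{i=1}^n(\mathbf{1}^T\mathbf{A}_{\boldsymbol{\kappa}}^{-1})_i}\prod_{j:\,\kappa_j=0}E\left(X_j^{(\mathbf{1}^T\mathbf{A}_{\boldsymbol{\kappa}}^{-1}\mathbf{A})_j}\right)=:\mu\left((c_1,\infty)\times\cdots\times(c_n,\infty)\right).$$ In particular, the distribution of $\left(\prod_{j=1}^m X_j^{a_{ij}}\right)_{1\le i\le n}$ is regularly varying on $(0,\infty)^n$ with respect to scalar multiplication; the normalizing function can be chosen as $c(x)=\left(\prod_{\{1\le j\le m:\,\kappa_j>0\}}P(X_j>x^{\kappa_j})\right)^{-1}$, the corresponding limit measure is $\mu$ (the measure on $(0,\infty)^n$ with the values on the sets $(c_1,\infty)\times\cdots\times(c_n,\infty)$ given above), and the index of regular variation equals $-\sum_{j=1}^m\kappa_j=-\mathbf{1}^T\mathbf{A}_{\boldsymbol{\kappa}}^{-1}\mathbf{1}$.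
   Context: Vector inequalities hold componentwise; $\mathbf{0}$ and $\mathbf{1}$ are column vectors of suitable dimension consisting of zeros, respectively ones. Conventions for products of powers of non-negative numbers: $0^a=+\infty$ for $a<0$, $0^0=1$, and $+\infty\cdot 0=0$; thus a product $\prod_{j}X_j^{a_{ij}}$ may take the value $+\infty$. A non-negative random variable $X$ is regularly varying with index $-1$ if $\lim_{x\to\infty}P(X>\lambda x)/P(X>x)=\lambda^{-1}$ for all $\lambda>0$. Regular variation on $(0,\infty)^n$ with respect to scalar multiplication: let $\mathbb{C}=[0,\infty)^n\setminus(0,\infty)^n$ and $\mathbb{O}=(0,\infty)^n$. For $r>0$ let $\mathbb{C}^r$ be the set of points at Euclidean distance less than $r$ from $\mathbb{C}$. Let $\mathbb{M}_{\mathbb{O}}$ be the space of Borel measures on $\mathbb{O}$ whose restrictions to $[0,\infty)^n\setminus\mathbb{C}^r$ are finite for each $r>0$, and let $\mathcal{C}^+(\mathbb{O})$ be the class of non-negative, bounded, continuous functions on $\mathbb{O}$ vanishing on $\mathbb{C}^r$ for some $r>0$. The space $\mathbb{M}_{\mathbb{O}}$ carries the topology generated by the sets $\{\nu\in\mathbb{M}_{\mathbb{O}}:|\int f_i\,d\nu-\int f_i\,d\mu|<\epsilon,\ 1\le i\le k\}$ with $\mu\in\mathbb{M}_{\mathbb{O}}$, $f_i\in\mathcal{C}^+(\mathbb{O})$, $\epsilon>0$; i.e. $\nu_k\to\nu$ iff $\int f\,d\nu_k\to\int f\,d\nu$ for all $f\in\mathcal{C}^+(\mathbb{O})$. A measure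 $\nu\in\mathbb{M}_{\mathbb{O}}$ is called regularly varying on $\mathbb{O}$ with respect to scalar multiplication if there exist an increasing (i.e. non-decreasing), regularly varying function $c:[0,\infty)\to(0,\infty)$ (the normalizing function) and a nonzero measure $\mu\in\mathbb{M}_{\mathbb{O}}$ (the limit measure) such that $c(x)\nu(x\,\cdot)\to\mu(\cdot)$ in $\mathbb{M}_{\mathbb{O}}$ as $x\to\infty$, where $xA=\{x\mathbf{y}:\mathbf{y}\in A\}$. In this case there is an $\alpha\ge 0$ with $\mu(\lambda A)=\lambda^{-\alpha}\mu(A)$ for all $\lambda>0$ and Borel sets $A\subset\mathbb{O}$, and $-\alpha$ is called the index of regular variation of $\nu$. The distribution of a random vector is regarded as an element of $\mathbb{M}_{\mathbb{O}}$ via its restriction to $\mathbb{O}=(0,\infty)^n$.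
   Formalization: That the limit measure μ is nonzero (needed for regular variation) is claimed only if P(X_j>0)>0 for all j with κ_j=0; otherwise, e.g. A=(1,1/2), X_2=0 a.s., hypotheses hold but μ=0. All other claims are proved without this assumption. *)

(* Defs.v *)
From HB Require Import structures.
From mathcomp Require Import all_boot all_order all_algebra.
From mathcomp Require Import all_classical all_reals all_analysis.
From mathcomp Require Import measurable_realfun.

Set Implicit Arguments.
Unset Strict Implicit.
Unset Printing Implicit Defensive.
Import Order.TTheory GRing.Theory Num.Theory.
Import numFieldNormedType.Exports.

Local Open Scope classical_set_scope.
Local Open Scope ring_scope.

Section linear_program.
Context {R : realType} {m n : nat}.
Implicit Types (A : 'M[R]_(n, m)) (x kappa : 'cV[R]_m).

Definition lp_feasible A x :=
  (forall j, 0 <= x j 0) /\ (forall i, 1 <= (A *m x) i 0).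

Definition lp_optimal A x :=
  lp_feasible A x /\
  forall y, lp_feasible A y -> \sum_j x j 0 <= \sum_j y j 0.

Definition lp_unique_optimal A x :=
  lp_optimal A x /\ forall y, lp_optimal A y -> y = x.

Definition lp_nondegenerate kappa := #|[pred j | 0 < kappa j 0]| = n.

End linear_program.

Arguments lp_nondegenerate {R m} n kappa.

Section optimal_basis.
Context {R : realType} {m n : nat}.
Implicit Types (A : 'M[R]_(n, m)) (kappa : 'cV[R]_m).

(* [enum_val] lists the indices of the positive components of [kappa] in
   increasing order, so the remaining columns of [A] keep their order. *)
Definition basis_mx A kappa (nd : lp_nondegenerate n kappa) : 'M[R]_n :=
  colsub (fun i : 'I_n => enum_val (cast_ord (esym nd) i)) A.

(* 1^T A_kappa^-1 *)
Definition dual_row A kappa (nd : lp_nondegenerate n kappa) : 'rV[R]_n :=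
  const_mx 1 *m invmx (basis_mx A nd).

(* 1^T A_kappa^-1 A *)
Definition moment_row A kappa (nd : lp_nondegenerate n kappa) : 'rV[R]_m :=
  dual_row A nd *m A.

End optimal_basis.

Section power.
Context {R : realType}.

(* Power of a non-negative real with the convention 0^a = +oo for a < 0;
   [powR] already gives 0^0 = 1, and 0^a = 0 for every a <> 0. *)
Definition epow (x a : R) : \bar R :=
  if (x == 0) && (a < 0) then +oo%E else (x `^ a)%:E.

Lemma measurable_epow (a : R) : measurable_fun [set: R] (epow ^~ a : R -> \bar R).
Proof.
apply: measurable_fun_ifT => //; last first.
  by apply/measurable_EFinP; exact: measurable_powR.
case: (a < 0) => /=.
  under eq_fun do rewrite andbT.
  by apply: measurable_fun_eqr => //; exact: measurable_cst.
by under eq_fun do rewrite andbF; exact: measurable_cst.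
Qed.

End power.

Section power_products.
Context {R : realType} {T : Type} {m n : nat}.

(* i-th component of (prod_j X_j^(a_ij))_i; the library's product on [\bar R]
   satisfies +oo * 0 = 0. *)
Definition powprod (A : 'M[R]_(n, m)) (X : 'I_m -> T -> R) (i : 'I_n) (w : T)
    : \bar R :=
  (\prod_j epow (X j w) (A i j))%E.

End power_products.

Lemma measurable_powprod {R : realType} d (T : measurableType d) (m n : nat)
    (P : probability T R) (A : 'M[R]_(n, m)) (X : 'I_m -> {RV P >-> R}) i :
  measurable_fun [set: T] (powprod A X i).
Proof.
rewrite /powprod; elim: (index_enum _) => [|j s IHs].
  by under eq_fun do rewrite big_nil; exact: measurable_cst.
under eq_fun do rewrite big_cons.
apply: emeasurable_funM => //.
exact: (measurableT_comp (measurable_epow _)).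
Qed.

(* R^n with its Borel sigma-algebra; the topology of ['rV[R]_n] is the usual
   one. *)
Notation borel_rV R n := (g_sigma_algebraType (@open 'rV[R]_n)).

Lemma measurable_row {R : realType} d (T : measurableType d) (n : nat)
    (g : T -> borel_rV R n) :
  (forall i, measurable_fun [set: T] (fun w => (g w : 'rV[R]_n) 0 i)) ->
  measurable_fun [set: T] g.
Proof.
move=> mg; apply: (@measurability _ _ T (borel_rV R n) [set: T] g (@open 'rV[R]_n)) => //.
move=> _ [U oU <-]; rewrite setTI.
pose box (q : {ffun 'I_n -> rat} * nat) : set 'rV[R]_n :=
  [set z | forall i, `|z 0 i - ratr (q.1 i)| < q.2.+1%:R^-1].
have -> : g @^-1` U =
    \bigcup_q (if `[< box q `<=` U >] then g @^-1` box q else set0).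
  apply/seteqP; split=> [w /= Uw|w [q _]]; last first.
    by case: asboolP => // qU /qU.
  have /nbhs_ballP[e /= e0 eU] : nbhs (g w : 'rV[R]_n) U.
    by move: oU; rewrite openE; exact.
  have [k ke] : exists k : nat, k.+1%:R^-1 < e / 2.
    have e20 : 0 < e / 2 by rewrite divr_gt0.
    have [k _ /(_ k (leqnn k)) /=] := near_infty_natSinv_lt (PosNum e20).
    by exists k.
  have k0 : (0 : R) < k.+1%:R^-1 by rewrite invr_gt0.
  have /choice[q qP] : forall i : 'I_n, exists q : rat,
      `|(g w : 'rV[R]_n) 0 i - ratr q| < k.+1%:R^-1.
    move=> i; have [q] := @rat_in_itvoo R ((g w : 'rV[R]_n) 0 i - k.+1%:R^-1)
      ((g w : 'rV[R]_n) 0 i + k.+1%:R^-1) (ltac:(by rewrite ltrD2l gtrN)).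
    rewrite in_itv /= => /andP[q1 q2]; exists q.
    by rewrite ltr_distlC q1 q2.
  exists ([ffun i => q i], k) => //.
  rewrite asboolT; first by move=> i /=; rewrite ffunE.
  move=> z zq; apply: eU; split => // i j; rewrite ord1.
  have := zq j; rewrite /= ffunE => zqj.
  rewrite /ball /= (splitr e); apply: (le_lt_trans (ler_distD (ratr (q j)) _ _)).
  by rewrite ltrD // (lt_trans _ ke) // distrC.
apply: countable_bigcupT_measurable => [|q]; first exact: countableP.
case: ifPn => // _.
rewrite (_ : g @^-1` box q = \bigcap_(i in [set: 'I_n])
   (fun w => `|(g w : 'rV[R]_n) 0 i - ratr (q.1 i)|) @^-1` `]-oo, q.2.+1%:R^-1[).
  apply: fin_bigcap_measurable => // i _; rewrite -[X in measurable X]setTI.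
  apply: (_ : measurable_fun [set: T] _) => //.
  apply: measurableT_comp => //; exact: measurable_funB.
by apply/seteqP; split=> w /= => [qw i _|qw i]; have := qw i; rewrite /= in_itv /=; exact.
Qed.

Section distribution.
Context {R : realType} d (T : measurableType d) (n : nat).
Context (P : probability T R) (Y : 'I_n -> T -> \bar R).
Hypothesis mY : forall i, measurable_fun [set: T] (Y i).

Definition pos_finite : set T := [set w | forall i, (0 < Y i w < +oo)%E].

Definition fine_row (w : T) : borel_rV R n := \row_i fine (Y i w).

Lemma measurable_pos_finite : measurable pos_finite.
Proof.
rewrite (_ : pos_finite = \bigcap_(i in [set: 'I_n]) (Y i @^-1` `]0%E, +oo%E[)).
  apply: fin_bigcap_measurable => // i _; rewrite -[X in measurable X]setTI.
  by apply: mY => //; exact: emeasurable_itv.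
by apply/seteqP; split=> w /= => [qw i _|qw i]; have := qw i; rewrite /= in_itv /=; exact.
Qed.

Lemma measurable_fine_row : measurable_fun [set: T] fine_row.
Proof.
apply: measurable_row => i; under eq_fun do rewrite mxE.
exact: measurableT_comp.
Qed.

(* Restriction to (0,oo)^n of the distribution of [Y], as a Borel measure on
   R^n that vanishes off (0,oo)^n. *)
Definition law_orthant : set (borel_rV R n) -> \bar R :=
  pushforward (mrestr P measurable_pos_finite) fine_row.

Let law_orthant0 : law_orthant set0 = 0%E.
Proof. by rewrite /law_orthant /pushforward preimage_set0 measure0. Qed.

Let law_orthant_ge0 A : (0 <= law_orthant A)%E.
Proof. exact: (measure_ge0 P). Qed.

Let law_orthant_sigma_additive : semi_sigma_additive law_orthant.
Proof.
move=> F mF tF mUF; rewrite /law_orthant /pushforward preimage_bigcup.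
have mfF i : measurable (fine_row @^-1` F i).
  by rewrite -[X in measurable X]setTI; apply: measurable_fine_row.
apply: measure_semi_sigma_additive => //; last exact: bigcup_measurable.
apply/trivIsetP => i j _ _ ij; rewrite -preimage_setI.
by move/trivIsetP : tF => -> //; rewrite preimage_set0.
Qed.

HB.instance Definition _ := isMeasure.Build _ _ _ law_orthant
  law_orthant0 law_orthant_ge0 law_orthant_sigma_additive.

End distribution.

Lemma law_orthantE {R : realType} d (T : measurableType d) (n : nat)
    (P : probability T R) (Y : 'I_n -> T -> \bar R)
    (mY : forall i, measurable_fun [set: T] (Y i)) (A : set (borel_rV R n)) :
  law_orthant P mY A =
  P [set w | exists2 y : 'rV[R]_n, A y /\ (forall i, 0 < y 0 i) &
                                   forall i, Y i w = (y 0 i)%:E].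
Proof.
rewrite /law_orthant /pushforward /mrestr; congr (P _).
apply/seteqP; split=> w /=.
  move=> [Aw pw]; exists (fine_row Y w).
    split=> // i; rewrite mxE fine_gt0 //.
  move=> i; rewrite mxE fineK // fin_real //.
  by have /andP[h ->] := pw i; rewrite (lt_trans _ h).
move=> [y [Ay y0] Yy]; split.
  suff -> : fine_row Y w = y by [].
  by apply/rowP => i; rewrite mxE Yy.
by move=> i; rewrite Yy lte_fin y0 ltry.
Qed.

Section regular_variation.
Context {R : realType}.

(* Regular variation at +oo with index [rho]. *)
Definition regularly_varying (f : R -> R) (rho : R) :=
  forall l, 0 < l -> (f (l * x) / f x) @[x --> +oo] --> l `^ rho.

Definition regularly_varying_RV d (T : measurableType d) (P : probability T R)
    (X : {RV P >-> R}) (rho : R) :=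
  regularly_varying (fun x => fine (ccdf X x)) rho.

Context {n : nat}.

Definition orthant : set 'rV[R]_n := [set y | forall i, 0 < y 0 i].

Definition closed_orthant : set 'rV[R]_n := [set y | forall i, 0 <= y 0 i].

Definition orthant_boundary : set 'rV[R]_n := closed_orthant `\` orthant.

Definition euclidean_dist (y z : 'rV[R]_n) : R :=
  Num.sqrt (\sum_i (y 0 i - z 0 i) ^+ 2).

Definition boundary_nbhd (r : R) : set 'rV[R]_n :=
  [set y | exists2 z, orthant_boundary z & euclidean_dist y z < r].

(* Borel measures on (0,oo)^n are represented by the Borel measures on R^n that
   vanish off (0,oo)^n. *)
Definition M_O (nu : {measure set (borel_rV R n) -> \bar R}) :=
  nu (~` orthant) = 0%E /\
  forall r, 0 < r -> (nu (closed_orthant `\` boundary_nbhd r) < +oo)%E.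

(* The values of [f] off (0,oo)^n are irrelevant. *)
Definition C_plus_O (f : 'rV[R]_n -> R) :=
  [/\ forall y, orthant y -> 0 <= f y,
      exists M, forall y, orthant y -> f y <= M,
      {within orthant, continuous f} &
      exists2 r, 0 < r &
        forall y, orthant y -> boundary_nbhd r y -> f y = 0].

(* A |-> c * nu (x A) *)
Definition rescaled (nu : {measure set (borel_rV R n) -> \bar R}) (c x : R) :
    set (borel_rV R n) -> \bar R :=
  fun A => (c%:E * nu [set x *: (y : 'rV[R]_n) | y in A])%E.

(* c(x) nu(x .) --> mu in M_O as x --> oo *)
Definition M_O_scaling_limit (nu : {measure set (borel_rV R n) -> \bar R})
    (c : R -> R) (mu : {measure set (borel_rV R n) -> \bar R}) :=
  forall f, C_plus_O f ->
    (\int[rescaled nu (c x) x]_(y in orthant) (f y)%:E)%E @[x --> +oo]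
      --> (\int[mu]_(y in orthant) (f y)%:E)%E.

Definition normalizing_function (c : R -> R) :=
  [/\ forall x, 0 <= x -> 0 < c x,
      forall x y, 0 <= x -> x <= y -> c x <= c y &
      exists rho, regularly_varying c rho].

(* [rho] is the exponent written -alpha in mu(l A) = l^(-alpha) mu(A). *)
Definition homogeneous_index (mu : {measure set (borel_rV R n) -> \bar R})
    (rho : R) :=
  rho <= 0 /\
  forall l (A : set (borel_rV R n)), 0 < l -> measurable A -> A `<=` orthant ->
    mu [set l *: (y : 'rV[R]_n) | y in A] = ((l `^ rho)%:E * mu A)%E.

(* All the requirements of regular variation on (0,oo)^n, except that the limit
   measure [mu] may be zero. *)
Definition scaling_convergence (nu : {measure set (borel_rV R n) -> \bar R})
    (c : R -> R) (mu : {measure set (borel_rV R n) -> \bar R}) (rho : R) :=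
  [/\ M_O nu, normalizing_function c, M_O mu, M_O_scaling_limit nu c mu &
      homogeneous_index mu rho].

(* [nu] is regularly varying on (0,oo)^n with respect to scalar multiplication,
   with normalizing function [c], limit measure [mu] and index [rho]. *)
Definition regularly_varying_O (nu : {measure set (borel_rV R n) -> \bar R})
    (c : R -> R) (mu : {measure set (borel_rV R n) -> \bar R}) (rho : R) :=
  scaling_convergence nu c mu rho /\ mu orthant != 0%E.

End regular_variation.

Section independence.
Context {R : realType} d (T : measurableType d) (P : probability T R).

Definition mutually_independent (I : finType) (X : I -> {RV P >-> R}) :=
  forall (J : {set I}) (B : I -> set R), (forall i, measurable (B i)) ->
    P [set w | forall i, i \in J -> B i (X i w)] =
    (\prod_(i in J) P (X i @^-1` B i))%E.

End independence.

Section limit_objects.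
Context {R : realType} {m n : nat} d (T : measurableType d).
Context (P : probability T R).
Variables (A : 'M[R]_(n, m)) (kappa : 'cV[R]_m).
Hypothesis nd : lp_nondegenerate n kappa.
Variable X : 'I_m -> {RV P >-> R}.

Definition tail_product (x : R) : R :=
  \prod_(j | 0 < kappa j 0) fine (ccdf (X j) (x `^ kappa j 0)).

(* mu ((c_1,oo) x ... x (c_n,oo)) *)
Definition limit_value (c : 'I_n -> R) : \bar R :=
  let b := dual_row A nd in
  let beta := moment_row A nd in
  ((`|\det (basis_mx A nd)|^-1 *
      ((\prod_i c i `^ (- b 0 i)) / \prod_i b 0 i))%R%:E *
   \prod_(j | (kappa j 0 == 0)%R) \int[P]_w epow (X j w) (beta 0 j)%R)%E.

End limit_objects.

(* Main.v *)
Require Import Defs.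
From HB Require Import structures.
From mathcomp Require Import all_boot all_order all_algebra.
From mathcomp Require Import all_classical all_reals all_analysis.
From mathcomp Require Import measurable_realfun perm ring lra.

(** Write [b = 1^T A_kappa^-1] and [beta = b A]. Since [kappa] is the unique
    optimum, every admissible direction strictly increases the objective
    ([lp_perturb]); applied to suitable directions this makes [A_kappa]
    invertible, all constraints tight and every [b_i] positive
    ([optimal_basis_unit], [dual_row_gt0]).

    Let [G] be the tail of a basic variable [X_j]. Regular variation says that
    [X_j], at the level [t], behaves like [t e^u], where [u] has the infinite
    measure [expm] with density [e^-u] on the whole line as its law, up to the
    factor [G t]. The generalised quantile
    [q t u = inf {s >= 0 : G s <= e^-u G t}] makes this exact for every [t]: on
    [(0, oo)] the image of [expm] under [q t] is the law of [X_j] divided by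
    [G t] ([survival_quantile_law]). Doing so for all basic variables at the
    levels [t_j = x^kappa_j] writes the expectation of any function that
    vanishes unless the basic variables are positive as an integral over the
    product of [P] and [expm^n], times exactly the normalising product of tails
    ([coupling_integral]).

    In these coordinates the limit can be taken pointwise:
    [ln (q t u / t) --> u], and because [A kappa = 1] the powers of [x] cancel,
    so the power products divided by [x] converge to
    [exp (sum_k a_ik u_k) prod_(kappa_j = 0) X_j^a_ij] ([merged_cvg]). To pass
    to the limit under the integral, put [xi = ln (q t u / t)]. Potter's bound
    gives [xi - 2 d |xi| <= u - d/2 |u| + C] ([tail_quantile_bound]). When all
    rescaled power products exceed a fixed [r > 0], combining the [n] logarithmic
    inequalities with weights close to [b], which are positive because [b] is,
    bounds a constant by [sum_k (xi_k - 2 d |xi_k|)] plus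
    [sum_(kappa_j = 0) q_j ln X_j], where [q_j] is within [eps] of [beta_j]
    ([cone_estimate]). Exponentiating, the integrand is dominated by a multiple of
    [prod_k e^(u_k - d/2 |u_k|)] times the product of the
    [X_j^(beta_j + eps) + X_j^(beta_j - eps)], which is integrable by the moment
    hypotheses ([powers_dominated], [dominating_integrable]). Dominated
    convergence yields [rescaled_integral_cvg]: for bounded test functions that vanish where
    some coordinate is small and are continuous almost everywhere, the normalised
    integrals converge to the integral with respect to [limit_measure], the
    image of the product measure under the limiting power products.

    A linear change of variables with matrix [A_kappa] and the identity
    [b A_kappa = 1] factorise the mass of an upper orthant into one-dimensional
    exponential integrals, whence the explicit value ([limit_measure_above]). This
    value is continuous in the corner, so boundaries of upper orthants are null
    and [rescaled_integral_cvg] applies to their indicators ([tail_limit]). It also applies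
    to every continuous function vanishing near the boundary of the orthant, which
    is the convergence in the definition of regular variation
    ([law_scaling_limit]). Finally, translating [u] by [- kappa ln l] divides the
    limiting power products by [l] and multiplies [expm^n] by a constant, which
    is the homogeneity of the limit measure ([limit_measure_homogeneous]). *)

Set Implicit Arguments.
Unset Strict Implicit.
Unset Printing Implicit Defensive.
Import Order.TTheory GRing.Theory Num.Theory.
Import numFieldNormedType.Exports.

Local Open Scope classical_set_scope.
Local Open Scope ring_scope.

(** * Product measures on row vectors *)

Lemma emeasurable_prod d (T : measurableType d) (R : realType) (I : Type)
    (s : seq I) (P : pred I) (h : I -> T -> \bar R) :
  (forall i, measurable_fun setT (h i)) ->
  measurable_fun setT (fun w => \prod_(i <- s | P i) h i w)%E.
Proof.
move=> mh; elim: s => [|i s IHs].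
  by under eq_fun do rewrite big_nil; exact: measurable_cst.
under eq_fun do rewrite big_cons.
by case: (P i) => //; apply: emeasurable_funM.
Qed.

Lemma measurable_EFin_indic d (T : measurableType d) (R : realType) (A : set T) :
  measurable A -> measurable_fun setT (fun x => (\1_A x)%:E : \bar R).
Proof. by move=> mA; apply/measurable_EFinP; exact: measurable_indic. Qed.

Section row_measurability.
Context {R : realType}.

Definition rect n (B : 'I_n -> set R) : set (borel_rV R n) :=
  [set z | forall i, B i ((z : 'rV[R]_n) 0 i)].

Definition rects (n : nat) : set (set 'rV[R]_n) :=
  [set C | exists2 B : 'I_n -> set R, (forall i, measurable (B i)) & C = rect B].

Lemma measurable_coord n (i : 'I_n) :
  measurable_fun [set: borel_rV R n] (fun z => (z : 'rV[R]_n) 0 i).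
Proof.
apply: (measurability _ (RGenOpens.measurableE R)).
move=> _ [_ [a [b ->] <-]]; rewrite setTI; apply: sub_sigma_algebra.
by apply: open_comp; [move=> z _; exact: coord_continuous|exact: interval_open].
Qed.

Lemma measurable_rect n (B : 'I_n -> set R) :
  (forall i, measurable (B i)) -> measurable (rect B).
Proof.
move=> mB; rewrite (_ : rect B = \bigcap_(i in [set: 'I_n])
    (fun z : borel_rV R n => (z : 'rV[R]_n) 0 i) @^-1` B i).
  apply: fin_bigcap_measurable => // i _; rewrite -[X in measurable X]setTI.
  exact: measurable_coord.
by apply/seteqP; split=> z /= h => [i _|i]; exact: h.
Qed.

(** Open sets need not be approximated by boxes here: a map with measurable
    coordinates is measurable for the open sets, in particular the identity from
    the sigma-algebra of rectangles. *)
Lemma borel_rectsE n : @measurable _ (borel_rV R n) = <<s @rects n >>.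
Proof.
apply/seteqP; split; last first.
  apply: smallest_sub; first exact: sigma_algebra_measurable.
  by move=> _ [B mB ->]; exact: measurable_rect.
move=> C mC; rewrite -[C]preimage_id -[X in <<s _ >> X]setTI.
suff : measurable_fun [set: g_sigma_algebraType (@rects n)]
    (id : g_sigma_algebraType (@rects n) -> borel_rV R n) by move=> /(_ measurableT _ mC).
apply: measurable_row => i _ B mB; rewrite setTI; apply: sub_sigma_algebra.
exists (fun j => if j == i then B else setT) => [j|]; first by case: ifP.
apply/seteqP; split=> z /= => [Bz j|/(_ i)]; last by rewrite eqxx.
by case: eqP => // ->.
Qed.

Lemma rects_setI n : setI_closed (@rects n).
Proof.
move=> _ _ [B mB ->] [C mC ->]; exists (fun i => B i `&` C i) => [i|].
  exact: measurableI.
apply/seteqP; split=> z /=; first by move=> [Bz Cz] i; split; [exact: Bz|exact: Cz].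
by move=> BCz; split=> i; have [] := BCz i.
Qed.

Lemma rect_measure_unique n (G : nat -> 'I_n -> set R)
    (m1 m2 : {measure set (borel_rV R n) -> \bar R}) :
  (forall k i, measurable (G k i)) -> \bigcup_k rect (G k) = setT ->
  (forall B, (forall i, measurable (B i)) -> m1 (rect B) = m2 (rect B)) ->
  (forall k, (m1 (rect (G k)) < +oo)%E) ->
  forall C, measurable C -> m1 C = m2 C.
Proof.
move=> mG GT m12 m1G; apply: (@measure_unique _ R (borel_rV R n) (@rects n) (fun k => rect (G k))) => //.
- exact: borel_rectsE.
- exact: rects_setI.
- by move=> k; exists (G k).
- by move=> _ [B mB ->]; exact: m12.
Qed.

End row_measurability.

Section row_cons.
Context {R : realType} {n : nat}.

Definition row_cons (p : measurableTypeR R * borel_rV R n) : borel_rV R n.+1 :=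
  \row_i if unlift ord0 i is Some j then (p.2 : 'rV[R]_n) 0 j else p.1.

Lemma row_cons0 p : (row_cons p : 'rV[R]_n.+1) 0 ord0 = p.1.
Proof. by rewrite mxE unlift_none. Qed.

Lemma row_consS p i :
  (row_cons p : 'rV[R]_n.+1) 0 (lift ord0 i) = (p.2 : 'rV[R]_n) 0 i.
Proof. by rewrite mxE liftK. Qed.

Lemma measurable_row_cons : measurable_fun setT row_cons.
Proof.
apply: measurable_row => i; under eq_fun do rewrite mxE.
case: (unlift ord0 i) => [j|]; last exact: measurable_fst.
exact: (measurableT_comp (@measurable_coord R n j) measurable_snd).
Qed.

Lemma row_cons_rect (B : 'I_n.+1 -> set R) :
  row_cons @^-1` rect B = B ord0 `*` rect (fun i => B (lift ord0 i)).
Proof.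
apply/seteqP; split=> [p Bp|p [B0 Bp] i] /=.
  split=> [|i]; first by have := Bp ord0; rewrite row_cons0.
  by have := Bp (lift ord0 i); rewrite row_consS.
by case: (unliftP ord0 i) => [j|] ->; rewrite ?row_cons0 ?row_consS.
Qed.

End row_cons.

Section image_measure.
Context d d' (T : measurableType d) (T' : measurableType d') (R : realType).
(** The push-forward, carrying the proof of measurability so that it is a
    measure canonically. *)
Definition image_measure (mu : set T -> \bar R) (f : T -> T')
  (mf : measurable_fun setT f) : set T' -> \bar R := pushforward mu f.

Variables (mu : {measure set T -> \bar R}) (f : T -> T').
Hypothesis mf : measurable_fun setT f.
Local Notation image := (image_measure mu mf).

Let image0 : image set0 = 0%E.
Proof. by rewrite /image_measure /pushforward preimage_set0 measure0. Qed.

Let image_ge0 B : (0 <= image B)%E.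
Proof. exact: (measure_ge0 mu). Qed.

Let image_sigma_additive : semi_sigma_additive image.
Proof.
move=> F mF tF mUF; rewrite /image_measure /pushforward preimage_bigcup.
have mfF i : measurable (f @^-1` F i) by rewrite -[X in measurable X]setTI; exact: mf.
apply: measure_semi_sigma_additive => //; last exact: bigcup_measurable.
apply/trivIsetP => i j _ _ ij; rewrite -preimage_setI.
by move/trivIsetP : tF => -> //; rewrite preimage_set0.
Qed.

HB.instance Definition _ := isMeasure.Build _ _ _ image
  image0 image_ge0 image_sigma_additive.

Lemma ge0_integral_image (g : T' -> \bar R) :
  measurable_fun setT g -> (forall y, (0 <= g y)%E) ->
  (\int[image]_y g y = \int[mu]_x g (f x))%E.
Proof. by move=> mg g0; exact: (ge0_integral_pushforward mf mu measurableT mg). Qed.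

End image_measure.
Arguments image_measure {d d' T T' R} mu {f} mf.

Section image_probability.
Context d d' (T : measurableType d) (T' : measurableType d') (R : realType).
Variables (P : probability T R) (f : T -> T').
Hypothesis mf : measurable_fun setT f.

Let image_probability_setT : image_measure P mf setT = 1%E.
Proof. by rewrite /image_measure /pushforward preimage_setT probability_setT. Qed.

HB.instance Definition _ := Measure_isProbability.Build _ _ _
  (image_measure P mf) image_probability_setT.

End image_probability.

Section cons_measure.
Context {R : realType} {n : nat}.
Variables (m0 : {sigma_finite_measure set (measurableTypeR R) -> \bar R})
  (mn : {sigma_finite_measure set (borel_rV R n) -> \bar R}).

Definition cons_measure : set (borel_rV R n.+1) -> \bar R :=
  image_measure (m0 \x mn)%E (@measurable_row_cons R n).

HB.instance Definition _ := Measure.on cons_measure.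

Let cons_measure_sigma_finite : sigma_finite setT cons_measure.
Proof.
have /sigma_finiteP[F [FT ndF mF]] := sigma_finiteT m0.
have /sigma_finiteP[G [GT ndG mG]] := sigma_finiteT mn.
have mfst := @measurable_coord R n.+1 ord0.
have msnd : measurable_fun [set: borel_rV R n.+1]
    (fun z => \row_i (z : 'rV[R]_n.+1) 0 (lift ord0 i) : borel_rV R n).
  by apply: measurable_row => i; under eq_fun do rewrite mxE; exact: measurable_coord.
exists (fun k => (fun z : borel_rV R n.+1 => (z : 'rV[R]_n.+1) 0 ord0) @^-1` F k `&`
    (fun z => \row_i (z : 'rV[R]_n.+1) 0 (lift ord0 i) : borel_rV R n) @^-1` G k).
  apply/seteqP; split=> // z _.
  have [k1 _ Fk1] : (\bigcup_k F k) ((z : 'rV[R]_n.+1) 0 ord0) by rewrite -FT.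
  have [k2 _ Gk2] : (\bigcup_k G k)
    (\row_i (z : 'rV[R]_n.+1) 0 (lift ord0 i) : borel_rV R n) by rewrite -GT.
  exists (maxn k1 k2) => //; split.
    have /subsetPset := ndF k1 (maxn k1 k2) (leq_maxl _ _); exact.
  have /subsetPset := ndG k2 (maxn k1 k2) (leq_maxr _ _); exact.
move=> k; have [mFk Fk] := mF k; have [mGk Gk] := mG k; split.
  by apply: measurableI; rewrite -[X in measurable X]setTI; [exact: mfst|exact: msnd].
rewrite /cons_measure /image_measure /pushforward.
rewrite (_ : _ @^-1` _ = F k `*` G k).
  rewrite product_measure1E//; apply: lte_mul_pinfty => //.
  by rewrite ge0_fin_numE.
apply/seteqP; split=> -[x y] /=; rewrite row_cons0;
  rewrite (_ : \row_i _ = y) //; apply/rowP => i; rewrite mxE row_consS //.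
Qed.

HB.instance Definition _ := Measure_isSigmaFinite.Build _ _ _ cons_measure
  cons_measure_sigma_finite.

Lemma cons_measure_rect (B : 'I_n.+1 -> set R) : (forall i, measurable (B i)) ->
  cons_measure (rect B) = (m0 (B ord0) * mn (rect (fun i => B (lift ord0 i))))%E.
Proof.
move=> mB; rewrite /cons_measure /image_measure /pushforward row_cons_rect.
apply: product_measure1E; first exact: mB.
by apply: measurable_rect => i; exact: mB.
Qed.

(** The two orders of integration serve the triangular changes of variables: a
    lower triangular matrix needs the first coordinate innermost, an upper
    triangular one outermost. *)
Lemma ge0_integral_cons (f : borel_rV R n.+1 -> \bar R) :
  measurable_fun setT f -> (forall z, (0 <= f z)%E) ->
  (\int[cons_measure]_z f z = \int[m0]_x \int[mn]_y f (row_cons (x, y)))%E.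
Proof.
move=> mf f0; rewrite [LHS]ge0_integral_image //.
rewrite [LHS](fubini_tonelli1 (f \o @row_cons R n)) // => [|p]; last exact: f0.
by apply: measurableT_comp => //; exact: measurable_row_cons.
Qed.

Lemma ge0_integral_cons2 (f : borel_rV R n.+1 -> \bar R) :
  measurable_fun setT f -> (forall z, (0 <= f z)%E) ->
  (\int[cons_measure]_z f z = \int[mn]_y \int[m0]_x f (row_cons (x, y)))%E.
Proof.
move=> mf f0; rewrite [LHS]ge0_integral_image //.
rewrite [LHS](fubini_tonelli2 (f \o @row_cons R n)) // => [|p]; last exact: f0.
by apply: measurableT_comp => //; exact: measurable_row_cons.
Qed.

End cons_measure.

Section family_product.
Context {R : realType}.
Local Notation sfm := {sigma_finite_measure set (measurableTypeR R) -> \bar R}.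

(** Adding one coordinate at a time lets Tonelli's theorem for two factors drive
    all inductions on the dimension. *)
Fixpoint family_product n :
    ('I_n -> sfm) -> {sigma_finite_measure set (borel_rV R n) -> \bar R} :=
  match n with
  | 0%N => fun=> (\d_(0 : borel_rV R 0))
  | n'.+1 => fun m => cons_measure (m ord0) (family_product (fun i => m (lift ord0 i)))
  end.

Lemma family_product_rect n (m : 'I_n -> sfm) (B : 'I_n -> set R) :
  (forall i, measurable (B i)) ->
  family_product m (rect B) = (\prod_i m i (B i))%E.
Proof.
elim: n m B => [|n IHn] m B mB /=.
  by rewrite big_ord0 diracE mem_set //; case.
by rewrite cons_measure_rect // IHn // big_ord_recl.
Qed.

Lemma family_product_unique n (m : 'I_n -> sfm)
    (mu : {measure set (borel_rV R n) -> \bar R}) :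
  (forall B : 'I_n -> set R, (forall i, measurable (B i)) ->
     mu (rect B) = (\prod_i m i (B i))%E) ->
  forall C, measurable C -> family_product m C = mu C.
Proof.
move=> muE.
have F i : {F : (set (measurableTypeR R))^nat | setT = \bigcup_k F k /\
    nondecreasing_seq F /\ forall k, measurable (F k) /\ (m i (F k) < +oo)%E}.
  by apply: cid; have /sigma_finiteP[F [? ? ?]] := sigma_finiteT (m i); exists F.
apply: (@rect_measure_unique R n (fun k i => sval (F i) k)).
- by move=> k i; case: (F i) => /= G [_ [_ /(_ k)[]]].
- apply/seteqP; split=> // z _.
  have /choice[k kP] : forall i, exists k, sval (F i) k ((z : 'rV[R]_n) 0 i).
    move=> i; case: (F i) => /= G [GT _]; have : setT ((z : 'rV[R]_n) 0 i) by [].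
    by rewrite GT => -[k _ Gk]; exists k.
  exists (\max_i k i)%N => // i; case: (F i) (kP i) => /= G [_ [ndG _]].
  have /subsetPset := ndG (k i) (\max_i k i)%N (leq_bigmax i); exact.
- by move=> B mB; rewrite [LHS](family_product_rect m mB) muE.
- move=> k; rewrite [X in (X < _)%E](family_product_rect m) => [|i]; last first.
    by case: (F i) => /= G [_ [_ /(_ k)[]]].
  rewrite ltey_eq; apply/orP; left.
  apply: prode_fin_num => i _.
  by rewrite ge0_fin_numE //; case: (F i) => /= G [_ [_ /(_ k)[]]].
Qed.

Lemma ge0_integral_family_product_prod n (m : 'I_n -> sfm) (h : 'I_n -> R -> \bar R) :
  (forall i, measurable_fun setT (h i)) -> (forall i x, (0 <= h i x)%E) ->
  (\int[family_product m]_z \prod_i h i ((z : 'rV[R]_n) 0%R i) =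
   \prod_i \int[m i]_x h i x)%E.
Proof.
elim: n m h => [|n IHn] m h mh h0 /=.
  under eq_integral do rewrite big_ord0.
  by rewrite integral_cst // [X in (1 * X)%E]diracT mule1 big_ord0.
have mprod k (f : 'I_k -> R -> \bar R) : (forall i, measurable_fun setT (f i)) ->
    measurable_fun [set: borel_rV R k] (fun z => \prod_i f i ((z : 'rV[R]_k) 0%R i))%E.
  move=> mf; apply: emeasurable_prod => i.
  exact: (measurableT_comp (mf i) (@measurable_coord R k i)).
rewrite ge0_integral_cons; last 2 first.
- exact: mprod.
- by move=> z; apply: prode_ge0 => i _; exact: h0.
rewrite big_ord_recl -IHn => [|i|i x]; [|exact: mh|exact: h0].
rewrite -ge0_integralZr //; last 2 first.
- exact: mh.
- by apply: integral_ge0 => y _; apply: prode_ge0.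
apply: eq_integral => x _; rewrite -ge0_integralZl //; last 2 first.
- exact: (mprod n (fun i => h (lift ord0 i)) (fun i => mh _)).
- by move=> y _; apply: prode_ge0.
apply: eq_integral => y _; rewrite big_ord_recl row_cons0; congr (_ * _)%E.
by apply: eq_bigr => i _; rewrite row_consS.
Qed.

End family_product.

(** * Linear change of variables *)

Section lebesgue_affine.
Context {R : realType}.
Local Notation leb := (@lebesgue_measure R).

(** By uniqueness of Lebesgue measure it suffices to compare intervals. A negative
    [a] exchanges the endpoints, hence also which of them is included. *)
Lemma lebesgue_affine1 (a b : R) (f : R -> \bar R) : a != 0 ->
  measurable_fun setT f -> (forall x, (0 <= f x)%E) ->
  (`|a|%:E * \int[leb]_x f (x * a + b)%R = \int[leb]_x f x)%E.
Proof.
move=> a0 mf f0.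
have maff : measurable_fun [set: measurableTypeR R]
    (fun x => (x : R) * a + b : measurableTypeR R).
  by apply: measurable_funD => //; apply: measurable_funM.
have a0' : 0 < `|a| by rewrite normr_gt0.
pose k : {nonneg R} := NngNum (ltW a0').
have lebE A : measurable A -> leb A = mscale k (image_measure leb maff) A.
  apply: lebesgue_measure_unique => X /ocitvP[->|[[s t]/= st ->]].
    by rewrite !measure0.
  rewrite /mscale /image_measure /pushforward /= lebesgue_measure_itv /= lte_fin st.
  have [ap|an|/eqP] := ltgtP a 0; last by rewrite (negbTE a0).
  - have E : (fun x : R => x * a + b) @^-1` `]s, t]%classic =
        `[(t - b) / a, (s - b) / a[%classic.
      apply/seteqP; split=> x /=; rewrite !in_itv /= => /andP[h1 h2]; apply/andP; split.
      + by rewrite ler_ndivrMr // lerBrDr.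
      + by rewrite ltr_ndivlMr // ltrBlDr.
      + by rewrite -ltrBlDr -ltr_ndivlMr.
      + by rewrite -lerBrDr -ler_ndivrMr.
    rewrite [image_measure _ _ _](congr1 leb E) lebesgue_measure_itv /= lte_fin.
    rewrite ltr_ndivrMr // divfK // ltrD2r st.
    by rewrite -!EFinB -EFinM; congr EFin; rewrite ltr0_norm //; field.
  - have E : (fun x : R => x * a + b) @^-1` `]s, t]%classic =
        `](s - b) / a, (t - b) / a]%classic.
      apply/seteqP; split=> x /=; rewrite !in_itv /= => /andP[h1 h2]; apply/andP; split.
      + by rewrite ltr_pdivrMr // ltrBlDr.
      + by rewrite ler_pdivlMr // lerBrDr.
      + by rewrite -ltrBlDr -ltr_pdivrMr.
      + by rewrite -lerBrDr -ler_pdivlMr.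
    rewrite [image_measure _ _ _](congr1 leb E) lebesgue_measure_itv /= lte_fin.
    rewrite ltr_pdivrMr // divfK // ltrD2r st.
    by rewrite -!EFinB -EFinM; congr EFin; rewrite gtr0_norm //; field.
transitivity (\int[mscale k (image_measure leb maff)]_x f x)%E; last first.
  by apply: eq_measure_integral => A mA _; apply/esym/lebE.
by rewrite ge0_integral_mscale // ge0_integral_image.
Qed.

End lebesgue_affine.

Section affine_change_of_variables.
Context {R : realType}.
Local Notation leb := (@lebesgue_measure R).
Local Notation lebn n := (family_product (fun _ : 'I_n => leb)).

Lemma measurable_affine n (M : 'M[R]_n) (s : 'rV[R]_n) :
  measurable_fun setT (fun z : borel_rV R n => ((z : 'rV[R]_n) *m M + s : borel_rV R n)).
Proof.
apply: measurable_row => i.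
under eq_fun do rewrite mxE mxE.
apply: measurable_funD => //; apply: measurable_sum => j.
by apply: measurable_funM => //; exact: measurable_coord.
Qed.

(** [z |-> z M + s] multiplies volume by [|c|]. The translation [s] is part of the
    property since eliminating one variable of a triangular system shifts the
    others. *)
Definition lebesgue_scales n (M : 'M[R]_n) (c : R) := forall s f,
  measurable_fun setT f -> (forall z, (0 <= f z)%E) ->
  (`|c|%:E * \int[lebn n]_z f (((z : 'rV[R]_n) *m M + s)%R : borel_rV R n)
   = \int[lebn n]_z f z)%E.

Lemma lebesgue_scalesM n (M N : 'M[R]_n) c d :
  lebesgue_scales M c -> lebesgue_scales N d -> lebesgue_scales (M *m N) (c * d).
Proof.
move=> HM HN s f mf f0; rewrite -[RHS](HN s f mf f0).
pose g (z : borel_rV R n) := f (((z : 'rV[R]_n) *m N + s)%R : borel_rV R n).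
have mg : measurable_fun setT g.
  by apply: (measurableT_comp mf); exact: measurable_affine.
rewrite -[X in (_ * X = _)%E]/(\int[lebn n]_z _)%E.
have := HM 0 g mg (fun z => f0 _); rewrite /g => <-.
rewrite muleA -EFinM normrM mulrC; congr (_ * _)%E.
by apply: eq_integral => z _; rewrite addr0 mulmxA.
Qed.

(** The transformed measure agrees with the product measure on rectangles, whose
    sides are permuted and translated. *)
Lemma lebesgue_scales_perm n (p : 'S_n) : lebesgue_scales (perm_mx p : 'M[R]_n) 1.
Proof.
move=> s f mf f0; rewrite normr1 mul1e.
have m1 := measurable_affine (perm_mx p) s.
transitivity (\int[image_measure (lebn n) m1]_z f z)%E.
  by rewrite ge0_integral_image.
apply: eq_measure_integral => A mA _; apply/esym.
apply: family_product_unique => // B mB.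
have mt c C : measurable C -> measurable [set x : R | C (x + c)].
  move=> mC; rewrite -[X in measurable X]setTI.
  have : measurable_fun [set: R] (fun x => x + c) by apply: measurable_funD; [exact: measurable_id|exact: measurable_cst].
  by move=> /(_ measurableT _ mC).
have E : (fun z : borel_rV R n => (z : 'rV[R]_n) *m perm_mx p + s) @^-1` rect B =
    rect (fun i => [set x | B (p i) (x + s 0 (p i))]).
  have zp (z : 'rV[R]_n) i : (z *m perm_mx p + s) 0 (p i) = z 0 i + s 0 (p i).
    by rewrite mxE -[p]invgK -col_permE mxE invgK permK.
  apply/seteqP; split=> z /= h i; first by rewrite /= -zp; exact: h.
  by have := h (p^-1%g i); rewrite /= -zp permKV.
rewrite [LHS](congr1 (lebn n) E).
rewrite [LHS](family_product_rect (fun=> leb)) => [|i]; last by apply: mt; exact: mB.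
rewrite [RHS](reindex_inj (@perm_inj _ p)); apply: eq_bigr => i _ /=.
have mBi : measurable_fun [set: R] (EFin \o \1_(B (p i)) : R -> \bar R).
  by apply/measurable_EFinP; apply: measurable_indic; exact: mB.
have := lebesgue_affine1 (s 0 (p i)) (oner_neq0 R) mBi.
rewrite normr1 mul1e => E2.
have -> : leb (B (p i)) = (\int[leb]_x (\1_(B (p i)) x)%:E)%E.
  by rewrite [RHS](integral_indic leb measurableT (mB (p i))) setIT.
rewrite -E2; last by move=> x; rewrite lee_fin.
rewrite -[X in leb X]setIT -[LHS](integral_indic leb measurableT (mt _ _ (mB (p i)))).
by apply: eq_integral => x _ /=; rewrite mulr1.
Qed.

(** Block form of an affine map, separating the first coordinate; for a triangular
    [M] one of the two off-diagonal blocks vanishes. *)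
Lemma row_cons_affine n (M : 'M[R]_n.+1) (s : 'rV[R]_n.+1) x (y : 'rV[R]_n) :
  row_cons (x, y) *m M + s =
  row_cons (x * M ord0 ord0 + (\sum_i y 0 i * M (lift ord0 i) ord0 + s 0 ord0),
    y *m row' ord0 (col' ord0 M) +
      (x *: col' ord0 (row ord0 M) + col' ord0 s)).
Proof.
apply/rowP => j; rewrite mxE [in LHS]mxE big_ord_recl row_cons0.
under eq_bigr do rewrite row_consS.
case: (unliftP ord0 j) => [k|] ->; last by rewrite row_cons0 /= addrA.
rewrite row_consS !mxE /=; under [in RHS]eq_bigr do rewrite !mxE.
by ring.
Qed.

Lemma lebesgue_scales_lower n (M : 'M[R]_n) : is_trig_mx M ->
  (forall i, M i i != 0) -> lebesgue_scales M (\prod_i M i i).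
Proof.
elim: n M => [|n IHn] M /is_trig_mxP Mt M0 s f mf f0.
  rewrite big_ord0 normr1 mul1e; apply: eq_integral => z _.
  by rewrite (_ : _ + _ = z) //; apply/rowP => -[].
have mc : measurable_fun setT (f \o @row_cons R n).
  exact: (measurableT_comp mf (@measurable_row_cons R n)).
have mfa : measurable_fun setT (fun z : borel_rV R n.+1 =>
    f (((z : 'rV[R]_n.+1) *m M + s)%R : borel_rV R n.+1)).
  by apply: (measurableT_comp mf); exact: measurable_affine.
rewrite [in LHS]ge0_integral_cons2 // [RHS]ge0_integral_cons2 //.
rewrite big_ord_recl normrM mulrC EFinM -muleA -ge0_integralZl //; last 2 first.
- apply: (measurable_fun_fubini_tonelli_G (fun p =>
    f (((row_cons p : 'rV[R]_n.+1) *m M + s)%R : borel_rV R n.+1))) => //.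
  by apply: (measurableT_comp mfa); exact: measurable_row_cons.
- by move=> y _; exact: integral_ge0.
have E0 : col' ord0 (row ord0 M) = 0.
  by apply/rowP => j; rewrite !mxE Mt.
pose G (y : borel_rV R n) := (\int[leb]_x f (row_cons (x, y)))%E.
have mG : measurable_fun setT G.
  exact: (measurable_fun_fubini_tonelli_G (f \o @row_cons R n) mc (fun p => f0 _)).
have G0 y : (0 <= G y)%E by exact: integral_ge0.
have -> : \prod_(i < n) M (lift ord0 i) (lift ord0 i) =
    \prod_i (row' ord0 (col' ord0 M)) i i by apply: eq_bigr => i _; rewrite !mxE.
rewrite -[RHS](IHn (row' ord0 (col' ord0 M)) _ _ (col' ord0 s)) //; last 2 first.
- by apply/is_trig_mxP => i j ij; rewrite !mxE Mt.
- by move=> i; rewrite !mxE.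
congr (_ * _)%E; apply: eq_integral => y _.
under eq_integral do rewrite row_cons_affine E0 scaler0 add0r.
apply: (lebesgue_affine1 _ (f := fun x => f (row_cons (x,
    ((y : 'rV[R]_n) *m row' ord0 (col' ord0 M) + col' ord0 s)%R : borel_rV R n)))) => //.
apply: (measurableT_comp mc); exact: measurable_fun_pair.
Qed.

Lemma lebesgue_scales_upper n (M : 'M[R]_n) : is_trig_mx M^T ->
  (forall i, M i i != 0) -> lebesgue_scales M (\prod_i M i i).
Proof.
elim: n M => [|n IHn] M /is_trig_mxP Mt M0 s f mf f0.
  rewrite big_ord0 normr1 mul1e; apply: eq_integral => z _.
  by rewrite (_ : _ + _ = z) //; apply/rowP => -[].
have mc : measurable_fun setT (f \o @row_cons R n).
  exact: (measurableT_comp mf (@measurable_row_cons R n)).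
have mfa : measurable_fun setT (fun z : borel_rV R n.+1 =>
    f (((z : 'rV[R]_n.+1) *m M + s)%R : borel_rV R n.+1)).
  by apply: (measurableT_comp mf); exact: measurable_affine.
rewrite [in LHS]ge0_integral_cons // [RHS]ge0_integral_cons //.
rewrite big_ord_recl normrM EFinM -muleA -ge0_integralZl //; last 2 first.
- apply: (measurable_fun_fubini_tonelli_F (fun p =>
    f (((row_cons p : 'rV[R]_n.+1) *m M + s)%R : borel_rV R n.+1))) => //.
  by apply: (measurableT_comp mfa); exact: measurable_row_cons.
- by move=> y _; exact: integral_ge0.
have E0 y : \sum_(i < n) (y : 'rV[R]_n) 0 i * M (lift ord0 i) ord0 = 0.
  by rewrite big1 // => i _; have := Mt ord0 (lift ord0 i); rewrite mxE => ->; rewrite ?mulr0.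
pose F (x : R) := (\int[lebn n]_y f (row_cons (x, y)))%E.
have mF : measurable_fun setT F.
  exact: (measurable_fun_fubini_tonelli_F (f \o @row_cons R n) mc (fun p => f0 _)).
have F0 y : (0 <= F y)%E by exact: integral_ge0.
rewrite -[RHS](lebesgue_affine1 (s 0 ord0) (M0 ord0) mF F0).
congr (_ * _)%E; apply: eq_integral => x _.
have -> : \prod_(i < n) M (lift ord0 i) (lift ord0 i) =
    \prod_i (row' ord0 (col' ord0 M)) i i by apply: eq_bigr => i _; rewrite !mxE.
under eq_integral do rewrite row_cons_affine E0 add0r.
apply: (IHn (row' ord0 (col' ord0 M)) _ _ (x *: col' ord0 (row ord0 M) + col' ord0 s)
    (fun y => f (row_cons (x * M ord0 ord0 + s 0 ord0, y)))) => //.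
- by apply/is_trig_mxP => i j ij; have := Mt (lift ord0 i) (lift ord0 j); rewrite !mxE => ->.
- by move=> i; rewrite !mxE.
- apply: (measurableT_comp mc); exact: measurable_fun_pair.
Qed.

(** An LUP decomposition reduces the claim to permutations and triangular
    matrices. *)
Lemma lebesgue_scales_unit n (M : 'M[R]_n) : M \in unitmx ->
  lebesgue_scales M (\det M).
Proof.
case: n M => [|n] M uM.
  have := @lebesgue_scales_perm 0 1%g; rewrite perm_mx1.
  by rewrite (_ : M = 1%:M) ?det1 //; apply/matrixP => -[].
have := cormen_lup_correct M; have := cormen_lup_perm M; have := cormen_lup_detL M.
have := @cormen_lup_lower _ _ M; have := @cormen_lup_upper _ _ M.
case: (cormen_lup M) => [[P L] U] /= Uu Ll detL /is_perm_mxP[p ->] PMLU.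
have detM : \det M = \det (perm_mx p^-1 : 'M[R]_n.+1) * (\det L * \det U).
  by rewrite -!det_mulmx -[L *m U]PMLU mulmxA -perm_mxM mulVg perm_mx1 mul1mx.
have -> : M = perm_mx p^-1 *m (L *m U).
  by rewrite -[L *m U]PMLU mulmxA -perm_mxM mulVg perm_mx1 mul1mx.
have Lt : is_trig_mx L.
  by apply/is_trig_mxP => i j ij; rewrite Ll ?(ltnW ij) // -val_eqE (ltn_eqF ij).
have Ut : is_trig_mx U^T by apply/is_trig_mxP => i j ij; rewrite mxE Uu.
have detU : \det U = \prod_i U i i.
  by rewrite -det_tr det_trig //; apply: eq_bigr => i _; rewrite mxE.
have U0 i : U i i != 0.
  move: uM; rewrite unitmxE unitfE detM !mulf_eq0 !negb_or => /and3P[_ _].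
  by rewrite detU => /prodf_neq0; exact.
have L1 i : L i i = 1 by rewrite Ll ?eqxx.
rewrite !det_mulmx => s f mf f0.
have := lebesgue_scalesM (lebesgue_scales_perm p^-1%g) (lebesgue_scalesM
  (lebesgue_scales_lower Lt (fun i => _)) (lebesgue_scales_upper Ut U0)).
rewrite -detU -det_trig // => /(_ _) H.
rewrite -[RHS](H _ s f mf f0); last by move=> i; rewrite L1 oner_neq0.
by rewrite !normrM det_perm normrX normrN normr1 expr1n.
Qed.

End affine_change_of_variables.

(** * The measure with density exp(-u) on the line *)

Lemma ge0_integral_mrestr d (T : measurableType d) (R : realType)
    (mu : {measure set T -> \bar R}) (D : set T) (mD : measurable D)
    (f : T -> \bar R) :
  measurable_fun setT f -> (forall x, (0 <= f x)%E) ->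
  (\int[mrestr mu mD]_x f x = \int[mu]_(x in D) f x)%E.
Proof.
move=> mf f0; rewrite -[in LHS](setUv D) ge0_integral_setU //; last 3 first.
- exact: measurableC.
- by rewrite setUv.
- exact/disj_setPCl.
rewrite [X in (_ + X)%E](_ : _ = 0%E) ?adde0; last first.
  apply: null_set_integral => //.
  - exact: measurableC.
  - exact: measurable_funTS.
  - by rewrite /= /mrestr setICl measure0.
apply: eq_measure_integral => A mA AD.
by rewrite /= /mrestr setIidl.
Qed.

Section exponential_integral.
Context {R : realType}.
Local Notation leb := (@lebesgue_measure R).

(** The substitution [y = b (x - c)] turns the integral into the total mass of the
    exponential distribution. *)
Lemma integral_expR_tail (b c : R) : 0 < b ->
  (\int[leb]_(x in `]c, +oo[) (expR (- b * x))%:E = (expR (- b * c) / b)%:E)%E.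
Proof.
move=> b0.
have me : measurable_fun [set: R] (EFin \o (fun x => expR (- b * x)) : R -> \bar R).
  apply/measurable_EFinP; apply: (measurableT_comp (@measurable_expR R)).
  by apply: measurable_funM => //; exact: measurable_cst.
rewrite integral_itv_obnd_cbnd; last exact: measurable_funTS.
have mp : measurable_fun [set: R] (EFin \o exponential_pdf 1 : R -> \bar R).
  by apply/measurable_EFinP; exact: measurable_exponential_pdf.
have := lebesgue_affine1 (- (b * c)) (lt0r_neq0 b0) mp.
move=> /(_ (fun x => exponential_pdf_ge0 ler01 x)) /=.
rewrite integral_exponential_pdf //.
rewrite gtr0_norm // => H; rewrite integral_mkcond.
rewrite -[RHS]mule1 -{}H muleA -EFinM divfK ?gt_eqF // -ge0_integralZl //; last 2 first.
- have ma : measurable_fun [set: R] (fun x => x * b - b * c).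
    apply: measurable_funB => //.
    by apply: measurable_funM => //; exact: measurable_cst.
  exact: (measurableT_comp mp ma).
- by move=> x _; rewrite lee_fin exponential_pdf_ge0 ?ler01.
apply: eq_integral => x _; rewrite /exponential_pdf !patchE.
rewrite !mem_setE !in_itv /= !andbT subr_ge0 [x * b]mulrC ler_pM2l //.
case: ifPn => _; rewrite ?mule0 // -EFinM mul1r -expRD; congr (expR _)%:E.
by ring.
Qed.

(** The measure with density [expR (- u)], realised as the area under that
    graph so that Tonelli's theorem gives its integrals. *)
Definition under_expR : set (measurableTypeR R * measurableTypeR R) :=
  [set p | 0 < (p.2 : R) < expR (- (p.1 : R))].

Lemma measurable_under_expR : measurable under_expR.
Proof.
rewrite -[X in measurable X]setTI.
have := @measurable_and _ _ setT (fun p : measurableTypeR R * measurableTypeR R => 0 < (p.2 : R))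
  (fun p => (p.2 : R) < expR (- (p.1 : R))).
move=> H; apply: (H _ _ measurableT [set true]) => //.
- by apply: measurable_fun_ltr => //; exact: measurable_cst.
- apply: measurable_fun_ltr => //; apply: measurableT_comp => //.
  exact: measurableT_comp.
Qed.

Definition expm : set (measurableTypeR R) -> \bar R :=
  image_measure (mrestr (leb \x leb)%E measurable_under_expR) measurable_fst.

HB.instance Definition _ := Measure.on expm.

Lemma ge0_integral_expm (f : R -> \bar R) :
  measurable_fun setT f -> (forall x, (0 <= f x)%E) ->
  (\int[expm]_u f u = \int[leb]_u (f u * (expR (- u))%:E))%E.
Proof.
move=> mf f0; rewrite [LHS]ge0_integral_image // ge0_integral_mrestr //; last first.
  exact: measurableT_comp.
rewrite integral_mkcond [LHS]fubini_tonelli1 //; last 2 first.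
- apply/(measurable_restrictT (f \o fst) measurable_under_expR).
  by apply: measurable_funTS; exact: measurableT_comp.
- by move=> p; rewrite patchE; case: ifP => _ //; exact: f0.
apply: eq_integral => u _; rewrite /fubini_F.
transitivity (\int[leb]_s (f u * (\1_(`]0, expR (- u)[) s)%:E))%E.
  apply: eq_integral => s _; rewrite patchE indicE.
  rewrite (_ : ((u, s) \in under_expR) = (s \in `]0, expR (- u)[%classic)).
    by case: ifPn => _; rewrite ?mule1 ?mule0.
  by apply/idP/idP => /set_mem h; apply/mem_set; move: h; rewrite /under_expR /= in_itv.
rewrite ge0_integralZl //; last first.
  by apply/measurable_EFinP; exact: measurable_indic.
rewrite integral_indic // setIT [X in (_ * X)%E]lebesgue_measure_itv /= lte_fin expR_gt0.
by rewrite oppr0 adde0.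
Qed.

Lemma expm_ray (c : R) : expm `]c, +oo[%classic = (expR (- c))%:E.
Proof.
rewrite -[X in expm X]setIT -[LHS](integral_indic expm) // ge0_integral_expm //; last first.
  exact: measurable_EFin_indic.
rewrite -[RHS]mule1 -[in RHS]invr1 -EFinM -mulN1r -integral_expR_tail // [RHS]integral_mkcond.
apply: eq_integral => x _; rewrite patchE indicE.
by case: ifPn => _; rewrite ?mul1e ?mul0e // mulN1r.
Qed.

Let expm_sigma_finite : sigma_finite setT expm.
Proof.
exists (fun k => `](- k%:R), +oo[%classic) => [|k].
  apply/seteqP; split=> // x _.
  exists (Num.trunc `|x|).+1 => //=; rewrite in_itv /= andbT ltrNl.
  by rewrite (le_lt_trans (ler_norm _)) // normrN truncnS_gt.
by split => //; rewrite [X in (X < _)%E]expm_ray ltry.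
Qed.

HB.instance Definition _ := Measure_isSigmaFinite.Build _ _ _ expm
  expm_sigma_finite.

End exponential_integral.

Section exponential_family.
Context {R : realType}.
Local Notation leb := (@lebesgue_measure R).
Local Notation lebn n := (family_product (fun _ : 'I_n => leb)).
Local Notation expn n := (family_product (fun _ : 'I_n => @expm R)).

Lemma indic_forall n (T : Type) (S : set T) z (B : 'I_n -> set R) (y : 'I_n -> R) :
  (S z <-> forall i, B i (y i)) -> \1_S z = \prod_i \1_(B i) (y i) :> R.
Proof.
move=> SB; have [Sz|nSz] := pselect (S z).
  rewrite indicE mem_set // big1 // => i _.
  by rewrite indicE mem_set //; exact: SB.1.
rewrite indicE memNset //.
have /existsNP[i nBi] : ~ forall i, B i (y i) by move=> /SB.2.
by rewrite (bigD1 i) //= indicE memNset // mul0r.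
Qed.

Lemma measurable_expR_sum n :
  measurable_fun setT (fun z : borel_rV R n => (expR (- \sum_i (z : 'rV[R]_n) 0 i))%:E).
Proof.
apply/measurable_EFinP; apply: (measurableT_comp (@measurable_expR R)).
apply: measurableT_comp => //; apply: measurable_sum => i; exact: measurable_coord.
Qed.

Lemma ge0_integral_expn n (f : borel_rV R n -> \bar R) :
  measurable_fun setT f -> (forall z, (0 <= f z)%E) ->
  (\int[expn n]_z f z =
   \int[lebn n]_z (f z * (expR (- \sum_i (z : 'rV[R]_n) 0%R i))%:E))%E.
Proof.
elim: n f => [|n IHn] f mf f0.
  by apply: eq_integral => z _; rewrite big_ord0 oppr0 expR0 mule1.
have mc : measurable_fun setT (f \o @row_cons R n).
  exact: (measurableT_comp mf (@measurable_row_cons R n)).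
rewrite [LHS]ge0_integral_cons // [RHS]ge0_integral_cons //; last 2 first.
- by apply: emeasurable_funM => //; exact: measurable_expR_sum.
- by move=> z; rewrite mule_ge0 // lee_fin expR_ge0.
rewrite ge0_integral_expm //; last 2 first.
- exact: (measurable_fun_fubini_tonelli_F (f \o @row_cons R n) mc (fun p => f0 _)).
- by move=> x; exact: integral_ge0.
apply: eq_integral => x _.
have mcx : measurable_fun setT (fun y : borel_rV R n => f (row_cons (x, y))).
  by apply: (measurableT_comp mc); exact: measurable_fun_pair.
rewrite IHn // -ge0_integralZr //; last 2 first.
- by apply: emeasurable_funM => //; exact: measurable_expR_sum.
- by move=> z _; rewrite mule_ge0 // lee_fin expR_ge0.
apply: eq_integral => y _; rewrite -muleA -EFinM -expRD; congr (_ * (expR _)%:E)%E.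
rewrite big_ord_recl row_cons0 opprD addrC; congr (_ - _).
by apply: eq_bigr => i _; rewrite row_consS.
Qed.

(** Translation invariance of Lebesgue measure, with the density contributing the
    factor. *)
Lemma expn_translate n (s : 'rV[R]_n) (f : borel_rV R n -> \bar R) :
  measurable_fun setT f -> (forall z, (0 <= f z)%E) ->
  (\int[expn n]_z f (((z : 'rV[R]_n) + s)%R : borel_rV R n) =
   (expR (\sum_i s 0%R i))%:E * \int[expn n]_z f z)%E.
Proof.
move=> mf f0.
have mfs : measurable_fun setT (fun z : borel_rV R n => f (((z : 'rV[R]_n) + s)%R : borel_rV R n)).
  apply: (measurableT_comp mf); have := measurable_affine 1%:M s.
  by under eq_fun do rewrite mulmx1.
rewrite !ge0_integral_expn // -ge0_integralZl //; last 2 first.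
- by apply: emeasurable_funM => //; exact: measurable_expR_sum.
- by move=> z _; rewrite mule_ge0 // lee_fin expR_ge0.
have := @lebesgue_scales_unit R n 1%:M (unitmx1 _ _) s
  (fun z : borel_rV R n => (expR (\sum_i s 0%R i))%:E * (f z * (expR (- \sum_i (z : 'rV[R]_n) 0%R i))%:E))%E.
rewrite det1 normr1 mul1e => <-; last 2 first.
- apply: emeasurable_funM; first exact: measurable_cst.
  by apply: emeasurable_funM => //; exact: measurable_expR_sum.
- by move=> z; rewrite !mule_ge0 // lee_fin expR_ge0.
apply: eq_integral => z _; rewrite mulmx1 muleCA -EFinM -expRD; congr (_ * (expR _)%:E)%E.
have -> : \sum_i ((z : 'rV[R]_n) + s) 0 i = \sum_i (z : 'rV[R]_n) 0 i + \sum_i s 0 i.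
  by rewrite -big_split; apply: eq_bigr => i _; rewrite mxE.
by ring.
Qed.

(** In the coordinates [y = z M] the density is [exp (- sum_i b_i y_i)] and the
    set is a product of half-lines, so the integral factorises. *)
Lemma expn_linear_tail n (M : 'M[R]_n) (b v : 'rV[R]_n) : M \in unitmx ->
  (forall i, 0 < b 0 i) -> (forall z : 'rV[R]_n, \sum_i (z *m M) 0 i * b 0 i = \sum_i z 0 i) ->
  expn n [set z | forall i, v 0 i < ((z : 'rV[R]_n) *m M) 0 i] =
  (`|\det M|^-1 * \prod_i (expR (- b 0 i * v 0 i) / b 0 i))%:E.
Proof.
move=> uM b0 Mb; set S := [set z | _].
pose B i := `](v 0 i), +oo[%classic : set R.
have mS : measurable (S : set (borel_rV R n)).
  rewrite (_ : S = (fun z : borel_rV R n => (z : 'rV[R]_n) *m M + 0) @^-1` rect B).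
    rewrite -[X in measurable X]setTI; apply: (measurable_affine M 0) => //.
    by apply: measurable_rect => i; exact: measurable_itv.
  by apply/seteqP; split=> z /= h i; have := h i; rewrite /B /= addr0 in_itv /= andbT.
pose h i (y : R) := ((\1_(B i) y)%:E * (expR (- b 0 i * y))%:E)%E.
have me i : measurable_fun [set: R] (fun y => (expR (- b 0 i * y))%:E).
  apply/measurable_EFinP; apply: (measurableT_comp (@measurable_expR R)).
  by apply: measurable_funM => //; exact: measurable_cst.
have mh i : measurable_fun [set: R] (h i).
  by apply: emeasurable_funM => //; apply: measurable_EFin_indic; exact: measurable_itv.
have h0 i y : (0 <= h i y)%E by rewrite mule_ge0 // lee_fin ?expR_ge0.
have ih i : (\int[leb]_y h i y = (expR (- b 0%R i * v 0%R i) / b 0%R i)%:E)%E.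
  rewrite -integral_expR_tail // [RHS]integral_mkcond; apply: eq_integral => y _.
  by rewrite patchE /h indicE; case: ifPn => _; rewrite ?mul1e ?mul0e.
rewrite -[X in expn n X]setIT -[LHS](integral_indic (expn n)) // ge0_integral_expn //; last first.
  exact: measurable_EFin_indic.
pose G (z : borel_rV R n) := (\prod_i h i ((z : 'rV[R]_n) 0%R i))%E.
have mG : measurable_fun setT G.
  by apply: emeasurable_prod => i; exact: (measurableT_comp (mh i) (@measurable_coord R n i)).
have G0 z : (0 <= G z)%E by apply: prode_ge0.
have d0 : \det M != 0 by rewrite -unitfE -unitmxE.
have GE z : ((\1_S z)%:E * (expR (- \sum_i (z : 'rV[R]_n) 0%R i))%:E)%E =
    G (((z : 'rV[R]_n) *m M + 0)%R : borel_rV R n).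
  rewrite /G addr0 /h.
  have -> : (\prod_i ((\1_(B i) (((z : 'rV[R]_n) *m M)%R 0%R i))%:E *
     (expR (- b 0%R i * ((z : 'rV[R]_n) *m M)%R 0%R i))%:E))%E =
     (\prod_i \1_(B i) (((z : 'rV[R]_n) *m M) 0 i) *
      \prod_i expR (- b 0 i * ((z : 'rV[R]_n) *m M) 0 i))%:E.
    by rewrite -big_split /= -prodEFin.
  rewrite -EFinM; congr EFin; congr (_ * _).
    by apply: indic_forall; split=> Sz i; have := Sz i; rewrite /B /= in_itv /= andbT.
  rewrite -expR_sum -Mb; congr expR.
  rewrite -sumrN; apply: eq_bigr => i _; ring.
under eq_integral do rewrite GE.
have := lebesgue_scales_unit uM 0 mG G0.
rewrite /G [X in _ = X -> _]ge0_integral_family_product_prod //.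
rewrite (eq_bigr (fun i => (expR (- b 0 i * v 0 i) / b 0 i)%:E)) => [|i _]; last exact: ih.
rewrite prodEFin => H.
rewrite EFinM -H muleA -EFinM mulVf ?normr_eq0 // mul1e.
by [].
Qed.

(** With respect to Lebesgue measure the integrand is [exp (- d |u|)], which is at
    most [exp (- d u)] or its reflection. The half-line starts at [-1] so that it
    contains [0] even though it is open. *)
Lemma expm_two_sided_lty (d : R) : 0 < d ->
  (\int[@expm R]_u (expR (u - d * `|u|))%:E < +oo)%E.
Proof.
move=> d0.
have ml (a : R) : measurable_fun [set: R] (fun u => a * u).
  by apply: measurable_funM => //; exact: measurable_cst.
have me : measurable_fun [set: R] (fun u => (expR (u - d * `|u|))%:E).
  apply/measurable_EFinP; apply: (measurableT_comp (@measurable_expR R)).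
  apply: measurable_funB => //; apply: measurable_funM; first exact: measurable_cst.
  exact: normr_measurable.
rewrite ge0_integral_expm //.
pose f u := ((EFin \o (fun u : R => expR (- d * u))) \_ (`]-1, +oo[%classic : set R)) u : \bar R.
have mf : measurable_fun [set: R] f.
  apply/(measurable_restrictT (EFin \o (fun u : R => expR (- d * u))) (measurable_itv `]-1, +oo[)).
  apply: measurable_funTS.
  by apply/measurable_EFinP; apply: (measurableT_comp (@measurable_expR R)).
have f0 u : (0 <= f u)%E by rewrite /f patchE; case: ifP => // _; rewrite lee_fin expR_ge0.
have intf : (\int[leb]_u f u < +oo)%E by rewrite -integral_mkcond integral_expR_tail // ltry.
have mfN : measurable_fun [set: R] (fun u => f (- u)) by exact: measurableT_comp.
apply: (@le_lt_trans _ _ (\int[leb]_u (f u + f (- u)%R))%E).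
  apply: ge0_le_integral => //.
  - apply: emeasurable_funM => //; apply/measurable_EFinP.
    exact: (measurableT_comp (@measurable_expR R) (@oppr_measurable R setT)).
  - by apply: emeasurable_funD.
  move=> u _; rewrite -EFinM -expRD.
  have [u0|u0] := leP 0 u.
    rewrite -[leLHS]adde0 leeD // /f patchE mem_set /= ?in_itv /= ?andbT; last by lra.
    by rewrite lee_fin ler_expR ger0_norm //; lra.
  rewrite -[leLHS]add0e leeD // /f patchE mem_set /= ?in_itv /= ?andbT; last by lra.
  by rewrite lee_fin ler_expR ltr0_norm //; lra.
rewrite ge0_integralD //; apply: lte_add_pinfty => //.
have := lebesgue_affine1 0 (ltr0_neq0 (ltrN10 R)) mf f0.
rewrite normrN1 mul1e => H.
rewrite (_ : (\int[_]_u _)%E = (\int[leb]_u f u)%E) // -H.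
by apply: eq_integral => u _; rewrite addr0 mulrN1.
Qed.

End exponential_family.

(** * Regularly varying tails *)

Section regularly_varying_tail.
Context {R : realType}.
Variable G : R -> R.
Hypothesis G_gt0 : forall s, 0 < G s.
Hypothesis G_le1 : forall s, G s <= 1.
Hypothesis G_noninc : forall s t, s <= t -> G t <= G s.
Hypothesis G_rv : regularly_varying G (- 1).

Lemma tail_ratio_cvg l : 0 < l -> G (l * x) / G x @[x --> +oo] --> l^-1.
Proof. by move=> l0; rewrite -powR_inv1 ?ltW //; exact: G_rv. Qed.

(** Potter's bound in logarithmic coordinates. Far out, each unit step of
    [x = ln t] changes [g x = ln (G (e^x))] by [-1] up to [d]; the bound follows by
    counting steps and using monotonicity in between. For [t e^h] below the range
    where this applies, [g <= 0] and the steps from [x0] up to [x] are enough. *)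
Lemma potter_bound (d : R) : 0 < d < 1 -> exists C t0 : R, [/\ 0 <= C, 0 < t0 &
  forall t h, t0 <= t -> ln (G (t * expR h)) - ln (G t) <= - h + d * `|h| + C].
Proof.
move=> /andP[d0 d1].
pose g x := ln (G (expR x)).
have g_noninc x y : x <= y -> g y <= g x.
  by move=> xy; rewrite /g ler_ln ?posrE // G_noninc // ler_expR.
have g_le0 x : g x <= 0 by rewrite /g ln_le0 // G_le1.
have [x0 step] : exists x0, forall x, x0 <= x ->
    - 1 - d <= g (x + 1) - g x <= - 1 + d.
  have ce := tail_ratio_cvg (expR_gt0 1).
  have lo : expR (- 1 - d) < (expR 1)^-1 by rewrite -expRN ltr_expR; lra.
  have hi : (expR 1)^-1 < expR (- 1 + d) by rewrite -expRN ltr_expR; lra.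
  have [M [_ HM]] : \forall x \near +oo,
      expR (- 1 - d) <= G (expR 1 * x) / G x <= expR (- 1 + d).
    near=> x; apply/andP; split.
      by near: x; exact: (cvgr_ge _ ce).
    by near: x; exact: (cvgr_le _ ce).
  exists (ln (Num.max 1 (M + 1))) => x x0.
  have Mx : M < expR x.
    apply: (@lt_le_trans _ _ (Num.max 1 (M + 1))).
      by rewrite lt_max ltrDl ltr01 orbT.
    by rewrite -[leLHS]lnK ?ler_expR // posrE lt_max ltr01.
  have /andP[h1 h2] := HM _ Mx.
  rewrite /g -ln_div ?posrE // [x + 1]addrC expRD.
  have q0 : 0 < G (expR 1 * expR x) / G (expR x) by rewrite divr_gt0.
  by rewrite -[X in X && _]ler_expR -[X in _ && X]ler_expR lnK ?posrE // h1 h2.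
have iter_le x k : x0 <= x -> g (x + k%:R) <= g x - (1 - d) * k%:R.
  move=> xx; elim: k => [|k IHk]; first by rewrite addr0 mulr0 subr0.
  have xk : x0 <= x + k%:R by rewrite ler_wpDr.
  have /andP[_] := step _ xk; rewrite -addrA -natr1; lra.
have iter_ge x k : x0 <= x -> g x - (1 + d) * k%:R <= g (x + k%:R).
  move=> xx; elim: k => [|k IHk]; first by rewrite addr0 mulr0 subr0.
  have xk : x0 <= x + k%:R by rewrite ler_wpDr.
  have /andP[+ _] := step _ xk; rewrite -addrA -natr1; lra.
have down x h : x0 <= x -> 0 <= h -> g x <= g (x + h) + (1 + d) * (h + 1).
  move=> xx h0; pose k := (Num.trunc h).+1.
  have hk : h <= k%:R by rewrite ltW // truncnS_gt.
  have kh : k%:R <= h + 1 by rewrite -natr1 lerD2r truncn_le.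
  have := iter_ge x k xx; have : g (x + k%:R) <= g (x + h) by apply: g_noninc; rewrite lerD2l.
  have : (1 + d) * k%:R <= (1 + d) * (h + 1) by rewrite ler_pM2l //; lra.
  lra.
exists (2 - g x0), (expR x0); split; first by have := g_le0 x0; lra.
  exact: expR_gt0.
move=> t h t0.
have t_gt0 : 0 < t by apply: lt_le_trans t0; exact: expR_gt0.
pose x := ln t; have xx0 : x0 <= x by rewrite /x -ler_expR lnK.
have -> : ln (G (t * expR h)) - ln (G t) = g (x + h) - g x.
  by rewrite /g expRD /x lnK.
have := g_le0 x0.
have [h0|h0] := leP 0 h.
  pose k := Num.trunc h.
  have kh : k%:R <= h by rewrite truncn_le.
  have hk : h <= k%:R + 1 by rewrite natr1 ltW // truncnS_gt.
  have := iter_le x k xx0; have : g (x + h) <= g (x + k%:R) by apply: g_noninc; rewrite lerD2l.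
  have : (1 - d) * (h - 1) <= (1 - d) * k%:R by rewrite ler_pM2l //; lra.
  by rewrite ger0_norm //; lra.
rewrite ltr0_norm //.
have [xh|xh] := leP x0 (x + h).
  have := down (x + h) (- h) xh; rewrite addrK oppr_ge0 (ltW h0) => /(_ isT).
  lra.
have := down x0 (x - x0) (lexx _); rewrite subr_ge0 addrCA subrr addr0 => /(_ xx0).
have := g_le0 (x + h).
have : (1 + d) * (x - x0 + 1) <= (1 + d) * (- h + 1) by rewrite ler_pM2l //; lra.
lra.
Unshelve. all: by end_near.
Qed.

Hypothesis G_rc : right_continuous G.
Hypothesis G_cvg0 : G s @[s --> +oo] --> 0.

(** The values [p >= G 0] have inverse [0]; they correspond to the mass outside
    [(0, oo)]. *)
Definition tail_inv (p : R) : R := inf [set s | 0 <= s /\ G s <= p].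

Lemma tail_inv_ge0 p : 0 <= tail_inv p.
Proof.
rewrite /tail_inv; set S := (X in inf X).
have [->|/set0P S0] := eqVneq S set0; first by rewrite inf0.
by apply: lb_le_inf => // s [].
Qed.

(** The Galois connection between a tail and its inverse; right continuity makes
    the infimum strictly larger than [s]. *)
Lemma lt_tail_inv s p : 0 <= s -> 0 < p -> (s < tail_inv p) = (p < G s).
Proof.
move=> s0 p0; apply/idP/idP => [sp|ps].
  rewrite ltNge; apply/negP => Gsp; move: sp; apply/negP; rewrite -leNgt.
  by apply: ge_inf => //; exists 0 => r [].
have [y [sy py]] : exists y, s < y /\ p < G y.
  have right_gt : \forall y \near s^'+, s < y /\ p < G y.
    near=> y; split; first by near: y; exact: nbhs_right_gt.
    by near: y; exact: (cvgr_gt _ (@G_rc s)).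
  exact: filter_ex right_gt.
apply: (lt_le_trans sy); apply: lb_le_inf.
  have small : \forall r \near +oo, 0 <= r /\ G r <= p.
    near=> r; split; first by near: r; exact: nbhs_pinfty_ge.
    by near: r; exact: (cvgr_le _ G_cvg0).
  by have [r rP] := filter_ex small; exists r.
move=> r [r0 rp]; rewrite leNgt; apply/negP => ry.
by have := lt_le_trans py (G_noninc (ltW ry)); rewrite ltNge rp.
Unshelve. all: by end_near.
Qed.

(** The inverse evaluated at [e^-u G t], so that [tail_quantile t u] is
    approximately [t e^u] for large [t]. *)
Definition tail_quantile (t u : R) : R := tail_inv (expR (- u) * G t).

Lemma tail_quantile_ge0 t u : 0 <= tail_quantile t u.
Proof. exact: tail_inv_ge0. Qed.

Lemma lt_tail_quantile s t u : 0 <= s ->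
  (s < tail_quantile t u) = (ln (G t) - ln (G s) < u).
Proof.
move=> s0; rewrite lt_tail_inv // ?mulr_gt0 ?expR_gt0 //.
rewrite -ltr_ln ?posrE ?mulr_gt0 ?expR_gt0 // lnM ?posrE ?expR_gt0 // expRK.
by apply/idP/idP; lra.
Qed.

Lemma measurable_tail_quantile t : measurable_fun [set: R] (tail_quantile t).
Proof.
apply: (measurability _ (RGenOInfty.measurableE R)).
move=> _ [_ [s ->] <-]; rewrite setTI.
have [s0|s0] := leP 0 s.
  rewrite (_ : _ @^-1` _ = `](ln (G t) - ln (G s)), +oo[%classic); first exact: measurable_itv.
  by apply/seteqP; split=> u /=; rewrite !in_itv /= !andbT lt_tail_quantile.
rewrite (_ : _ @^-1` _ = setT) //; apply/seteqP; split=> u //= _.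
by rewrite in_itv /= andbT (lt_le_trans s0) // tail_quantile_ge0.
Qed.

Lemma tail_quantile_near_gt u e : 0 < e ->
  \forall t \near +oo, t * expR (u - e) < tail_quantile t u.
Proof.
move=> e0; near=> t.
have t0 : 0 < t by near: t; exact: nbhs_pinfty_gt.
rewrite lt_tail_quantile ?mulr_ge0 ?expR_ge0 ?(ltW t0) //.
have : expR (- u) < G (expR (u - e) * t) / G t.
  near: t; apply: (cvgr_gt _ (tail_ratio_cvg (expR_gt0 (u - e)))).
  by rewrite -expRN ltr_expR; lra.
rewrite -ltr_ln ?posrE ?expR_gt0 ?divr_gt0 // expRK ln_div ?posrE // mulrC; lra.
Unshelve. all: by end_near.
Qed.

Lemma tail_quantile_near_gt0 u : \forall t \near +oo, 0 < tail_quantile t u.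
Proof.
near=> t; have t0 : 0 < t by near: t; exact: nbhs_pinfty_gt.
apply: (@le_lt_trans _ _ (t * expR (u - 1))); first by rewrite mulr_ge0 ?expR_ge0 ?ltW.
by near: t; exact: tail_quantile_near_gt.
Unshelve. all: by end_near.
Qed.

Lemma tail_quantile_cvg u :
  ln (tail_quantile t u / t) @[t --> +oo] --> u.
Proof.
apply/cvgrPdist_le => e e0; near=> t.
have t0 : 0 < t by near: t; exact: nbhs_pinfty_gt.
have lo : t * expR (u - e) < tail_quantile t u.
  by near: t; exact: tail_quantile_near_gt.
have hi : tail_quantile t u <= t * expR (u + e).
  rewrite leNgt lt_tail_quantile ?mulr_ge0 ?expR_ge0 ?(ltW t0) // -leNgt.
  have : G (expR (u + e) * t) / G t <= expR (- u).
    near: t; apply: (cvgr_le _ (tail_ratio_cvg (expR_gt0 (u + e)))).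
    by rewrite -expRN ltr_expR; lra.
  rewrite -ler_ln ?posrE ?expR_gt0 ?divr_gt0 // expRK ln_div ?posrE // mulrC; lra.
have q0 : 0 < tail_quantile t u / t.
  by rewrite divr_gt0 // (le_lt_trans _ lo) // mulr_ge0 ?expR_ge0 ?ltW.
rewrite ler_distlC; apply/andP; split.
  by rewrite -ler_expR lnK ?posrE // ler_pdivlMr // mulrC ltW.
by rewrite -ler_expR lnK ?posrE // ler_pdivrMr // mulrC.
Unshelve. all: by end_near.
Qed.

(** Potter's bound at [h = x - 1], where [t e^h] is strictly below the quantile,
    gives [x - d |x| <= u + C + 2]. It remains to trade another multiple of
    [|x|] for one of [|u|]. *)
Lemma tail_quantile_bound (d : R) : 0 < d < 1 -> exists C t0 : R, [/\ 0 <= C, 0 < t0 &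
  forall t u, t0 <= t -> 0 < tail_quantile t u ->
   let x := ln (tail_quantile t u / t) in x - 2 * d * `|x| <= u - d / 2 * `|u| + C].
Proof.
move=> d01; have [C [t0 [C0 t00 H]]] := potter_bound d01.
have /andP[d0 d1] := d01.
pose K := C + 2.
exists (3 * K), t0; split; [by rewrite /K; lra|by []|move=> t u tt q0 /=].
set x := ln _.
have tgt0 : 0 < t by exact: lt_le_trans tt.
have xu : x - d * `|x| <= u + K.
  have lt1 : t * expR (x - 1) < tail_quantile t u.
    rewrite expRD lnK ?posrE ?divr_gt0 // mulrA mulrC [t * _]mulrC divfK ?gt_eqF //.
    by rewrite gtr_pMl // expR_lt1; lra.
  move: lt1; rewrite lt_tail_quantile ?mulr_ge0 ?expR_ge0 ?(ltW tgt0) // => lt1.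
  have := H t (x - 1) tt.
  have : d * `|x - 1| <= d * `|x| + d.
    rewrite (_ : d * `|x| + d = d * (`|x| + 1)) ?ler_pM2l //; last by ring.
    by rewrite (le_trans (ler_normB _ _)) // normr1.
  rewrite /K; lra.
have K0 : 0 <= K by rewrite /K; lra.
have dK : d * K <= K by rewrite ler_piMl // ltW.
have dK0 : 0 <= d * K by rewrite mulr_ge0 // ltW.
have [x0|x0] := leP 0 x.
  rewrite ger0_norm // in xu *.
  have uK : 0 <= u + K.
    have : 0 <= (1 - d) * x by rewrite mulr_ge0 //; lra.
    lra.
  have duK : 0 <= d * (u + K) by rewrite mulr_ge0 // ltW.
  have s1 : (1 - d) * ((1 - d) * x) <= (1 - d) * (u + K).
    by rewrite ler_pM2l; lra.
  have s2 : 0 <= d * d * x by rewrite !mulr_ge0 // ltW.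
  have [u0|u0] := leP 0 u.
    have s3 : 0 <= d * u by rewrite mulr_ge0 // ltW.
    by rewrite ger0_norm //; lra.
  by rewrite ltr0_norm //; lra.
rewrite ltr0_norm // in xu *.
have [u0|u0] := leP 0 u.
  have s3 : d * u <= u by rewrite ler_piMl // ltW.
  have s4 : d * x <= 0 by rewrite pmulr_rle0 // ltW.
  by rewrite ger0_norm //; lra.
rewrite ltr0_norm //.
have s1 : (1 + d / 2) * ((1 + d) * x) <= (1 + d / 2) * (u + K).
  by rewrite ler_pM2l; lra.
have s2 : (d - d * d) * x <= 0.
  by rewrite mulr_ge0_le0 ?(ltW x0) // subr_ge0 ler_piMr // ltW.
lra.
Qed.

End regularly_varying_tail.

Section survival_function.
Context {R : realType} d {T : measurableType d} {P : probability T R}.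
Variable X : {RV P >-> R}.

Definition survival (s : R) : R := fine (ccdf X s).

Lemma survivalE s : (survival s)%:E = P (X @^-1` `]s, +oo[%classic).
Proof. by rewrite /survival fineK // fin_num_measure. Qed.

Lemma survival_ge0 s : 0 <= survival s.
Proof. by rewrite /survival fine_ge0. Qed.

Lemma survival_le1 s : survival s <= 1.
Proof. by rewrite -lee_fin survivalE; exact: (probability_le1 (distribution P X)). Qed.

Lemma survival_noninc s t : s <= t -> survival t <= survival s.
Proof.
move=> st; rewrite /survival fine_le ?fin_num_measure //; exact: ccdf_nonincreasing.
Qed.

Lemma survival_rc : right_continuous survival.
Proof.
move=> s; apply: fine_cvg.
rewrite fineK; last exact: fin_num_measure.
exact: ccdf_right_continuous.
Qed.

Lemma survival_cvg0 : survival s @[s --> +oo] --> 0.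
Proof. by apply: fine_cvg; exact: cvg_ccdfy0. Qed.

Hypothesis X_rv : regularly_varying_RV X (- 1).

(** If a tail vanished from some point on, its ratios would be [0 / 0 = 0], which
    do not tend to [1]. *)
Lemma survival_gt0 s : 0 < survival s.
Proof.
rewrite lt0r survival_ge0 andbT; apply/eqP => Gs0.
have Gx0 x : s <= x -> survival x = 0.
  by move=> sx; apply/eqP; rewrite eq_le survival_ge0 -Gs0 survival_noninc.
have := X_rv ltr01; rewrite powR1.
move=> /cvgrPdist_lt /(_ _ ltr01) near1.
suff [x [sx]] : exists x, s <= x /\ `|1 - survival (1 * x) / survival x| < 1.
  by rewrite (Gx0 x) // invr0 mulr0 subr0 normr1 ltxx.
apply: (@filter_ex _ (pinfty_nbhs R)).
by apply: filterI near1; apply: nbhs_pinfty_ge; exact: num_real.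
Qed.

(** Both sides are measures in [B]; they agree on the half-lines [(r, oo)], where
    the right-hand side is [G t * (G s / G t)] with [s = max r 0]. *)
Lemma survival_quantile_law t (B : set R) : measurable B ->
  P (X @^-1` (B `&` `]0, +oo[)) =
  ((survival t)%:E * @expm R [set u | (0 < tail_quantile survival t u)%R /\
                                  B (tail_quantile survival t u)])%E.
Proof.
have Gt0 := survival_gt0.
have mq : measurable_fun [set: measurableTypeR R]
    (tail_quantile survival t : measurableTypeR R -> measurableTypeR R).
  exact: (measurable_tail_quantile Gt0 survival_noninc survival_rc survival_cvg0).
have m0 : measurable (`]0, +oo[%classic : set (measurableTypeR R)) by [].
have mX : measurable_fun [set: T] (X : T -> measurableTypeR R) by exact: (@measurable_funPT _ _ _ _ X).
pose m1 : {measure set (measurableTypeR R) -> \bar R} := mrestr (image_measure P mX) m0.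
pose k : {nonneg R} := NngNum (ltW (Gt0 t)).
pose m2 : {measure set (measurableTypeR R) -> \bar R} := mscale k (mrestr (image_measure (@expm R) mq) m0).
have ray (r s : R) : 0 <= s -> `]r, +oo[%classic `&` `]0, +oo[%classic = `]s, +oo[%classic ->
    m1 `]r, +oo[%classic = m2 `]r, +oo[%classic.
  move=> s0 E.
  have -> : m1 `]r, +oo[%classic = (survival s)%:E by rewrite survivalE -E.
  have -> : m2 `]r, +oo[%classic = ((survival t)%:E *
      @expm R (tail_quantile survival t @^-1` `]s, +oo[))%E by rewrite -E.
  have -> : tail_quantile survival t @^-1` `]s, +oo[ =
      `](ln (survival t) - ln (survival s)), +oo[%classic.
    by apply/seteqP; split=> u /=; rewrite !in_itv /= !andbT (lt_tail_quantile Gt0 survival_noninc survival_rc survival_cvg0).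
  rewrite expm_ray opprB expRB !lnK ?posrE // -EFinM mulrC divfK //.
  by rewrite gt_eqF.
have m12 : forall C, measurable C -> m1 C = m2 C.
  apply: (@measure_unique _ R (measurableTypeR R) (@RGenOInfty.G R)
    (fun k => `](- k%:R), +oo[%classic)).
  - exact: RGenOInfty.measurableE.
  - move=> _ _ [r ->] [s ->]; exists (Num.max r s).
    by apply/seteqP; split=> x /=; rewrite !in_itv /= !andbT gt_max => /andP.
  - by move=> i; exists (- i%:R).
  - apply/seteqP; split=> // x _.
    exists (Num.trunc `|x|).+1 => //=; rewrite in_itv /= andbT ltrNl.
    by rewrite (le_lt_trans (ler_norm _)) // normrN truncnS_gt.
  - move=> _ [r ->]; apply: (ray r (Num.max r 0)); first by rewrite le_max lexx orbT.
    apply/seteqP; split=> x /=; rewrite !in_itv /= !andbT gt_max; first by move=> [-> ->].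
    by move=> /andP.
  - move=> i; apply: (@le_lt_trans _ _ 1%E); last by rewrite ltry.
    by apply: probability_le1; apply: measurableI => //; exact: measurable_itv.
move=> mB; rewrite [LHS](m12 B mB); congr (_ * expm _)%E.
by apply/seteqP; split=> u /=; rewrite in_itv /= andbT => -[? ?]; split.
Qed.

Lemma measurable_survival_quantile t : measurable_fun [set: R] (tail_quantile survival t).
Proof.
exact: (measurable_tail_quantile survival_gt0 survival_noninc survival_rc survival_cvg0).
Qed.

Lemma survival_quantile_cvg u : ln (tail_quantile survival t u / t) @[t --> +oo] --> u.
Proof.
exact: (tail_quantile_cvg survival_gt0 survival_noninc X_rv survival_rc survival_cvg0).
Qed.

Lemma survival_quantile_near_gt0 u : \forall t \near +oo, 0 < tail_quantile survival t u.
Proof.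
exact: (tail_quantile_near_gt0 survival_gt0 survival_noninc X_rv survival_rc survival_cvg0).
Qed.

Lemma survival_quantile_bound (e : R) : 0 < e < 1 -> exists C t0 : R, [/\ 0 <= C, 0 < t0 &
  forall t u, t0 <= t -> 0 < tail_quantile survival t u ->
   let x := ln (tail_quantile survival t u / t) in
   x - 2 * e * `|x| <= u - e / 2 * `|u| + C].
Proof.
exact: (tail_quantile_bound survival_gt0 survival_le1 survival_noninc X_rv
  survival_rc survival_cvg0).
Qed.

End survival_function.

(** * The optimal basis of the linear program *)

Section optimal_basis_properties.
Context {R : realType} {m n : nat}.
Variables (A : 'M[R]_(n, m)) (kappa : 'cV[R]_m).
Hypothesis kappa_opt : lp_unique_optimal A kappa.
Hypothesis nd : lp_nondegenerate n kappa.

Definition basis_idx (k : 'I_n) : 'I_m := enum_val (cast_ord (esym nd) k).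

Lemma basis_mxE i k : basis_mx A nd i k = A i (basis_idx k).
Proof. by rewrite mxE. Qed.

Lemma kappa_basis_gt0 k : 0 < kappa (basis_idx k) 0.
Proof. by have := enum_valP (cast_ord (esym nd) k); rewrite inE. Qed.

Lemma basis_idx_inj : injective basis_idx.
Proof. by move=> k l /enum_val_inj /cast_ord_inj. Qed.

Lemma big_basis (S : Type) (idx : S) (op : Monoid.com_law idx) (F : 'I_m -> S) :
  \big[op/idx]_(j | 0 < kappa j 0) F j = \big[op/idx]_k F (basis_idx k).
Proof.
rewrite -[LHS]/(\big[op/idx]_(j in [pred j | 0 < kappa j 0]) F j) big_enum_val.
by rewrite (reindex (cast_ord (esym nd))) //; exists (cast_ord nd) => ? _; rewrite ?cast_ordK ?cast_ordKV.
Qed.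

Lemma kappa_ge0 j : 0 <= kappa j 0.
Proof. by have [[[]]] := kappa_opt. Qed.

Lemma kappa_eq0 j : (kappa j 0 == 0) = ~~ (0 < kappa j 0).
Proof. by rewrite lt0r kappa_ge0 andbT negbK. Qed.

Lemma big_basisC (S : Type) (idx : S) (op : Monoid.com_law idx) (F : 'I_m -> S) :
  \big[op/idx]_j F j =
  op (\big[op/idx]_k F (basis_idx k)) (\big[op/idx]_(j | kappa j 0 == 0) F j).
Proof.
rewrite (bigID (fun j => 0 < kappa j 0)) /= big_basis; congr (op _ _).
by apply: eq_bigl => j; rewrite kappa_eq0.
Qed.

(** A small step from [kappa] along [v] stays feasible: only the vanishing
    components and the tight constraints restrict the direction. Uniqueness makes
    the objective strictly larger. *)
Lemma lp_perturb (v : 'cV[R]_m) : v != 0 ->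
  (forall j, kappa j 0 = 0 -> 0 <= v j 0) ->
  (forall i, (A *m kappa) i 0 = 1 -> 0 <= (A *m v) i 0) ->
  0 < \sum_j v j 0.
Proof.
move=> v0 vj vi; have [[[k0 k1] kmin] kuniq] := kappa_opt.
have feas : \forall e \near 0^'+, 0 < e /\ lp_feasible A (kappa + e *: v).
  have near_pos (a b : R) : 0 < a -> \forall e \near 0^'+, 0 <= a + e * b.
    move=> a0; near=> e.
    have e0 : 0 < e by near: e; exact: nbhs_right_gt.
    have b0 : 0 < `|b| + 1 by rewrite ltr_wpDl.
    have : e <= a / (`|b| + 1) by near: e; apply: nbhs_right_le; rewrite divr_gt0.
    rewrite ler_pdivlMr // mulrDr mulr1 => ea.
    have : e * - b <= e * `|b| by rewrite ler_pM2l // -normrN ler_norm.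
    lra.
  have feas1 : \forall e \near 0^'+, forall j, 0 <= (kappa + e *: v) j 0.
    apply: filter_forall => j; have [kj|kj] := eqVneq (kappa j 0) 0.
      near=> e; have e0 : 0 < e by near: e; exact: nbhs_right_gt.
      by rewrite !mxE kj add0r mulr_ge0 ?vj // ltW.
    near=> e; rewrite !mxE; near: e; apply: near_pos.
    by rewrite lt0r kj k0.
  have feas2 : \forall e \near 0^'+, forall i, 1 <= (A *m (kappa + e *: v)) i 0.
    apply: filter_forall => i; have [ki|ki] := eqVneq ((A *m kappa) i 0) 1.
      near=> e; have e0 : 0 < e by near: e; exact: nbhs_right_gt.
      by rewrite mulmxDr -scalemxAr mxE ki mxE lerDl mulr_ge0 ?vi // ltW.
    near=> e; rewrite -subr_ge0 mulmxDr -scalemxAr mxE [X in _ + X - _]mxE addrAC.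
    near: e; apply: near_pos.
    by rewrite subr_gt0 lt_neqAle eq_sym ki k1.
  by near=> e; split; [near: e; exact: nbhs_right_gt|split; near: e].
have [e [e0 ef]] := filter_ex feas.
have sumE : \sum_j (kappa + e *: v) j 0 = \sum_j kappa j 0 + e * \sum_j v j 0.
  by rewrite mulr_sumr -big_split; apply: eq_bigr => j _; rewrite !mxE.
have := kmin _ ef; rewrite sumE lerDl pmulr_rge0 // le_eqVlt => /orP[/eqP s0|//].
have : lp_optimal A (kappa + e *: v).
  by split=> // y yf; rewrite sumE -s0 mulr0 addr0; exact: kmin.
move=> /kuniq /eqP; rewrite addrC -subr_eq0 addrK scaler_eq0 (negbTE v0) orbF.
by rewrite gt_eqF.
Unshelve. all: by end_near.
Qed.

(** [basis_col *m w] is [w] on the basic variables, extended by zero. *)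
Definition basis_col : 'M[R]_(m, n) := \matrix_(j, k) (basis_idx k == j)%:R.

Lemma mulmx_basis_col : A *m basis_col = basis_mx A nd.
Proof.
apply/matrixP => i k; rewrite mxE basis_mxE (bigD1 (basis_idx k)) //= mxE eqxx mulr1.
by rewrite big1 ?addr0 // => j jk; rewrite mxE eq_sym (negbTE jk) mulr0.
Qed.

Lemma basis_col_idx (w : 'cV[R]_n) k : (basis_col *m w) (basis_idx k) 0 = w k 0.
Proof.
rewrite mxE (bigD1 k) //= mxE eqxx mul1r big1 ?addr0 // => l lk.
by rewrite mxE (inj_eq basis_idx_inj) (negbTE lk) mul0r.
Qed.

Lemma basis_col0 (w : 'cV[R]_n) j : kappa j 0 = 0 -> (basis_col *m w) j 0 = 0.
Proof.
move=> kj; rewrite mxE big1 // => k _; rewrite mxE; case: eqP => [kE|]; last by rewrite mul0r.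
by have := kappa_basis_gt0 k; rewrite kE kj ltxx.
Qed.

Lemma sum_basis_col (w : 'cV[R]_n) : \sum_j (basis_col *m w) j 0 = \sum_k w k 0.
Proof.
rewrite big_basisC /= [X in _ + X]big1 ?addr0 => [|j /eqP]; last exact: basis_col0.
by apply: eq_bigr => k _; exact: basis_col_idx.
Qed.

Lemma basis_col_neq0 (w : 'cV[R]_n) : w != 0 -> basis_col *m w != 0.
Proof.
apply: contra => /eqP w0; apply/eqP/matrixP => k l; rewrite ord1 -basis_col_idx w0.
by rewrite !mxE.
Qed.

(** Replace by zero the rows of the basis matrix that belong to slack constraints. A
    kernel vector of the result gives two opposite admissible directions, which
    [lp_perturb] forbids; so even this matrix is invertible, and a slack
    constraint, being a zero row, cannot occur. *)
Lemma optimal_basis_unit :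
  basis_mx A nd \in unitmx /\ forall i, (A *m kappa) i 0 = 1.
Proof.
pose B := \matrix_(i, k) (if (A *m kappa) i 0 == 1 then basis_mx A nd i k else 0).
have uB : B \in unitmx.
  rewrite -unitmx_tr -row_free_unit -kermx_eq0; apply/eqP/row_matrixP => r.
  rewrite row0; pose w := (row r (kermx B^T))^T.
  have Bw : B *m w = 0.
    by apply: trmx_inj; rewrite trmx_mul /w trmxK -row_mul mulmx_ker row0 trmx0.
  suff : w = 0 by move=> /(congr1 trmx); rewrite /w trmxK trmx0.
  apply/eqP/negPn/negP => w0.
  have Aw (c : R) i : (A *m kappa) i 0 = 1 -> (A *m (basis_col *m (c *: w))) i 0 = 0.
    move=> ti; rewrite mulmxA mulmx_basis_col.
    transitivity (c * (B *m w) i 0); last by rewrite Bw mxE mulr0.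
    rewrite mxE [in RHS]mxE mulr_sumr; apply: eq_bigr => k _.
    by rewrite [(c *: w) k 0]mxE [B i k]mxE ti eqxx mulrCA.
  have pos c : c != 0 -> 0 < c * \sum_k w k 0.
    move=> c0; have := @lp_perturb (basis_col *m (c *: w)).
    rewrite sum_basis_col mulr_sumr; under eq_bigr do rewrite mxE.
    apply; first by apply: basis_col_neq0; rewrite scaler_eq0 negb_or c0.
    - by move=> j kj; rewrite basis_col0.
    - by move=> i ti; rewrite Aw.
  have := pos 1 (oner_neq0 _); have := pos (-1) (ltr0_neq0 (ltrN10 _)).
  by rewrite mul1r mulN1r oppr_gt0 => /lt_trans /[apply]; rewrite ltxx.
have tight i : (A *m kappa) i 0 = 1.
  apply/eqP/negPn/negP => ti; move: uB; rewrite unitmxE unitfE (expand_det_row _ i).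
  by rewrite big1 ?eqxx // => k _; rewrite mxE (negbTE ti) mul0r.
split=> //; suff <- : B = basis_mx A nd by [].
by apply/matrixP => i k; rewrite mxE tight eqxx.
Qed.

Let uA := optimal_basis_unit.1.

(** The direction that increases the [i]-th constraint at unit rate and keeps the
    others changes the objective at rate [b_i]. *)
Lemma dual_row_gt0 i : 0 < dual_row A nd 0 i.
Proof.
pose w := invmx (basis_mx A nd) *m delta_mx i 0 : 'cV[R]_n.
have Aw : A *m (basis_col *m w) = delta_mx i 0.
  by rewrite mulmxA mulmx_basis_col /w mulKVmx.
have -> : dual_row A nd 0 i = \sum_j (basis_col *m w) j 0.
  rewrite sum_basis_col /dual_row mxE; apply: eq_bigr => k _.
  by rewrite mxE mul1r /w -colE mxE.
apply: lp_perturb.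
- apply/eqP => /(congr1 (mulmx A)); rewrite Aw mulmx0 => /matrixP /(_ i 0).
  by rewrite !mxE !eqxx => /eqP; rewrite oner_eq0.
- by move=> j kj; rewrite basis_col0.
- by move=> r _; rewrite Aw mxE ler0n.
Qed.

Lemma dual_row_mul_basis : dual_row A nd *m basis_mx A nd = const_mx 1.
Proof. by rewrite /dual_row mulmxKV. Qed.

Lemma basis_mx_kappa i : \sum_k basis_mx A nd i k * kappa (basis_idx k) 0 = 1.
Proof.
rewrite -(optimal_basis_unit.2 i) mxE big_basisC /= [X in _ = _ + X]big1 ?addr0 => [|j /eqP ->].
  by apply: eq_bigr => k _; rewrite basis_mxE.
by rewrite mulr0.
Qed.

Lemma moment_row_basis k : moment_row A nd 0 (basis_idx k) = 1.
Proof.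
have := congr1 (fun C : 'rV_n => C 0 k) dual_row_mul_basis; rewrite !mxE => <-.
by apply: eq_bigr => i _; rewrite basis_mxE.
Qed.

(** Linear programming duality: insert [A_kappa kappa = 1] into the sum of [b]. *)
Lemma sum_kappaE : \sum_j kappa j 0 = \sum_i dual_row A nd 0 i.
Proof.
rewrite big_basisC /= [X in _ + X]big1 ?addr0 => [|j /eqP //].
have -> : \sum_i dual_row A nd 0 i =
   \sum_i \sum_k dual_row A nd 0 i * (basis_mx A nd i k * kappa (basis_idx k) 0).
  by apply: eq_bigr => i _; rewrite -mulr_sumr basis_mx_kappa mulr1.
rewrite exchange_big; apply: eq_bigr => k _ /=.
have := congr1 (fun C : 'rV_n => C 0 k) dual_row_mul_basis; rewrite !mxE => sE.
by under eq_bigr do rewrite mulrA; rewrite -mulr_suml sE mul1r.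
Qed.

End optimal_basis_properties.

(** * Coupling with quantile transforms *)

Section coupling.
Context {R : realType} {m n : nat}.
Variables (A : 'M[R]_(n, m)) (kappa : 'cV[R]_m).
Hypothesis kappa_opt : lp_unique_optimal A kappa.
Hypothesis nd : lp_nondegenerate n kappa.
Local Notation idx := (basis_idx nd).
Local Notation expn n := (family_product (fun _ : 'I_n => @expm R)).

Definition merge (z : 'rV[R]_n) (x : 'I_m -> R) (j : 'I_m) : R :=
  if [pick k | idx k == j] is Some k then z 0 k else x j.

Lemma merge_basis z x k : merge z x (idx k) = z 0 k.
Proof.
rewrite /merge; case: pickP => [l /eqP /basis_idx_inj -> //|/(_ k)].
by rewrite eqxx.
Qed.

Lemma merge_nonbasis z x j : kappa j 0 = 0 -> merge z x j = x j.
Proof.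
rewrite /merge; case: pickP => // k /eqP <- k0.
by have := kappa_basis_gt0 nd k; rewrite k0 ltxx.
Qed.

Lemma forall_basis (Q : 'I_m -> Prop) :
  (forall j, Q j) <-> (forall k, Q (idx k)) /\ (forall j, kappa j 0 = 0 -> Q j).
Proof.
split=> [QT|[Q1 Q2] j]; first by split.
have [kj|kj] := eqVneq (kappa j 0) 0; first exact: Q2.
have j_pos : j \in [pred j | 0 < kappa j 0] by rewrite inE lt0r kj (kappa_ge0 kappa_opt).
have -> : j = idx (cast_ord nd (enum_rank_in j_pos j)).
  by rewrite /basis_idx cast_ordK enum_rankK_in.
exact: Q1.
Qed.

Context d {T : measurableType d} {P : probability T R}.
Variable X : 'I_m -> {RV P >-> R}.
Hypothesis X_indep : mutually_independent X.
Hypothesis X_rv : forall j, 0 < kappa j 0 -> regularly_varying_RV (X j) (- 1).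

Definition Xrow (w : T) : borel_rV R m := \row_j X j w.

Lemma measurable_Xrow : measurable_fun setT Xrow.
Proof.
apply: measurable_row => j; under eq_fun do rewrite mxE.
exact: (@measurable_funPT _ _ _ _ (X j)).
Qed.

Definition quantile_row (t : 'I_n -> R) (u : borel_rV R n) : 'rV[R]_n :=
  \row_k tail_quantile (survival (X (idx k))) (t k) ((u : 'rV[R]_n) 0 k).

Definition merge_row (t : 'I_n -> R) (p : T * borel_rV R n) : borel_rV R m :=
  \row_j merge (quantile_row t p.2) (fun j => X j p.1) j.

Lemma measurable_merge_row t : measurable_fun setT (merge_row t).
Proof.
apply: measurable_row => j; under eq_fun do rewrite mxE /merge.
case: pickP => [k _|_].
  under eq_fun do rewrite mxE.
  apply: (measurableT_comp (measurable_survival_quantile (X_rv (kappa_basis_gt0 nd k)) (t k))).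
  exact: (measurableT_comp (@measurable_coord R n k) measurable_snd).
exact: (measurableT_comp (@measurable_funPT _ _ _ _ (X j)) measurable_fst).
Qed.

Definition basis_pos : set (borel_rV R m) :=
  [set z | forall k, 0 < (z : 'rV[R]_m) 0 (idx k)].

Lemma measurable_basis_pos : measurable basis_pos.
Proof.
rewrite (_ : basis_pos = \bigcap_(k in [set: 'I_n])
    (fun z : borel_rV R m => (z : 'rV[R]_m) 0 (idx k)) @^-1` `]0, +oo[).
  apply: fin_bigcap_measurable => // k _; rewrite -[X in measurable X]setTI.
  by apply: measurable_coord => //; exact: measurable_itv.
by apply/seteqP; split=> z /= => [zk k _|zk k]; have := zk k; rewrite /= in_itv /= andbT; exact.
Qed.

Definition levels_tail (t : 'I_n -> R) : R := \prod_k survival (X (idx k)) (t k).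

(** Independence turns both sides into products over coordinates; the basic
    factors match by [survival_quantile_law] and the others are common. *)
Lemma coupling_rect t (B : 'I_m -> set R) : (forall j, measurable (B j)) ->
  P (Xrow @^-1` (rect B `&` basis_pos)) =
  ((levels_tail t)%:E *
    (P \x expn n)%E (merge_row t @^-1` (rect B `&` basis_pos)))%E.
Proof.
move=> mB.
pose B' j := if 0 < kappa j 0 then B j `&` `]0, +oo[%classic else B j.
have mB' j : measurable (B' j).
  by rewrite /B'; case: ifP => _ //; apply: measurableI => //; exact: measurable_itv.
pose J0 := [set j | kappa j 0 == 0]%SET.
have mq k : measurable [set u | 0 < tail_quantile (survival (X (idx k))) (t k) u /\
    B (idx k) (tail_quantile (survival (X (idx k))) (t k) u)].
  rewrite (_ : [set u | _] = tail_quantile (survival (X (idx k))) (t k) @^-1`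
      (`]0, +oo[ `&` B (idx k))).
    rewrite -[X in measurable X]setTI.
    apply: (measurable_survival_quantile (X_rv (kappa_basis_gt0 nd k)) (t k)) => //.
    by apply: measurableI => //; exact: measurable_itv.
  by apply/seteqP; split=> u /=; rewrite in_itv /= andbT.
have mJ0 : measurable [set w | forall j, j \in J0 -> B j (X j w)].
  rewrite (_ : [set w | _] = \bigcap_(j in [set: 'I_m])
      (X j @^-1` (if j \in J0 then B j else setT))).
    apply: fin_bigcap_measurable => // j _; apply: measurable_funPTI.
    by case: ifP.
  apply/seteqP; split=> w /=; first by move=> Bw j _ /=; case: ifP => // /Bw.
  by move=> Bw j jJ; have := Bw j I; rewrite /= jJ.
have -> : Xrow @^-1` (rect B `&` basis_pos) =
    [set w | forall j, j \in [set: 'I_m]%SET -> B' j (X j w)].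
  apply/seteqP; split=> w /=.
    move=> [Bw pw] j _; rewrite /B'; have := Bw j; rewrite mxE => Bj.
    case: ifPn => // kj; split=> //=; rewrite in_itv /= andbT.
    move: j kj {Bj}; apply/forall_basis; split=> [k _|j ->]; last by rewrite ltxx.
    by have := pw k; rewrite mxE.
  move=> Bw; split=> [j|k]; rewrite mxE.
    by have := Bw j (finset.in_setT _); rewrite /B'; case: ifP => // _ [].
  have := Bw (idx k) (finset.in_setT _); rewrite /B' kappa_basis_gt0 => -[_].
  by rewrite /= in_itv /= andbT.
have -> : merge_row t @^-1` (rect B `&` basis_pos) =
    [set w | forall j, j \in J0 -> B j (X j w)] `*`
    rect (fun k => [set u | 0 < tail_quantile (survival (X (idx k))) (t k) u /\
       B (idx k) (tail_quantile (survival (X (idx k))) (t k) u)]).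
  have quantE (u : borel_rV R n) k : quantile_row t u 0 k =
      tail_quantile (survival (X (idx k))) (t k) ((u : 'rV[R]_n) 0 k) by rewrite mxE.
  apply/seteqP; split=> -[w u] /=.
    move=> [Bp pos]; split=> [j|k].
      rewrite inE => /eqP kj; have := Bp j.
      by rewrite mxE (merge_nonbasis _ _ kj).
    have := Bp (idx k); have := pos k.
    by rewrite mxE merge_basis quantE => ? ?; split.
  move=> [B0 Bq]; split; last first.
    by move=> k; rewrite mxE merge_basis quantE; have [] := Bq k.
  apply/forall_basis; split=> [k|j kj].
    by rewrite mxE merge_basis quantE; have [] := Bq k.
  by rewrite mxE (merge_nonbasis _ _ kj); apply: B0; rewrite inE kj.
rewrite X_indep // product_measure1E //; last exact: measurable_rect.
rewrite [X in (_ * (X * _))%E]X_indep // family_product_rect //.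
rewrite (eq_bigl predT) => [|j]; last by rewrite finset.in_setT.
rewrite (big_basisC kappa_opt nd) /=.
have -> : (\prod_k P (X (idx k) @^-1` B' (idx k)) = (levels_tail t)%:E *
    \prod_k @expm R [set u | (0 < tail_quantile (survival (X (idx k))) (t k) u)%R /\
       B (idx k) (tail_quantile (survival (X (idx k))) (t k) u)])%E.
  rewrite /levels_tail -prodEFin -big_split; apply: eq_bigr => k _.
  rewrite /B' kappa_basis_gt0.
  exact: (survival_quantile_law (X_rv (kappa_basis_gt0 nd k)) (t k) (mB (idx k))).
have -> : (\prod_(j | kappa j 0%R == 0%R) P (X j @^-1` B' j) =
    \prod_(j in J0) P (X j @^-1` B j))%E.
  rewrite (eq_bigl (fun j => j \in J0)) => [|j]; last by rewrite inE.
  by apply: eq_bigr => j; rewrite inE => /eqP kj; rewrite /B' kj ltxx.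
by rewrite -muleA; congr (_ * _)%E; rewrite muleC.
Qed.

(** Rectangles determine both measures, since the law of [X] is finite. Functions
    that vanish unless the basic coordinates are positive do not see the mass that
    the quantiles put at zero, which is infinite. *)
Lemma coupling_integral t (f : borel_rV R m -> \bar R) :
  measurable_fun setT f -> (forall z, (0 <= f z)%E) ->
  (forall z, ~ basis_pos z -> f z = 0%E) ->
  (\int[P]_w f (Xrow w) =
   (levels_tail t)%:E * \int[(P \x expn n)%E]_p f (merge_row t p))%E.
Proof.
move=> mf f0 fpos.
have lt0 : 0 <= levels_tail t.
  by apply: prodr_ge0 => k _; exact: survival_ge0.
pose c : {nonneg R} := NngNum lt0.
pose m1 : {measure set (borel_rV R m) -> \bar R} :=
  mrestr (image_measure P measurable_Xrow) measurable_basis_pos.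
pose m2 : {measure set (borel_rV R m) -> \bar R} :=
  mscale c (mrestr (image_measure (P \x expn n)%E (measurable_merge_row t)) measurable_basis_pos).
have m12 C : measurable C -> m1 C = m2 C.
  apply: (@rect_measure_unique R m (fun _ _ => setT)) => //.
  - by apply/seteqP; split=> // z _; exists 0%N.
  - by move=> B mB; exact: coupling_rect.
  - move=> k; apply: (@le_lt_trans _ _ 1%E); last by rewrite ltry.
    apply: probability_le1; apply: measurableI; last exact: measurable_basis_pos.
    exact: measurable_rect.
have restrE (mu : {measure set (borel_rV R m) -> \bar R}) :
    (\int[mrestr mu measurable_basis_pos]_z f z = \int[mu]_z f z)%E.
  rewrite ge0_integral_mrestr // integral_mkcond; apply: eq_integral => z _.
  by rewrite patchE; case: ifPn => //; rewrite notin_setE => /fpos ->.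
rewrite -[LHS](ge0_integral_image P measurable_Xrow) // -[LHS]restrE.
rewrite -[X in (_ * X)%E](ge0_integral_image _ (measurable_merge_row t)) //.
rewrite -[X in (_ * X)%E]restrE.
rewrite -[RHS](ge0_integral_mscale _ measurableT c) //.
by apply: eq_measure_integral => C mC _; exact: (m12 C mC).
Qed.

End coupling.

(** * The cone estimate *)

Section cone_estimate.
Context {R : realType} {m n : nat}.
Variables (A : 'M[R]_(n, m)) (kappa : 'cV[R]_m).
Hypothesis kappa_opt : lp_unique_optimal A kappa.
Hypothesis nd : lp_nondegenerate n kappa.
Local Notation Ak := (basis_mx A nd).
Local Notation b := (dual_row A nd).

(** Let [sg] be the vector of signs of [xi]. The weights
    [th = b - 2 d sg A_kappa^-1] satisfy [th A_kappa = 1 - 2 d sg], so that the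
    combination of the [n] inequalities with weights [th] has coefficient
    [xi_k - 2 d |xi_k|] in the basic part, and [q = th A] in the other. For small
    [d], [th] is positive and [q] is close to [beta = b A]. *)
Lemma cone_estimate (eps : R) : 0 < eps -> exists d K : R, [/\ 0 < d < 2^-1, 0 <= K &
  forall (xi : 'rV[R]_n) (s : 'I_m -> R) (L : R),
  (forall i, L <= \sum_k Ak i k * xi 0 k + \sum_(j | kappa j 0 == 0) A i j * s j) ->
  exists2 q : 'I_m -> R, forall j, `|q j - moment_row A nd 0 j| <= eps &
  - (K * `|L|) <= \sum_k (xi 0 k - 2 * d * `|xi 0 k|) +
                  \sum_(j | kappa j 0 == 0) q j * s j].
Proof.
move=> eps0; have [uA _] := optimal_basis_unit kappa_opt nd.
have b0 := dual_row_gt0 kappa_opt nd.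
(* [H] bounds every coordinate of [sg *m invmx Ak] and of [sg *m B]. *)
pose B := invmx Ak *m A.
pose H := 1 + \sum_k \sum_i `|invmx Ak k i| + \sum_k \sum_j `|B k j|.
have sB0 : 0 <= \sum_k \sum_j `|B k j| by apply: sumr_ge0 => k _; exact: sumr_ge0.
have sA0 : 0 <= \sum_k \sum_i `|invmx Ak k i|.
  by apply: sumr_ge0 => k _; exact: sumr_ge0.
have H0 : 0 < H by rewrite /H; lra.
have [d [d0 d1 dE db]] : exists d, [/\ 0 < d, d < 2^-1, 2 * d * H <= eps &
    forall i, 2 * d * H <= b 0 i].
  have near_le a : 0 < a -> \forall d \near 0^'+, 2 * d * H <= a.
    move=> a0; near=> d.
    have : d <= a / (2 * H) by near: d; apply: nbhs_right_le; rewrite divr_gt0 ?mulr_gt0.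
    by rewrite ler_pdivlMr ?mulr_gt0 // => h; lra.
  have near_b : \forall d \near 0^'+, forall i, 2 * d * H <= b 0 i.
    by apply: filter_forall => i; exact: near_le.
  have near_all : \forall d \near 0^'+, [/\ 0 < d, d < 2^-1, 2 * d * H <= eps &
      forall i, 2 * d * H <= b 0 i].
    near=> d; split; near: d => //.
    - exact: nbhs_right_gt.
    - by apply: nbhs_right_lt; rewrite invr_gt0.
    - exact: near_le.
  exact: filter_ex near_all.
have boundl (p q : nat) (C : 'M[R]_(p, q)) (sg : 'rV[R]_p) j :
    (forall k, `|sg 0 k| <= 1) -> `|(sg *m C) 0 j| <= \sum_k \sum_l `|C k l|.
  move=> sg1; rewrite mxE; apply: (le_trans (ler_norm_sum _ _ _)).
  apply: ler_sum => k _; rewrite normrM (bigD1 j) //=.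
  apply: (@le_trans _ _ `|C k j|); first by rewrite ler_piMl.
  by rewrite lerDl sumr_ge0.
exists d, (\sum_i (b 0 i + 2 * d * H)); split; first by rewrite d0 d1.
  by apply: sumr_ge0 => i _; rewrite addr_ge0 ?ltW // !mulr_gt0.
move=> xi s L HL.
pose sg : 'rV[R]_n := \row_k Num.sg (xi 0 k).
have sg1 k : `|sg 0 k| <= 1 by rewrite mxE normr_sg lern1 leq_b1.
have subE p (a c : 'rV[R]_p) x i : (a - x *: c) 0 i = a 0 i - x * c 0 i by rewrite !mxE.
pose th := b - (2 * d) *: (sg *m invmx Ak).
have thb i : 0 <= th 0 i <= b 0 i + 2 * d * H.
  have : 2 * d * `|(sg *m invmx Ak) 0 i| <= 2 * d * H.
    rewrite ler_pM2l ?mulr_gt0 //; apply: (le_trans (boundl _ _ _ _ _ sg1)).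
    by rewrite /H; lra.
  rewrite -[X in X * `|_|]gtr0_norm ?mulr_gt0 // -normrM ler_norml => /andP[h1 h2].
  by rewrite subE; have := db i; lra.
pose q j := (th *m A) 0 j.
exists q => [j|].
  rewrite /q /th mulmxBl -/(moment_row A nd) -scalemxAl -mulmxA -/B subE addrC addKr.
  rewrite normrN normrM gtr0_norm ?mulr_gt0 //; apply: le_trans dE.
  rewrite ler_pM2l ?mulr_gt0 //.
  apply: (le_trans (boundl _ _ B sg j sg1)).
  by rewrite /H; lra.
have thA k : (th *m Ak) 0 k = 1 - 2 * d * Num.sg (xi 0 k).
  rewrite /th mulmxBl (dual_row_mul_basis kappa_opt) -scalemxAl mulmxKV //.
  by rewrite subE !mxE.
have -> : \sum_k (xi 0 k - 2 * d * `|xi 0 k|) + \sum_(j | kappa j 0 == 0) q j * s j =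
    \sum_i th 0 i * (\sum_k Ak i k * xi 0 k + \sum_(j | kappa j 0 == 0) A i j * s j).
  transitivity (\sum_i \sum_k th 0 i * (Ak i k * xi 0 k) +
      \sum_i \sum_(j | kappa j 0 == 0) th 0 i * (A i j * s j)); last first.
    by rewrite -big_split; apply: eq_bigr => i _; rewrite mulrDr !mulr_sumr.
  congr (_ + _).
    rewrite exchange_big; apply: eq_bigr => k _ /=.
    under eq_bigr do rewrite mulrA.
    rewrite -mulr_suml; have := thA k; rewrite mxE => ->.
    by rewrite mulrBl mul1r [in LHS]normrEsg mulrA.
  rewrite exchange_big; apply: eq_bigr => j _ /=.
  by rewrite /q mxE mulr_suml; apply: eq_bigr => i _; rewrite mulrA.
rewrite mulr_suml -sumrN; apply: ler_sum => i _.
have /andP[t0 t1] := thb i.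
apply: (@le_trans _ _ (th 0 i * L)); last by rewrite ler_wpM2l.
rewrite lerNl; apply: (le_trans (ler_norm _)).
by rewrite normrN normrM (ger0_norm t0) ler_wpM2r.
Unshelve. all: by end_near.
Qed.

End cone_estimate.

(** * Rescaled power products *)

Section independent_products.
Context {R : realType} {m : nat} d {T : measurableType d} {P : probability T R}.
Variable X : 'I_m -> {RV P >-> R}.
Hypothesis X_indep : mutually_independent X.

(** Independence identifies the joint law with the product of the marginal laws. The
    variables outside [Q] get the constant weight one. *)
Lemma ge0_expectation_prod (h : 'I_m -> R -> \bar R) (Q : pred 'I_m) :
  (forall j, measurable_fun setT (h j)) -> (forall j x, (0 <= h j x)%E) ->
  (\int[P]_w \prod_(j | Q j) h j (X j w) = \prod_(j | Q j) \int[P]_w h j (X j w))%E.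
Proof.
move=> mh h0.
have mX j : measurable_fun setT (X j : T -> measurableTypeR R).
  exact: (@measurable_funPT _ _ _ _ (X j)).
pose law j : {sigma_finite_measure set (measurableTypeR R) -> \bar R} :=
  image_measure P (mX j).
pose h' j := if Q j then h j else cst 1%E.
have mh' j : measurable_fun setT (h' j) by rewrite /h'; case: (Q j).
have h'0 j x : (0 <= h' j x)%E by rewrite /h'; case: (Q j) => //=; rewrite lee_fin.
have mXrow := measurable_Xrow X.
have lawE C : measurable C -> family_product law C = image_measure P mXrow C.
  apply: family_product_unique => B mB.
  transitivity (P [set w | forall j, j \in [set: 'I_m]%SET -> B j (X j w)]).
    congr (P _); apply/seteqP; split=> w /= Bw j; first by have := Bw j; rewrite mxE.
    by rewrite mxE; apply: Bw; rewrite finset.in_setT.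
  by rewrite X_indep //; apply: eq_bigl => j; rewrite finset.in_setT.
transitivity (\int[P]_w \prod_j h' j ((Xrow X w : 'rV[R]_m) 0%R j))%E.
  apply: eq_integral => w _; rewrite big_mkcond; apply: eq_bigr => j _.
  by rewrite mxE /h'; case: (Q j).
rewrite -(ge0_integral_image P mXrow (g := fun z => \prod_j h' j ((z : 'rV[R]_m) 0%R j))%E); last 2 first.
- by apply: emeasurable_prod => j; exact: (measurableT_comp (mh' j) (@measurable_coord R m j)).
- by move=> z; apply: prode_ge0.
transitivity (\int[family_product law]_z \prod_j h' j ((z : 'rV[R]_m) 0%R j))%E.
  by apply: eq_measure_integral => C mC _; exact/esym/lawE.
rewrite ge0_integral_family_product_prod // [RHS]big_mkcond; apply: eq_bigr => j _.
rewrite [LHS]ge0_integral_image //; last exact: mh'.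
rewrite /h'; case: (Q j) => //=; rewrite integral_cst // mul1e.
exact: probability_setT.
Qed.

End independent_products.

Section rescaled_power_products.
Context {R : realType} {m n : nat}.
Variables (A : 'M[R]_(n, m)) (kappa : 'cV[R]_m).
Hypothesis kappa_opt : lp_unique_optimal A kappa.
Hypothesis nd : lp_nondegenerate n kappa.
Local Notation idx := (basis_idx nd).
Local Notation Ak := (basis_mx A nd).
Local Notation b := (dual_row A nd).
Local Notation beta := (moment_row A nd).
Local Notation expn n := (family_product (fun _ : 'I_n => @expm R)).
Context d {T : measurableType d} {P : probability T R}.
Variable X : 'I_m -> {RV P >-> R}.
Hypothesis X_indep : mutually_independent X.
Hypothesis X_rv : forall j, 0 < kappa j 0 -> regularly_varying_RV (X j) (- 1).
Variable eps : R.
Hypothesis eps_gt0 : 0 < eps.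
Hypothesis X_moment : forall j, kappa j 0 = 0 ->
  (\int[P]_w epow (X j w) (beta 0 j + eps)%R < +oo)%E /\
  (\int[P]_w epow (X j w) (beta 0 j - eps)%R < +oo)%E.

Local Notation M := (P \x expn n)%E.

Definition levels (x : R) (k : 'I_n) : R := x `^ kappa (idx k) 0.

(** Written with logarithms, hence equal to the power products only at vectors with
    positive coordinates; all uses are restricted to these. *)
Definition powers (z : borel_rV R m) : borel_rV R n :=
  \row_i expR (\sum_j A i j * ln ((z : 'rV[R]_m) 0 j)).

Definition all_pos : set (borel_rV R m) :=
  [set z | forall j, 0 < (z : 'rV[R]_m) 0 j].

Definition log_rest (w : T) (i : 'I_n) : R :=
  \sum_(j | kappa j 0 == 0) A i j * ln (X j w).

(** What the rescaled power products become when [ln (q t u / t)] is replaced by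
    its limit [u]. *)
Definition limit_powers (p : T * borel_rV R n) : borel_rV R n :=
  \row_i expR (\sum_k Ak i k * (p.2 : 'rV[R]_n) 0 k + log_rest p.1 i).

Definition rest_pos : set (T * borel_rV R n) :=
  [set p | forall j, kappa j 0 = 0 -> 0 < X j p.1].

Lemma measurable_powers : measurable_fun setT powers.
Proof.
apply: measurable_row => i; under eq_fun do rewrite mxE.
apply: (measurableT_comp (@measurable_expR R)); apply: measurable_sum => j.
apply: measurable_funM; first exact: measurable_cst.
exact: (measurableT_comp (@measurable_ln R) (@measurable_coord R m j)).
Qed.

Lemma measurable_scale k (x : R) :
  measurable_fun setT (fun y : borel_rV R k => (x *: (y : 'rV[R]_k) : borel_rV R k)).
Proof.
apply: measurable_row => i; under eq_fun do rewrite mxE.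
by apply: measurable_funM; [exact: measurable_cst|exact: measurable_coord].
Qed.

Lemma measurable_all_pos : measurable all_pos.
Proof.
rewrite (_ : all_pos = rect (fun=> `]0, +oo[%classic)).
  by apply: measurable_rect => j; exact: measurable_itv.
by apply/seteqP; split=> z /= zp j; have := zp j; rewrite /= in_itv /= andbT.
Qed.

Lemma measurable_RV_comp_fst j :
  measurable_fun setT (fun p : T * borel_rV R n => X j p.1).
Proof. exact: (measurableT_comp (@measurable_funPT _ _ _ _ (X j)) measurable_fst). Qed.

Lemma measurable_limit_powers : measurable_fun setT limit_powers.
Proof.
apply: measurable_row => i; under eq_fun do rewrite mxE.
apply: (measurableT_comp (@measurable_expR R)); apply: measurable_funD.
  apply: measurable_sum => k; apply: measurable_funM; first exact: measurable_cst.
  exact: (measurableT_comp (@measurable_coord R n k) measurable_snd).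
under eq_fun do rewrite /log_rest big_mkcond.
apply: measurable_sum => j; case: (_ == _); last exact: measurable_cst.
apply: measurable_funM; first exact: measurable_cst.
exact: (measurableT_comp (@measurable_ln R) (measurable_RV_comp_fst j)).
Qed.

Lemma measurable_rest_pos : measurable rest_pos.
Proof.
rewrite (_ : rest_pos = \bigcap_(j in [set j : 'I_m | kappa j 0 = 0])
    (fun p : T * borel_rV R n => X j p.1) @^-1` `]0, +oo[).
  apply: fin_bigcap_measurable => // j _; rewrite -[X in measurable X]setTI.
  by apply: measurable_RV_comp_fst => //; exact: measurable_itv.
by apply/seteqP; split=> p /= pp j kj; have := pp j kj; rewrite /= in_itv /= andbT.
Qed.

(** Since [A_kappa kappa = 1], dividing by [x] amounts to dividing each basic
    coordinate by its level [x^kappa_k]. *)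
Lemma rescaled_powers x p i : 0 < x -> all_pos (merge_row nd X (levels x) p) ->
  (x^-1 *: (powers (merge_row nd X (levels x) p) : 'rV[R]_n)) 0 i =
  expR (\sum_k Ak i k * ln (tail_quantile (survival (X (idx k))) (levels x k)
    ((p.2 : 'rV[R]_n) 0 k) / levels x k) + log_rest p.1 i).
Proof.
move=> x0 pos; rewrite mxE mxE -{1}(lnK x0) -expRN -expRD; congr expR.
rewrite (big_basisC kappa_opt nd) /= addrA; congr (_ + _); last first.
  by apply: eq_bigr => j /eqP kj; rewrite mxE merge_nonbasis.
rewrite -[ln x]mul1r.
have lx : \sum_k Ak i k * (kappa (idx k) 0 * ln x) = 1 * ln x.
  by rewrite -(basis_mx_kappa kappa_opt nd i) mulr_suml; apply: eq_bigr => k _; rewrite mulrA.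
rewrite -{}lx -sumrN -big_split; apply: eq_bigr => k _ /=.
have mE : (merge_row nd X (levels x) p : 'rV[R]_m) 0 (idx k) =
    tail_quantile (survival (X (idx k))) (levels x k) ((p.2 : 'rV[R]_n) 0 k).
  by rewrite mxE merge_basis mxE.
have := pos (idx k); rewrite mE => qk.
rewrite ln_div ?posrE ?powR_gt0 // ln_powR basis_mxE.
by rewrite mulrBr addrC.
Qed.

End rescaled_power_products.

(** * Domination and convergence *)

Lemma lee_prod (R : realDomainType) (I : Type) (s : seq I) (Q : pred I)
    (f g : I -> \bar R) :
  (forall i, Q i -> (0 <= f i <= g i)%E) ->
  (\prod_(i <- s | Q i) f i <= \prod_(i <- s | Q i) g i)%E.
Proof.
move=> fg; suff /andP[] : (0 <= \prod_(i <- s | Q i) f i <= \prod_(i <- s | Q i) g i)%E by [].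
apply: (big_ind2 (fun x y => 0 <= x <= y)%E) => [|x1 x2 y1 y2|i Qi]; last exact: fg.
  by rewrite lee_fin ler01 lexx.
move=> /andP[x0 x12] /andP[y0 y12].
by rewrite mule_ge0 //= lee_pmul.
Qed.

Lemma cvg_sumr (R : realType) (I : Type) (s : seq I) (U : Type) (F : set_system U)
    {FF : Filter F} (f : I -> U -> R) (l : I -> R) :
  (forall i, f i x @[x --> F] --> l i) ->
  \sum_(i <- s) f i x @[x --> F] --> \sum_(i <- s) l i.
Proof.
move=> fl; elim: s => [|i s IHs].
  by rewrite big_nil; under eq_fun do rewrite big_nil; exact: cvg_cst.
by rewrite big_cons; under eq_fun do rewrite big_cons; exact: cvgD.
Qed.

Lemma cvg_prodr (R : realType) (I : Type) (s : seq I) (U : Type) (F : set_system U)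
    {FF : Filter F} (f : I -> U -> R) (l : I -> R) :
  (forall i, f i x @[x --> F] --> l i) ->
  \prod_(i <- s) f i x @[x --> F] --> \prod_(i <- s) l i.
Proof.
move=> fl; elim: s => [|i s IHs].
  by rewrite big_nil; under eq_fun do rewrite big_nil; exact: cvg_cst.
by rewrite big_cons; under eq_fun do rewrite big_cons; exact: cvgM.
Qed.

Lemma cvg_row (R : realType) k (U : Type) (F : set_system U) {FF : Filter F}
    (g : U -> 'rV[R]_k) (y : 'rV[R]_k) :
  (forall i, g u 0 i @[u --> F] --> y 0 i) -> g @ F --> y.
Proof.
move=> gy; apply/cvg_ballP => e e0.
have : \forall u \near F, forall i, ball (y 0 i) e (g u 0 i).
  by apply: filter_forall => i; move: (gy i) => /cvg_ballP /(_ e e0).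
by apply: filterS => u gu; split=> // i j; rewrite ord1.
Qed.

Section rescaled_integral_cvg.
Context {R : realType} {m n : nat}.
Variables (A : 'M[R]_(n, m)) (kappa : 'cV[R]_m).
Hypothesis kappa_opt : lp_unique_optimal A kappa.
Hypothesis nd : lp_nondegenerate n kappa.
Local Notation idx := (basis_idx nd).
Local Notation Ak := (basis_mx A nd).
Local Notation b := (dual_row A nd).
Local Notation beta := (moment_row A nd).
Local Notation expn n := (family_product (fun _ : 'I_n => @expm R)).
Context d {T : measurableType d} {P : probability T R}.
Variable X : 'I_m -> {RV P >-> R}.
Hypothesis X_indep : mutually_independent X.
Hypothesis X_rv : forall j, 0 < kappa j 0 -> regularly_varying_RV (X j) (- 1).
Variable eps : R.
Hypothesis eps_gt0 : 0 < eps.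
Hypothesis X_moment : forall j, kappa j 0 = 0 ->
  (\int[P]_w epow (X j w) (beta 0 j + eps)%R < +oo)%E /\
  (\int[P]_w epow (X j w) (beta 0 j - eps)%R < +oo)%E.

Local Notation M := (P \x expn n)%E.
Local Notation merged x p := (merge_row nd X (levels nd x) p).
Local Notation powers := (powers A).

Lemma near_levels t k : \forall x \near +oo, t <= levels nd x k.
Proof.
have k0 := kappa_basis_gt0 nd k.
near=> x; rewrite /levels.
have x0 : 0 <= x by near: x; apply: nbhs_pinfty_ge; exact: num_real.
have [t0|t0] := leP t 0; first by rewrite (le_trans t0) // powR_ge0.
rewrite -[t in t <= _](powRr1 (ltW t0)) -(mulVf (lt0r_neq0 k0)) powRrM.
by apply: ge0_ler_powR; rewrite ?nnegrE ?powR_ge0 ?(ltW k0).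
Unshelve. all: by end_near.
Qed.

Lemma levels_cvg k : levels nd x k @[x --> +oo] --> +oo.
Proof. by apply/cvgryPge => t; exact: near_levels. Qed.

(** Dominates all powers with exponents within [eps] of [beta_j], and is
    integrable by the moment hypotheses. *)
Definition moment_bound (j : 'I_m) (x : R) : \bar R :=
  (epow x (beta 0%R j + eps)%R + epow x (beta 0%R j - eps)%R)%E.

Lemma epow_ge0 (x a : R) : (0 <= epow x a)%E.
Proof. by rewrite /epow; case: ifP => // _; rewrite lee_fin powR_ge0. Qed.

Lemma epow_gt0E (x a : R) : 0 < x -> epow x a = (expR (a * ln x))%:E.
Proof. by move=> x0; rewrite /epow /powR gt_eqF. Qed.

Lemma moment_bound_ge0 j x : (0 <= moment_bound j x)%E.
Proof. by rewrite adde_ge0 ?epow_ge0. Qed.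

Definition dominating (C e : R) (p : T * borel_rV R n) : \bar R :=
  (C%:E * ((\prod_(j | kappa j 0%R == 0%R) moment_bound j (X j p.1)) *
    \prod_k (expR ((p.2 : 'rV[R]_n) 0%R k - e * `|(p.2 : 'rV[R]_n) 0%R k|))%:E))%E.

Lemma moment_bound_expR j x q : 0 < x -> `|q - beta 0 j| <= eps ->
  ((expR (q * ln x))%:E <= moment_bound j x)%E.
Proof.
move=> x0 qb; rewrite /moment_bound !epow_gt0E // -EFinD lee_fin.
move: qb; rewrite ler_norml => /andP[q1 q2].
have [l0|l0] := leP 0 (ln x).
  apply: (@le_trans _ _ (expR ((beta 0 j + eps) * ln x))); last by rewrite lerDl expR_ge0.
  by rewrite ler_expR ler_wpM2r //; lra.
apply: (@le_trans _ _ (expR ((beta 0 j - eps) * ln x))); last by rewrite lerDr expR_ge0.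
by rewrite ler_expR ler_wnM2r ?(ltW l0) //; lra.
Qed.

(** Exponentiate the cone estimate with lower bound [L = ln r], then apply the
    quantile bound to the basic variables and [moment_bound_expR] to the others. *)
Lemma powers_dominated (r : R) : 0 < r -> exists C e : R, [/\ 0 <= C, 0 < e &
  \forall x \near +oo, forall p, all_pos (merged x p) ->
    (forall i, r <= (x^-1 *: (powers (merged x p) : 'rV[R]_n)) 0 i) ->
    (1 <= dominating C e p)%E].
Proof.
move=> r0; have [e [K [/andP[e0 e1] K0 cone]]] := cone_estimate kappa_opt nd eps_gt0.
have e01 : 0 < e < 1 by apply/andP; split; lra.
have /choice[Ct CtP] : forall k, exists Ct : R * R, [/\ 0 <= Ct.1, 0 < Ct.2 &
    forall t u, Ct.2 <= t -> 0 < tail_quantile (survival (X (idx k))) t u ->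
     let x := ln (tail_quantile (survival (X (idx k))) t u / t) in
     x - 2 * e * `|x| <= u - e / 2 * `|u| + Ct.1].
  move=> k; have [C [t0 H]] := survival_quantile_bound (X_rv (kappa_basis_gt0 nd k)) e01.
  by exists (C, t0).
exists (expR (K * `|ln r| + \sum_k (Ct k).1)), (e / 2); split.
- exact: expR_ge0.
- by rewrite divr_gt0.
have lev : \forall x \near +oo, forall k, (Ct k).2 <= levels nd x k.
  by apply: filter_forall => k; exact: near_levels.
near=> x => p pos ler.
have x0 : 0 < x by near: x; apply: nbhs_pinfty_gt; exact: num_real.
have levx : forall k, (Ct k).2 <= levels nd x k by near: x.
pose xi : 'rV[R]_n := \row_k ln (tail_quantile (survival (X (idx k))) (levels nd x k)
    ((p.2 : 'rV[R]_n) 0 k) / levels nd x k).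
have [|q qb qs] := cone xi (fun j => ln (X j p.1)) (ln r).
  move=> i; have := ler i; rewrite (rescaled_powers kappa_opt) // => ri.
  rewrite -ler_expR lnK ?posrE //; apply: (le_trans ri); rewrite ler_expR.
  by apply: lerD => //; apply: ler_sum => k _; rewrite [xi 0 k]mxE.
have Xpos j : kappa j 0 = 0 -> 0 < X j p.1.
  by move=> kj; have := pos j; rewrite mxE merge_nonbasis.
have prodq : ((expR (\sum_(j | kappa j 0 == 0) q j * ln (X j p.1)))%:E <=
    \prod_(j | kappa j 0%R == 0%R) moment_bound j (X j p.1))%E.
  rewrite expR_sum -prodEFin; apply: lee_prod => j /eqP kj.
  by rewrite lee_fin expR_ge0 moment_bound_expR // Xpos.
have xib : \sum_k (xi 0 k - 2 * e * `|xi 0 k|) <=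
    \sum_k ((p.2 : 'rV[R]_n) 0 k - e / 2 * `|(p.2 : 'rV[R]_n) 0 k|) + \sum_k (Ct k).1.
  rewrite -big_split; apply: ler_sum => k _ /=.
  have [_ _ H] := CtP k; rewrite [xi 0 k]mxE; apply: H => //.
  by have := pos (idx k); rewrite mxE merge_basis mxE.
apply: (@le_trans _ _ ((expR (K * `|ln r| + \sum_k (Ct k).1))%:E *
   ((expR (\sum_(j | kappa j 0 == 0) q j * ln (X j p.1)))%:E *
    (expR (\sum_k ((p.2 : 'rV[R]_n) 0 k - e / 2 * `|(p.2 : 'rV[R]_n) 0 k|)))%:E))%E).
  rewrite -!EFinM lee_fin -!expRD -[leLHS]expR0 ler_expR.
  move: qs xib => /=; set s1 := \sum_k _; set s2 := \sum_(j | _) _; set s3 := \sum_k _.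
  by set s4 := \sum_k _; lra.
rewrite /dominating; apply: lee_pmul => //; try by rewrite ?mule_ge0 // lee_fin expR_ge0.
by rewrite [in leRHS]prodEFin -expR_sum; apply: lee_pmul => //; rewrite lee_fin expR_ge0.
Unshelve. all: by end_near.
Qed.

Lemma measurable_moment_bound j : measurable_fun [set: R] (moment_bound j).
Proof. by apply: emeasurable_funD; exact: measurable_epow. Qed.

(** The dominating function is a product of functions of independent coordinates,
    each of which has a finite integral. *)
Lemma dominating_integrable (C e : R) : 0 <= C -> 0 < e ->
  M.-integrable setT (dominating C e).
Proof.
move=> C0 e0.
pose h (_ : 'I_n) (u : R) := (expR (u - e * `|u|))%:E.
have mh k : measurable_fun [set: R] (h k).
  apply/measurable_EFinP; apply: (measurableT_comp (@measurable_expR R)).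
  apply: measurable_funB => //; apply: measurable_funM; first exact: measurable_cst.
  exact: normr_measurable.
have h0 k u : (0 <= h k u)%E by rewrite lee_fin expR_ge0.
have mrest : measurable_fun setT
    (fun w => \prod_(j | kappa j 0%R == 0%R) moment_bound j (X j w))%E.
  apply: emeasurable_prod => j.
  exact: (measurableT_comp (measurable_moment_bound j) (@measurable_funPT _ _ _ _ (X j))).
have mprod : measurable_fun setT (fun z : borel_rV R n => \prod_k h k ((z : 'rV[R]_n) 0%R k))%E.
  by apply: emeasurable_prod => k; exact: (measurableT_comp (mh k) (@measurable_coord R n k)).
have mcprod (c : \bar R) : measurable_fun setT
    (fun z : borel_rV R n => c * \prod_k h k ((z : 'rV[R]_n) 0%R k))%E.
  exact: measurable_funeM.
have rest0 w : (0 <= \prod_(j | kappa j 0%R == 0%R) moment_bound j (X j w))%E.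
  by apply: prode_ge0 => j _; exact: moment_bound_ge0.
have prod0 z : (0 <= \prod_k h k ((z : 'rV[R]_n) 0%R k))%E by exact: prode_ge0.
have dom0 p : (0 <= dominating C e p)%E.
  by apply: mule_ge0; [rewrite lee_fin|apply: mule_ge0; [exact: rest0|exact: prod0]].
have mdom : measurable_fun setT (dominating C e).
  apply: emeasurable_funM; first exact: measurable_cst.
  apply: emeasurable_funM; first exact: (measurableT_comp mrest measurable_fst).
  exact: (measurableT_comp mprod measurable_snd).
apply/integrableP; split => //.
under eq_integral do rewrite gee0_abs //.
rewrite fubini_tonelli1 //.
pose K := (\prod_(k < n) \int[@expm R]_u h k u)%E.
have K0 : (0 <= K)%E by apply: prode_ge0 => k _; exact: integral_ge0.
have Kfin : K \is a fin_num.
  by apply: prode_fin_num => k _; rewrite ge0_fin_numE ?expm_two_sided_lty ?integral_ge0.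
rewrite (eq_integral (fun w =>
    C%:E * ((\prod_(j | kappa j 0%R == 0%R) moment_bound j (X j w)) * K))%E); last first.
  move=> w _; rewrite /fubini_F /dominating ge0_integralZl //; last 2 first.
  - exact: (mcprod (\prod_(j | kappa j 0%R == 0%R) moment_bound j (X j w))%E).
  - by move=> z _; apply: mule_ge0; [exact: rest0|exact: prod0].
  congr (_ * _)%E.
  rewrite -[LHS]/(\int[expn n]_z ((\prod_(j | kappa j 0%R == 0%R) moment_bound j (X j w)) *
    \prod_k h k ((z : 'rV[R]_n) 0%R k)))%E ge0_integralZl //; congr (_ * _)%E.
  exact: (ge0_integral_family_product_prod (fun=> @expm R)).
rewrite ge0_integralZl //; last 2 first.
- by apply: emeasurable_funM; [exact: mrest|exact: measurable_cst].
- by move=> w _; apply: mule_ge0; [exact: rest0|].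
rewrite ge0_integralZr // (ge0_expectation_prod X_indep); last 2 first.
- exact: measurable_moment_bound.
- by move=> j x; exact: moment_bound_ge0.
rewrite ltey_eq; apply/orP; left; rewrite !fin_numM //.
apply: prode_fin_num => j /eqP kj.
have mX a : measurable_fun setT (fun w => epow (X j w) a).
  exact: (measurableT_comp (measurable_epow a) (@measurable_funPT _ _ _ _ (X j))).
rewrite ge0_integralD //; try by move=> w _; exact: epow_ge0.
have [m1 m2] := X_moment kj.
have i0 a : (0 <= \int[P]_w epow (X j w) a)%E.
  by apply: integral_ge0 => w _; exact: epow_ge0.
by rewrite fin_numD !ge0_fin_numE // m1 m2.
Qed.

Definition test_value (f : borel_rV R n -> R) (x : R) (z : borel_rV R m) : \bar R :=
  (f (x^-1 *: (powers z : 'rV[R]_n)) * \1_(@all_pos R m) z)%:E.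

Definition limit_test_value (f : borel_rV R n -> R) (p : T * borel_rV R n) : \bar R :=
  (f (limit_powers A nd X p) * \1_(rest_pos kappa X) p)%:E.

Lemma measurable_test_value f x : measurable_fun setT f -> measurable_fun setT (test_value f x).
Proof.
move=> mf; apply/measurable_EFinP; apply: measurable_funM; last first.
  by apply: measurable_indic; exact: (@measurable_all_pos R m).
apply: (measurableT_comp mf).
exact: (measurableT_comp (@measurable_scale R n x^-1) (measurable_powers A)).
Qed.

Lemma merged_cvg p : rest_pos kappa X p ->
  (\forall x \near +oo, all_pos (merged x p)) /\
  (x^-1 *: (powers (merged x p) : 'rV[R]_n) @[x --> +oo] -->
   (limit_powers A nd X p : 'rV[R]_n)).
Proof.
move=> pp.
have pos : \forall x \near +oo, all_pos (merged x p).
  have q_pos : \forall x \near +oo, forall k, 0 < tail_quantile (survival (X (idx k)))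
      (levels nd x k) ((p.2 : 'rV[R]_n) 0 k).
    apply: filter_forall => k.
    exact: (levels_cvg k (survival_quantile_near_gt0 (X_rv (kappa_basis_gt0 nd k)) _)).
  apply: filterS q_pos => x qx; apply/(forall_basis kappa_opt nd); split=> [k|j kj].
    by rewrite mxE merge_basis mxE.
  by rewrite mxE merge_nonbasis //; exact: pp.
split=> //; apply: cvg_row => i.
apply: (@cvg_trans _ (expR (\sum_k Ak i k * ln (tail_quantile (survival (X (idx k)))
    (levels nd x k) ((p.2 : 'rV[R]_n) 0 k) / levels nd x k) + log_rest A kappa X p.1 i)
    @[x --> +oo])).
  apply: near_eq_cvg; near=> x.
  have x0 : 0 < x by near: x; apply: nbhs_pinfty_gt; exact: num_real.
  have posx : all_pos (merged x p) by near: x.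
  by rewrite (rescaled_powers kappa_opt).
have -> : (limit_powers A nd X p : 'rV[R]_n) 0 i =
    expR (\sum_k Ak i k * (p.2 : 'rV[R]_n) 0 k + log_rest A kappa X p.1 i) by rewrite mxE.
apply: continuous_cvg; first exact: continuous_expR.
apply: cvgD; last exact: cvg_cst.
apply: cvg_sumr => k; apply: cvgMl_tmp.
pose u := (p.2 : 'rV[R]_n) 0 k.
have qcv := @survival_quantile_cvg _ _ _ _ _ (X_rv (kappa_basis_gt0 nd k)) u.
have lcv := @levels_cvg k.
exact: cvg_comp lcv qcv.
Unshelve. all: by end_near.
Qed.

(** Where some nonbasic variable vanishes both sides are zero; elsewhere the
    integrands converge by [merged_cvg] and the continuity of [f] at the limit. *)
Lemma rescaled_integral_cvg_seq (f : borel_rV R n -> R) (K r : R) (x_ : nat -> R) :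
  measurable_fun setT f -> (forall y, 0 <= f y <= K) -> 0 < r ->
  (forall y i, (y : 'rV[R]_n) 0 i < r -> f y = 0) ->
  {ae M, forall p, rest_pos kappa X p ->
    {for limit_powers A nd X p : 'rV[R]_n, continuous (f : 'rV[R]_n -> R)}} ->
  x_ N @[N --> \oo] --> +oo ->
  (\int[M]_p test_value f (x_ N) (merged (x_ N) p))%E @[N --> \oo] -->
  (\int[M]_p limit_test_value f p)%E.
Proof.
move=> mf fK r0 fr fcont xoo.
have [C [e [C0 e0 dom]]] := powers_dominated r0.
have := xoo _ dom; rewrite nbhs_nearE => -[N0 _ HN0].
(* The domination holds only for large levels: drop the first terms. *)
rewrite -(cvg_shiftn N0).
have K0 : 0 <= K by have /andP[/le_trans] := fK 0; apply.
have domK : M.-integrable setT (fun p => K%:E * dominating C e p)%E.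
  by apply: integrableZl => //; exact: dominating_integrable.
have mt x : measurable_fun setT (fun p => test_value f x (merged x p)).
  apply: (measurableT_comp (measurable_test_value x mf)).
  exact: measurable_merge_row.
have mlim : measurable_fun setT (limit_test_value f).
  apply/measurable_EFinP; apply: measurable_funM; last first.
    by apply: measurable_indic; exact: measurable_rest_pos.
  by apply: (measurableT_comp mf); exact: measurable_limit_powers.
have xoo' : x_ (N + N0)%N @[N --> \oo] --> +oo by exact: cvg_comp (cvg_addnr N0) xoo.
have fcv : {ae M, forall p, setT p ->
    (fun N => test_value f (x_ (N + N0)%N) (merged (x_ (N + N0)%N) p)) @ \oo -->
    limit_test_value f p}.
  apply: filterS fcont => p pc _.
  have [pp|npp] := pselect (rest_pos kappa X p); last first.
    rewrite /limit_test_value indicE memNset // mulr0.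
    rewrite (_ : (fun N => _) = fun=> 0%E); first exact: cvg_cst.
    apply/funext => N; rewrite /test_value indicE memNset ?mulr0 // => pos.
    by apply: npp => j kj; have := pos j; rewrite mxE merge_nonbasis.
  have [pos cv] := merged_cvg pp.
  have fcv : f (x^-1 *: (powers (merged x p) : 'rV[R]_n)) * \1_(@all_pos R m) (merged x p)
      @[x --> +oo] --> f (limit_powers A nd X p).
    apply: (@cvg_trans _ (f (x^-1 *: (powers (merged x p) : 'rV[R]_n)) @[x --> +oo])).
      apply: near_eq_cvg; near=> x; rewrite indicE mem_set ?mulr1 //.
      by near: x.
    exact: cvg_comp cv (pc pp).
  rewrite /limit_test_value indicE mem_set // mulr1.
  apply: cvg_EFin; first by apply: nearW.
  exact: cvg_comp xoo' fcv.
have bnd : {ae M, forall p N, setT p ->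
    `|test_value f (x_ (N + N0)%N) (merged (x_ (N + N0)%N) p)| <= K%:E * dominating C e p}%E.
  apply: aeW => p N _.
  have dom0 : (0 <= dominating C e p)%E.
    apply: mule_ge0; first by rewrite lee_fin.
    apply: mule_ge0; apply: prode_ge0 => j _; first exact: moment_bound_ge0.
    by rewrite lee_fin expR_ge0.
  have rhs0 : (0 <= K%:E * dominating C e p)%E by apply: mule_ge0; rewrite ?lee_fin.
  rewrite /test_value; set x := x_ _; set y := x^-1 *: _.
  have [pos|npos] := pselect (all_pos (merged x p)); last first.
    by rewrite indicE memNset // mulr0 abse0.
  have [yr|/existsNP[i /negP yr]] := pselect (forall i, r <= y 0 i); last first.
    by rewrite (fr y i) ?mul0r ?abse0 // ltNge.
  have /andP[f0 fK1] := fK y.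
  rewrite indicE mem_set // mulr1 abse_EFin ger0_norm //.
  apply: (@le_trans _ _ K%:E); first by rewrite lee_fin.
  rewrite -[leLHS]mule1; apply: lee_pmul; rewrite ?lee_fin ?ler01 //.
  by apply: (HN0 (N + N0)%N) => //=; rewrite leq_addl.
have [_ _ H] := dominated_convergence measurableT (fun N => mt _) mlim fcv domK bnd.
exact: H.
Unshelve. all: by end_near.
Qed.

End rescaled_integral_cvg.

(** * The limit measure *)

Section limit_measure.
Context {R : realType} {m n : nat}.
Variables (A : 'M[R]_(n, m)) (kappa : 'cV[R]_m).
Hypothesis kappa_opt : lp_unique_optimal A kappa.
Hypothesis nd : lp_nondegenerate n kappa.
Local Notation idx := (basis_idx nd).
Local Notation Ak := (basis_mx A nd).
Local Notation b := (dual_row A nd).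
Local Notation beta := (moment_row A nd).
Local Notation expn n := (family_product (fun _ : 'I_n => @expm R)).
Context d {T : measurableType d} {P : probability T R}.
Variable X : 'I_m -> {RV P >-> R}.
Hypothesis X_ge0 : forall j w, 0 <= X j w.
Hypothesis X_indep : mutually_independent X.
Hypothesis X_rv : forall j, 0 < kappa j 0 -> regularly_varying_RV (X j) (- 1).
Variable eps : R.
Hypothesis eps_gt0 : 0 < eps.
Hypothesis X_moment : forall j, kappa j 0 = 0 ->
  (\int[P]_w epow (X j w) (beta 0 j + eps)%R < +oo)%E /\
  (\int[P]_w epow (X j w) (beta 0 j - eps)%R < +oo)%E.

Local Notation M := (P \x expn n)%E.
Local Notation limit_powers := (limit_powers A nd X).
Local Notation rest_pos := (rest_pos (n := n) kappa X).

Lemma tail_productE x : tail_product kappa X x = levels_tail nd X (levels nd x).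
Proof. by rewrite /tail_product (big_basis nd). Qed.

Lemma tail_product_gt0 x : 0 < tail_product kappa X x.
Proof.
rewrite tail_productE; apply: prodr_gt0 => k _.
exact: (survival_gt0 (X_rv (kappa_basis_gt0 nd k))).
Qed.

(** By [coupling_integral] the tail product cancels exactly, for every [x]. *)
Lemma rescaled_integral_cvg (f : borel_rV R n -> R) (K r : R) :
  measurable_fun setT f -> (forall y, 0 <= f y <= K) -> 0 < r ->
  (forall y i, (y : 'rV[R]_n) 0 i < r -> f y = 0) ->
  {ae M, forall p, rest_pos p ->
    {for limit_powers p : 'rV[R]_n, continuous (f : 'rV[R]_n -> R)}} ->
  ((tail_product kappa X x)^-1%:E * \int[P]_w test_value A f x (Xrow X w))%E
    @[x --> +oo] --> (\int[M]_p limit_test_value A nd X f p)%E.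
Proof.
move=> mf fK r0 fr fcont.
have test0 x z : (0 <= test_value A f x z)%E.
  by rewrite lee_fin mulr_ge0 //; have /andP[] := fK (x^-1 *: powers A z).
have E x : ((tail_product kappa X x)^-1%:E * \int[P]_w test_value A f x (Xrow X w) =
    \int[M]_p test_value A f x (merge_row nd X (levels nd x) p))%E.
  rewrite (coupling_integral kappa_opt X_indep X_rv (levels nd x)
    (measurable_test_value A x mf) (test0 x)).
    rewrite muleA -EFinM -tail_productE mulVf ?mul1e //.
    by rewrite gt_eqF ?tail_product_gt0.
  move=> z npos; rewrite /test_value indicE memNset ?mulr0 // => pos.
  by apply: npos => k; exact: pos.
under eq_fun do rewrite E.
apply/cvge_pinftyP => x_ xoo.
exact: (rescaled_integral_cvg_seq kappa_opt X_indep X_rv eps_gt0 X_moment mf fK r0 fr fcont xoo).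
Qed.

Definition limit_measure : set (borel_rV R n) -> \bar R :=
  image_measure (mrestr M (measurable_rest_pos kappa X)) (measurable_limit_powers A nd X).

HB.instance Definition _ := Measure.on limit_measure.

Lemma ge0_integral_limit_measure (f : borel_rV R n -> R) :
  measurable_fun setT f -> (forall y, 0 <= f y) ->
  (\int[limit_measure]_y (f y)%:E = \int[M]_p limit_test_value A nd X f p)%E.
Proof.
move=> mf f0.
have mEf : measurable_fun setT (fun y => (f y)%:E) by exact/measurable_EFinP.
have Ef0 y : (0 <= (f y)%:E)%E by rewrite lee_fin.
have mlim := measurable_limit_powers A nd X.
rewrite [LHS](ge0_integral_image _ mlim mEf Ef0).
rewrite [LHS](ge0_integral_mrestr _ _ (measurableT_comp mEf mlim) (fun p => Ef0 _)).
rewrite integral_mkcond; apply: eq_integral => p _.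
by rewrite patchE /limit_test_value indicE; case: ifPn; rewrite ?mulr1 ?mulr0.
Qed.

(** The finite moment has the exponent [beta_j - eps < 0], and a negative power is
    infinite at zero. *)
Lemma positive_ae j : kappa j 0 = 0 -> beta 0 j <= 0 -> {ae P, forall w, 0 < X j w}.
Proof.
move=> kj bj; have [_ m2] := X_moment kj.
have bneg : beta 0 j - eps < 0 by rewrite subr_lt0 (le_lt_trans bj).
have int2 : P.-integrable setT (fun w => epow (X j w) (beta 0 j - eps)).
  apply/integrableP; split.
    exact: (measurableT_comp (measurable_epow _) (@measurable_funPT _ _ _ _ (X j))).
  by under eq_integral do rewrite gee0_abs ?epow_ge0 //.
apply: filterS (integrable_ae measurableT int2) => w /(_ I).
rewrite lt0r X_ge0 andbT; apply: contraTneq => ->.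
by rewrite /epow eqxx bneg.
Qed.

(** The power on [(0, oo)], cut off at zero as the limiting products are by
    [rest_pos]. *)
Definition pos_powR (a x : R) : \bar R := if 0 < x then (expR (a * ln x))%:E else 0%E.

Lemma pos_powR_ge0 a x : (0 <= pos_powR a x)%E.
Proof. by rewrite /pos_powR; case: ifP => // _; rewrite lee_fin expR_ge0. Qed.

Lemma measurable_pos_powR a : measurable_fun [set: R] (pos_powR a).
Proof.
apply: measurable_fun_ifT => //.
  by apply: measurable_fun_ltr => //; exact: measurable_cst.
apply/measurable_EFinP; apply: (measurableT_comp (@measurable_expR R)).
by apply: measurable_funM => //; exact: measurable_cst.
Qed.

(** The two powers differ only at zero: for [beta_j > 0] both vanish there, and
    for [beta_j <= 0] the variable is almost surely positive. *)
Lemma expectation_pos_powR j : kappa j 0 = 0 ->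
  (\int[P]_w pos_powR (beta 0%R j) (X j w) = \int[P]_w epow (X j w) (beta 0%R j))%E.
Proof.
move=> kj; have mX := @measurable_funPT _ _ _ _ (X j).
apply: ge0_ae_eq_integral => //.
- exact: (measurableT_comp (measurable_pos_powR _) mX).
- exact: (measurableT_comp (measurable_epow _) mX).
- by move=> w _; exact: pos_powR_ge0.
- by move=> w _; exact: epow_ge0.
have [bj|bj] := leP (beta 0 j) 0.
  apply: filterS (positive_ae kj bj) => w Xw _.
  by rewrite /pos_powR Xw epow_gt0E.
apply: aeW => w _; rewrite /pos_powR; case: ltP => Xw; first by rewrite epow_gt0E.
have /eqP -> : X j w == 0 by rewrite eq_le Xw X_ge0.
by rewrite /epow eqxx /= ltNge (ltW bj) /= powR0 // gt_eqF.
Qed.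

Lemma moment_fin_num j : kappa j 0 = 0 ->
  (\int[P]_w epow (X j w) (beta 0%R j) \is a fin_num)%E.
Proof.
move=> kj; rewrite -(expectation_pos_powR kj) ge0_fin_numE; last first.
  by apply: integral_ge0 => w _; exact: pos_powR_ge0.
have [m1 m2] := X_moment kj.
have mX := @measurable_funPT _ _ _ _ (X j).
have mE a : measurable_fun setT (fun w => epow (X j w) a).
  exact: (measurableT_comp (measurable_epow a) mX).
apply: (@le_lt_trans _ _ (\int[P]_w moment_bound A nd eps j (X j w))%E).
  apply: ge0_le_integral => //.
  - by move=> w _; exact: pos_powR_ge0.
  - exact: (measurableT_comp (measurable_pos_powR _) mX).
  - exact: (measurableT_comp (measurable_moment_bound A nd eps j) mX).
  move=> w _; rewrite /pos_powR; case: ltP => Xw; last exact: moment_bound_ge0.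
  by apply: moment_bound_expR => //; rewrite subrr normr0 ltW.
rewrite ge0_integralD //; try by move=> w _; exact: epow_ge0.
exact: lte_add_pinfty.
Qed.

Definition orthant_above (c : 'I_n -> R) : set (borel_rV R n) :=
  [set y : 'rV[R]_n | forall i, c i < y 0 i].

Lemma measurable_orthant_above c : measurable (orthant_above c).
Proof.
rewrite (_ : orthant_above c = rect (fun i => `](c i), +oo[%classic)).
  by apply: measurable_rect => i; exact: measurable_itv.
by apply/seteqP; split=> y /= yc i; have := yc i; rewrite /= in_itv /= andbT.
Qed.

Lemma sum_dual_log_rest w :
  \sum_i b 0 i * log_rest A kappa X w i =
  \sum_(j | kappa j 0 == 0) beta 0 j * ln (X j w).
Proof.
under eq_bigr do rewrite mulr_sumr.
rewrite exchange_big; apply: eq_bigr => j _ /=.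
by rewrite [beta 0 j]mxE mulr_suml; apply: eq_bigr => i _; rewrite mulrA.
Qed.

(** For fixed nonbasic variables, the section is a set of the form treated in
    [expn_linear_tail] with [M = A_kappa^T], whose hypothesis on [b] is
    [b A_kappa = 1]. The nonbasic variables enter through the corner, that is as a
    factor [exp (sum_i b_i log_rest_i) = prod_j X_j^beta_j]. *)
Lemma limit_measure_above c : (forall i, 0 < c i) ->
  limit_measure (orthant_above c) = limit_value A nd X c.
Proof.
move=> c0; have [uA _] := optimal_basis_unit kappa_opt nd.
have b0 := dual_row_gt0 kappa_opt nd.
pose K := `|\det Ak|^-1 * ((\prod_i c i `^ (- b 0 i)) / \prod_i b 0 i).
have sumb (z : 'rV[R]_n) : \sum_i (z *m Ak^T) 0 i * b 0 i = \sum_i z 0 i.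
  transitivity ((z *m (b *m Ak)^T) 0 0).
    by rewrite trmx_mul mulmxA [RHS]mxE; apply: eq_bigr => i _; rewrite [b^T _ _]mxE.
  rewrite (dual_row_mul_basis kappa_opt) mxE; apply: eq_bigr => i _.
  by rewrite !mxE mulr1.
have sectionE w : (expn n) (xsection (limit_powers @^-1` orthant_above c `&` rest_pos) w) =
    (K%:E * \prod_(j | kappa j 0%R == 0%R) pos_powR (beta 0%R j) (X j w))%E.
  have [wpos|wnpos] := pselect (forall j, kappa j 0 = 0 -> 0 < X j w); last first.
    have [j /not_implyP[kj Xj]] : exists j, ~ (kappa j 0 = 0 -> 0 < X j w) by exact/existsNP.
    rewrite (_ : xsection _ w = set0); last first.
      by apply/seteqP; split=> // z; rewrite /xsection /= inE => -[_ /(_ j kj)].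
    by rewrite measure0 (bigD1 j) ?kj //= /pos_powR (negbTE (introN idP Xj)) mul0e mule0.
  have -> : xsection (limit_powers @^-1` orthant_above c `&` rest_pos) w =
      [set z | forall i, (\row_i (ln (c i) - log_rest A kappa X w i)) 0 i <
        ((z : 'rV[R]_n) *m Ak^T) 0 i].
    have zA (z : 'rV[R]_n) i : (z *m Ak^T) 0 i = \sum_k Ak i k * z 0 k.
      by rewrite mxE; apply: eq_bigr => k _; rewrite mxE mulrC.
    have cE (z : borel_rV R n) i : (c i < (limit_powers (w, z) : 'rV[R]_n) 0 i) =
        (ln (c i) - log_rest A kappa X w i < ((z : 'rV[R]_n) *m Ak^T) 0 i).
      by rewrite mxE zA -{1}[c i]lnK ?posrE // ltr_expR ltrBlDr.
    apply/seteqP; split=> z; rewrite /xsection /= inE.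
      by move=> -[/= zc _] i; rewrite [X in X < _]mxE -cE; exact: zc.
    move=> zc; split=> //= i; rewrite cE.
    by have := zc i; rewrite [X in X < _ -> _]mxE.
  have uAT : Ak^T \in unitmx by rewrite unitmx_tr.
  rewrite (expn_linear_tail _ uAT b0 sumb) det_tr.
  rewrite (eq_bigr (fun j => (expR (beta 0 j * ln (X j w)))%:E)) => [|j /eqP kj]; last first.
    by rewrite /pos_powR wpos.
  rewrite prodEFin -EFinM -expR_sum -sum_dual_log_rest /K -mulrA; congr (_ * _)%:E.
  rewrite prodf_div mulrAC; congr (_ / _).
  rewrite expR_sum -big_split; apply: eq_bigr => i _ /=.
  rewrite /powR gt_eqF // -expRD mxE; congr expR; ring.
rewrite /limit_measure /image_measure /pushforward /mrestr /product_measure1.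
under eq_integral do rewrite /= sectionE.
have K0 : 0 <= K.
  rewrite /K mulr_ge0 // ?invr_ge0 // divr_ge0 //; apply: prodr_ge0 => i _.
    exact: powR_ge0.
  exact: ltW.
rewrite ge0_integralZl_EFin //; last 2 first.
- by move=> w _; apply: prode_ge0 => j _; exact: pos_powR_ge0.
- apply: emeasurable_prod => j.
  exact: (measurableT_comp (measurable_pos_powR _) (@measurable_funPT _ _ _ _ (X j))).
have := ge0_expectation_prod X_indep (h := fun j => pos_powR (beta 0 j))
  (fun j => kappa j 0 == 0) (fun j => measurable_pos_powR _) (fun j => pos_powR_ge0 _).
move=> ->; congr (_ * _)%E; apply: eq_bigr => j /eqP kj; exact: expectation_pos_powR.
Qed.

End limit_measure.

(** * Tail probabilities of power products *)

Lemma measure_ae_iff d (T : measurableType d) (R : realType)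
    (mu : {measure set T -> \bar R}) (B C : set T) :
  measurable B -> measurable C -> {ae mu, forall w, B w <-> C w} -> mu B = mu C.
Proof.
move=> mB mC [N [mN N0 subN]].
have half (B1 C1 : set T) : measurable B1 -> measurable C1 ->
    (forall w, ~ N w -> B1 w -> C1 w) -> (mu B1 <= mu C1)%E.
  move=> mB1 mC1 BC; apply: (@le_trans _ _ (mu (C1 `|` N))).
    apply: le_measure; rewrite ?inE //; first exact: measurableU.
    by move=> w Bw; have [?|nN] := pselect (N w); [right|left; exact: BC].
  by apply: (le_trans (measureU2 _ mC1 mN)); rewrite [X in (_ + X)%E]N0 adde0.
have iffN w : ~ N w -> (B w <-> C w).
  by move=> nN; apply: contrapT => h; apply: nN; exact: subN.
by apply/eqP; rewrite eq_le !half // => w /iffN [].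
Qed.

Section power_products_limit.
Context {R : realType} {m n : nat}.
Variables (A : 'M[R]_(n, m)) (kappa : 'cV[R]_m).
Hypothesis kappa_opt : lp_unique_optimal A kappa.
Hypothesis nd : lp_nondegenerate n kappa.
Local Notation idx := (basis_idx nd).
Local Notation Ak := (basis_mx A nd).
Local Notation b := (dual_row A nd).
Local Notation beta := (moment_row A nd).
Local Notation expn n := (family_product (fun _ : 'I_n => @expm R)).
Context d {T : measurableType d} {P : probability T R}.
Variable X : 'I_m -> {RV P >-> R}.
Hypothesis X_ge0 : forall j w, 0 <= X j w.
Hypothesis X_indep : mutually_independent X.
Hypothesis X_rv : forall j, 0 < kappa j 0 -> regularly_varying_RV (X j) (- 1).
Variable eps : R.
Hypothesis eps_gt0 : 0 < eps.
Hypothesis X_moment : forall j, kappa j 0 = 0 ->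
  (\int[P]_w epow (X j w) (beta 0 j + eps)%R < +oo)%E /\
  (\int[P]_w epow (X j w) (beta 0 j - eps)%R < +oo)%E.

Local Notation M := (P \x expn n)%E.
Local Notation limit_powers := (limit_powers A nd X).
Local Notation rest_pos := (rest_pos (n := n) kappa X).
Local Notation mu := (limit_measure A nd X).

Lemma powprod_pos w i : (forall j, 0 < X j w) ->
  powprod A X i w = ((powers A (Xrow X w) : 'rV[R]_n) 0 i)%:E.
Proof.
move=> Xw; rewrite /powprod mxE expR_sum -prodEFin; apply: eq_bigr => j _.
by rewrite epow_gt0E // mxE.
Qed.

(** If [X_j = 0] while all power products are positive, then [a_ij <= 0] for all
    [i], hence [beta_j <= 0] as [b > 0]. This excludes basic variables, for which
    [beta_j = 1], and nonbasic ones by [positive_ae]. *)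
Lemma powprod_gt0_ae :
  {ae P, forall w, (forall i, 0 < powprod A X i w)%E -> forall j, 0 < X j w}.
Proof.
have rest_ae : {ae P, forall w, forall j, kappa j 0 = 0 -> beta 0 j <= 0 -> 0 < X j w}.
  apply: filter_forall => j.
  have [kj|kj] := pselect (kappa j 0 = 0); last by apply: aeW => w /kj.
  have [bj|bj] := pselect (beta 0 j <= 0); last by apply: aeW => w _ /bj.
  by apply: filterS (positive_ae X_ge0 eps_gt0 X_moment kj bj) => w ? _ _.
apply: filterS rest_ae => w rest pw j; rewrite lt0r X_ge0 andbT; apply/eqP => Xj0.
have Aij i : A i j <= 0.
  rewrite leNgt; apply/negP => Aij; have := pw i.
  rewrite /powprod (bigD1 j) //= Xj0 /epow eqxx [A i j < 0]ltNge (ltW Aij) /= powR0 ?gt_eqF //.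
  by rewrite mul0e ltxx.
have bj : beta 0 j <= 0.
  rewrite mxE; apply: sumr_le0 => i _; apply: mulr_ge0_le0 => //.
  exact: ltW (dual_row_gt0 kappa_opt nd i).
have [kj|kj] := eqVneq (kappa j 0) 0.
  by have := rest j kj bj; rewrite Xj0 ltxx.
suff bj1 : beta 0 j = 1 by move: bj; rewrite bj1 ler10.
move: j kj {Xj0 Aij bj}; apply/(forall_basis kappa_opt nd).
by split=> [k _|j ->]; [exact: moment_row_basis|rewrite eqxx].
Qed.

Lemma measurable_sample_powers : measurable_fun setT (powers A \o Xrow X).
Proof. exact: (measurableT_comp (measurable_powers A) (measurable_Xrow X)). Qed.

Lemma measurable_sample_pos : measurable (Xrow X @^-1` @all_pos R m).
Proof. by rewrite -[X in measurable X]setTI; apply: measurable_Xrow => //; exact: measurable_all_pos. Qed.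

Lemma sample_posP w : (Xrow X @^-1` @all_pos R m) w <-> forall j, 0 < X j w.
Proof. by split=> Xw j; have := Xw j; rewrite mxE. Qed.

(** By [powprod_gt0_ae] no factor vanishes, almost surely, when all products are
    positive; so on the orthant the products may be computed by [powers]. *)
Lemma law_orthant_sample B : measurable B ->
  law_orthant P (measurable_powprod A X) B =
  image_measure (mrestr P measurable_sample_pos) measurable_sample_powers B.
Proof.
move=> mB; rewrite /law_orthant /image_measure /pushforward /mrestr.
apply: measure_ae_iff.
- apply: measurableI; last exact: (measurable_pos_finite (measurable_powprod A X)).
  rewrite -[X in measurable X]setTI.
  exact: (measurable_fine_row (measurable_powprod A X)).
- apply: measurableI; last exact: measurable_sample_pos.
  by rewrite -[X in measurable X]setTI; exact: measurable_sample_powers.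
have fineE w : (forall j, 0 < X j w) -> fine_row (powprod A X) w = (powers A \o Xrow X) w.
  by move=> Xw; apply/rowP => i; rewrite mxE powprod_pos.
apply: filterS powprod_gt0_ae => w pos; split=> -[Bw pw].
  have Xw : forall j, 0 < X j w by apply: pos => i; have /andP[] := pw i.
  by split; [move: Bw; rewrite /preimage /mkset (fineE w Xw)|apply/sample_posP].
move/sample_posP : pw => Xw; split; first by rewrite /preimage /mkset (fineE w Xw).
by move=> i; rewrite powprod_pos // lte_fin ltry andbT mxE expR_gt0.
Qed.

Definition corner_boundary (c : 'I_n -> R) : set (borel_rV R n) :=
  [set y : 'rV[R]_n | forall i, c i <= y 0 i] `\` orthant_above c.

Lemma measurable_corner_boundary c : measurable (corner_boundary c).
Proof.
apply: measurableD; last exact: measurable_orthant_above.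
rewrite (_ : [set y : 'rV[R]_n | _] = rect (fun i => `[(c i), +oo[%classic)).
  by apply: measurable_rect => i; exact: measurable_itv.
by apply/seteqP; split=> y /= yc i; have := yc i; rewrite /= in_itv /= andbT.
Qed.

Lemma limit_value_ge0 c : (0 <= limit_value A nd X c)%E.
Proof.
apply: mule_ge0.
  rewrite lee_fin mulr_ge0 ?invr_ge0 // divr_ge0 //; apply: prodr_ge0 => i _.
    exact: powR_ge0.
  exact: ltW (dual_row_gt0 kappa_opt nd i).
by apply: prode_ge0 => j _; apply: integral_ge0 => w _; exact: epow_ge0.
Qed.

Lemma limit_value_fin c : limit_value A nd X c \is a fin_num.
Proof.
rewrite fin_numM //; apply: prode_fin_num => j /eqP kj.
exact: (moment_fin_num X_ge0 eps_gt0 X_moment kj).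
Qed.

Lemma limit_value_scale c l : 0 < l -> (forall i, 0 < c i) ->
  limit_value A nd X (fun i => l * c i) =
  ((l `^ (- \sum_i b 0 i))%:E * limit_value A nd X c)%E.
Proof.
move=> l0 c0; rewrite /limit_value muleA -EFinM; congr (_%:E * _)%E.
have -> : l `^ (- \sum_i b 0 i) = \prod_i l `^ (- b 0 i).
  rewrite [LHS]/powR gt_eqF // -sumrN mulr_suml expR_sum; apply: eq_bigr => i _.
  by rewrite /powR gt_eqF.
have -> : \prod_i (l * c i) `^ (- b 0 i) = (\prod_i l `^ (- b 0 i)) * \prod_i c i `^ (- b 0 i).
  by rewrite -big_split; apply: eq_bigr => i _; rewrite powRM // ltW.
by rewrite -[(_ * _) / _]mulrA mulrCA.
Qed.

Lemma sum_dual_gt0 : (0 < n)%N -> 0 < \sum_i b 0 i.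
Proof.
move=> n0; rewrite (bigD1 (Ordinal n0)) //=; apply: ltr_wpDr.
  by apply: sumr_ge0 => i _; exact: ltW (dual_row_gt0 kappa_opt nd i).
exact: dual_row_gt0.
Qed.

(** Shrinking the corner by [q < 1] captures the boundary, and multiplies the
    mass of the upper orthant by a factor as close to one as desired. *)
Lemma limit_measure_corner_null c : (0 < n)%N -> (forall i, 0 < c i) ->
  mu (corner_boundary c) = 0%E.
Proof.
move=> n0 c0; set D := corner_boundary c.
have s0 := sum_dual_gt0 n0; set s := \sum_i b 0 i in s0 *.
have mU := measurable_orthant_above c.
have mD : measurable D by exact: measurable_corner_boundary.
have muU (a : 'I_n -> R) (a0 : forall i, 0 < a i) : mu (orthant_above a) = limit_value A nd X a.
  exact: (limit_measure_above kappa_opt X_ge0 X_indep eps_gt0 X_moment a0).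
have fU := limit_value_fin c.
have bound e : 0 < e -> (mu D <= e%:E * limit_value A nd X c)%E.
  (* With this [q] the factor [q^(- s)] of [limit_value_scale] is [1 + e]. *)
  move=> e0; pose q := (1 + e) `^ (- s^-1).
  have e1 : 0 < 1 + e by rewrite addr_gt0.
  have q0 : 0 < q by exact: powR_gt0.
  have q1 : q < 1.
    rewrite /q powRN invf_lt1 ?powR_gt0 //.
    suff : 1 `^ s^-1 < (1 + e) `^ s^-1 by rewrite powR1.
    by apply: gt0_ltr_powR; rewrite ?nnegrE ?invr_gt0 ?(ltW e1) // ltrDl.
  have : (mu (D `|` orthant_above c) <= mu (orthant_above (fun i => (q * c i)%R)))%E.
    apply: le_measure; rewrite ?inE; [exact: measurableU|exact: measurable_orthant_above|].
    move=> y [[yc _]|yc] i; last by apply: lt_trans (yc i); rewrite gtr_pMl.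
    by apply: lt_le_trans (yc i); rewrite gtr_pMl.
  rewrite measureU //; last by apply/seteqP; split=> // y [[_]].
  rewrite [X in (_ + X <= _)%E -> _](muU c c0) [X in (_ <= X)%E -> _]muU => [|i]; last by rewrite mulr_gt0.
  rewrite limit_value_scale // /q -powRrM mulrNN mulVf ?gt_eqF // powRr1 ?(ltW e1) //.
  rewrite EFinD ge0_muleDl // ?lee_fin ?(ltW e0) // mul1e addeC.
  by rewrite leeD2lE.
apply/eqP; rewrite eq_le measure_ge0 andbT; apply/lee_addgt0Pr => e e0; rewrite add0e.
have v0 := limit_value_ge0 c; set v := limit_value A nd X c in bound fU v0.
have fv0 : 0 < fine v + 1 by rewrite ltr_wpDl // fine_ge0.
apply: (le_trans (bound (e / (fine v + 1)) _)); first by rewrite divr_gt0.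
rewrite -(fineK fU) -EFinM lee_fin mulrAC ler_pdivrMr // ler_pM2l //.
by rewrite lerDl.
Qed.

Lemma continuous_indic_above c (y : 'rV[R]_n) :
  ~ corner_boundary c y ->
  {for y, continuous (\1_(orthant_above c) : 'rV[R]_n -> R)}.
Proof.
move=> yD; have near_gt i : c i < y 0 i -> \forall z \near y, c i < (z : 'rV[R]_n) 0 i.
  move=> yi; apply: (@coord_continuous R 1 n 0 i y [set t | c i < t]).
  exact: lt_nbhsr.
have near_lt i : y 0 i < c i -> \forall z \near y, (z : 'rV[R]_n) 0 i < c i.
  move=> yi; apply: (@coord_continuous R 1 n 0 i y [set t | t < c i]).
  exact: lt_nbhsl.
have [yU|nyU] := pselect (orthant_above c y).
  have near_above : \forall z \near y, forall i, c i < (z : 'rV[R]_n) 0 i.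
    exact: (@filter_forall _ _ (fun i (z : 'rV[R]_n) => c i < z 0 i) (nbhs y) _ (fun i => near_gt i (yU i))).
  apply: (@cvg_near_cst _ _ _ _ (nbhs y) (nbhs_filter y)); apply: filterS near_above => z zU.
  by rewrite !indicE !mem_set.
have [i yi] : exists i, y 0 i < c i.
  apply: contrapT => /forallNP h; apply: yD; split=> // i; rewrite leNgt; apply/negP; exact: h.
apply: (@cvg_near_cst _ _ _ _ (nbhs y) (nbhs_filter y)); apply: filterS (near_lt i yi) => z zi.
by rewrite !indicE !memNset // => /(_ i) /lt_trans /(_ zi); rewrite ltxx.
Qed.

Lemma measurable_sample_above c x :
  measurable [set w | forall i, ((c i * x)%:E < powprod A X i w)%E].
Proof.
rewrite (_ : [set w | _] = \bigcap_(i in [set: 'I_n])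
    (powprod A X i @^-1` `](c i * x)%:E, +oo%E]%classic)).
  apply: fin_bigcap_measurable => // i _; rewrite -[X in measurable X]setTI.
  by apply: measurable_powprod => //; exact: emeasurable_itv.
by apply/seteqP; split=> w /= => [wc i _|wc i]; have := wc i; rewrite /= in_itv /= leey andbT; exact.
Qed.

Lemma test_value_sample_indic c x : 0 < x -> (forall i, 0 < c i) ->
  (\int[P]_w test_value A \1_(orthant_above c) x (Xrow X w) =
   P [set w | forall i, ((c i * x)%:E < powprod A X i w)%E])%E.
Proof.
move=> x0 c0; pose B := (fun w => x^-1 *: (powers A (Xrow X w) : 'rV[R]_n)) @^-1`
  orthant_above c `&` Xrow X @^-1` @all_pos R m.
have mB : measurable B.
  apply: measurableI; last exact: measurable_sample_pos.
  rewrite -[X in measurable X]setTI.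
  apply: (measurableT_comp (@measurable_scale R n x^-1) measurable_sample_powers) => //.
  exact: measurable_orthant_above.
transitivity (P B).
  rewrite -[in RHS](setIT B) -integral_indic //.
  apply: eq_integral => w _; rewrite /test_value; congr (_%:E).
  by rewrite !indicE /B in_setI -natrM mulnb.
apply: measure_ae_iff => //; first exact: measurable_sample_above.
apply: filterS powprod_gt0_ae => w pos.
have above i : (forall j, 0 < X j w) -> ((c i * x)%:E < powprod A X i w)%E =
    (c i < (x^-1 *: (powers A (Xrow X w) : 'rV[R]_n)) 0 i).
  by move=> Xw; rewrite powprod_pos // lte_fin [in RHS]mxE mulrC ltr_pdivlMl // mulrC.
split=> [[Bw /sample_posP Xw] i|wc].
  by rewrite above //; exact: Bw.
have Xw : forall j, 0 < X j w.
  by apply: pos => i; apply: le_lt_trans (wc i); rewrite lee_fin mulr_ge0 // ltW.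
by split; [move=> i; rewrite -above|apply/sample_posP].
Qed.

(** The limit measure does not charge the boundary of the sets considered, so
    their indicators are admissible test functions. *)
Theorem tail_limit c : (0 < n)%N -> (forall i, 0 < c i) ->
  (fine (P [set w | forall i, ((c i * x)%:E < powprod A X i w)%E])
    / tail_product kappa X x)%:E @[x --> +oo] --> limit_value A nd X c.
Proof.
move=> n0 c0; have mU := measurable_orthant_above c.
have mf : measurable_fun setT (\1_(orthant_above c) : borel_rV R n -> R).
  exact: measurable_indic.
have [r r0 rc] : exists2 r, 0 < r & forall i, r <= c i.
  have : \forall r \near 0^'+, forall i, r <= c i.
    by apply: filter_forall => i; exact: nbhs_right_le.
  by move=> /(filterI (@nbhs_right_gt R 0)) /filter_ex[r [r0 rc]]; exists r.
have lim := rescaled_integral_cvg kappa_opt (nd := nd) X_indep X_rv eps_gt0 X_moment mf (K := 1) _ r0.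
rewrite -(limit_measure_above kappa_opt (nd := nd) X_ge0 X_indep eps_gt0 X_moment c0).
have -> : mu (orthant_above c) = (\int[M]_p limit_test_value A nd X \1_(orthant_above c) p)%E.
  rewrite -(ge0_integral_limit_measure A nd X mf); last by move=> y; rewrite indicE.
  by rewrite integral_indic // setIT.
apply: cvg_trans (lim _ _ _).
- apply: near_eq_cvg; near=> x.
  have x0 : 0 < x by near: x; apply: nbhs_pinfty_gt; exact: num_real.
  by rewrite test_value_sample_indic // mulrC EFinM fineK // fin_num_measure //; exact: measurable_sample_above.
- by move=> y; rewrite indicE; case: (_ \in _); rewrite /= ?lexx ?ler01.
- move=> y i yi; rewrite indicE memNset // => /(_ i); move: yi => /lt_le_trans /(_ (rc i)).
  by move=> /lt_trans /[apply]; rewrite ltxx.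
exists (limit_powers @^-1` corner_boundary c `&` rest_pos); split.
- apply: measurableI; last exact: measurable_rest_pos.
  rewrite -[X in measurable X]setTI; apply: measurable_limit_powers => //.
  exact: measurable_corner_boundary.
- exact: limit_measure_corner_null n0 c0.
move=> p /= npc; apply: contrapT => np; apply: npc => pp.
by apply: continuous_indic_above => Dp; apply: np.
Unshelve. all: by end_near.
Qed.

End power_products_limit.

(** * Test functions on the orthant *)

Section orthant_topology.
Context {R : realType} {n : nat}.
Implicit Types (y z : 'rV[R]_n) (U : set 'rV[R]_n) (f : 'rV[R]_n -> R).

Lemma measurable_open_rV U : open U -> measurable (U : set (borel_rV R n)).
Proof. by move=> oU; exact: sub_sigma_algebra. Qed.

Lemma continuous_euclidean_dist z : continuous (fun y => euclidean_dist y z).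
Proof.
move=> y; rewrite /continuous_at /euclidean_dist.
apply: (@continuous_cvg _ _ _ (nbhs y) _ (fun t => \sum_i (t 0 i - z 0 i) ^+ 2) (@Num.sqrt R)).
  exact: sqrt_continuous.
apply: cvg_sumr => i; apply: (@continuous_cvg _ _ _ (nbhs y) _ (fun t : 'rV[R]_n => t 0 i - z 0 i) (fun t : R => t ^+ 2)).
  exact: exprn_continuous.
by apply: cvgB; [exact: coord_continuous|exact: cvg_cst].
Qed.

Lemma open_boundary_nbhd r : open (@boundary_nbhd R n r).
Proof.
rewrite (_ : boundary_nbhd r = \bigcup_(z in @orthant_boundary R n)
    ((fun y => euclidean_dist y z) @^-1` [set t | t < r])).
  apply: bigcup_open => z _; apply: open_comp; last exact: open_lt.
  by move=> y _; exact: continuous_euclidean_dist.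
by apply/seteqP; split=> y [z zb yz]; exists z.
Qed.

Lemma open_orthant : open (@orthant R n).
Proof.
rewrite openE => y y0; rewrite /interior.
apply: (@filter_forall _ _ (fun i z => 0 < z 0 i) (nbhs y)) => i.
by apply: (@coord_continuous R 1 n 0 i y [set t | 0 < t]); exact: lt_nbhsr.
Qed.

Lemma measurable_closed_orthant : measurable (@closed_orthant R n : set (borel_rV R n)).
Proof.
rewrite (_ : closed_orthant = rect (fun=> `[0, +oo[%classic)).
  by apply: measurable_rect => j; exact: measurable_itv.
by apply/seteqP; split=> z /= zp j; have := zp j; rewrite /= in_itv /= andbT.
Qed.

(** Replacing the small coordinate by zero gives a boundary point at distance
    [y_i]. *)
Lemma coord_lt_boundary_nbhd r y i :
  closed_orthant y -> y 0 i < r -> boundary_nbhd r y.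
Proof.
move=> y0 yi; pose z : 'rV[R]_n := \row_j if j == i then 0 else y 0 j.
exists z.
  split=> [j|/(_ i)]; last by rewrite mxE eqxx ltxx.
  by rewrite mxE; case: ifP => _; [exact: lexx|exact: y0].
rewrite /euclidean_dist (bigD1 i) //= big1 ?addr0 => [|j ji].
  by rewrite mxE eqxx subr0 sqrtr_sqr ger0_norm.
by rewrite mxE (negbTE ji) subrr expr0n.
Qed.

Lemma orthant_closed y : orthant y -> closed_orthant y.
Proof. by move=> y0 i; exact: ltW. Qed.

Lemma within_orthantP f y : {within orthant, continuous f} -> orthant y ->
  {for y, continuous f}.
Proof.
move=> + y0; rewrite (continuous_open_subspace _ open_orthant).
by apply; rewrite inE.
Qed.

(** As the orthant is open, extension by zero keeps continuity at its points. *)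
Lemma patch_orthant_continuous f y : {within orthant, continuous f} -> orthant y ->
  {for y, continuous (f \_ (@orthant R n))}.
Proof.
move=> fc y0; have ny : \forall z \near y, orthant z.
  by move: open_orthant; rewrite openE => /(_ y y0).
apply: (@cvg_trans _ (f @ y)).
  apply: (@near_eq_cvg _ _ (nbhs y)); apply: filterS ny => z z0.
  by rewrite patchE mem_set.
by rewrite patchE mem_set //; exact: within_orthantP.
Qed.

Lemma measurable_patch_orthant f : {within orthant, continuous f} ->
  measurable_fun setT (f \_ (@orthant R n) : borel_rV R n -> R).
Proof.
move=> fc; apply: (measurability _ (RGenOInfty.measurableE R)) => _ [_ [a ->] <-].
rewrite setTI.
rewrite (_ : _ @^-1` _ = (orthant `&` f @^-1` [set t | a < t]) `|`
    (if a < 0 then ~` (@orthant R n) else set0)).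
  apply: measurableU; last first.
    by case: ifP => // _; apply: measurableC; exact: measurable_open_rV open_orthant.
  apply: measurable_open_rV; rewrite openE => y [y0 ay]; apply: filterI.
    by move: open_orthant; rewrite openE => /(_ y y0).
  by apply: (within_orthantP fc y0); exact: lt_nbhsr.
apply/seteqP; split=> y /=; rewrite in_itv /= andbT patchE.
  case: ifPn => [|/negP]; rewrite inE => y0 ay; [by left|right].
  by rewrite ay.
move=> [[y0 ay]|]; first by rewrite mem_set.
by case: ifP => // a0 /= y0; rewrite memNset.
Qed.

End orthant_topology.

(** * Scaling convergence of the law *)

Lemma rescaledE (R : realType) n (nu : {measure set (borel_rV R n) -> \bar R})
    (c : {nonneg R}) x : 0 < x ->
  rescaled nu c%:num x = mscale c (image_measure nu (@measurable_scale R n x^-1)).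
Proof.
move=> x0; apply/funext => B; rewrite /rescaled /mscale /image_measure /pushforward.
congr (_ * nu _)%E; apply/seteqP; split=> [_ /= [y By <-]|y /= By].
  by rewrite scalerA mulVf ?gt_eqF // scale1r.
by exists (x^-1 *: y) => //; rewrite scalerA divff ?gt_eqF // scale1r.
Qed.

Section regular_variation_of_products.
Context {R : realType} {m n : nat}.
Variables (A : 'M[R]_(n, m)) (kappa : 'cV[R]_m).
Hypothesis kappa_opt : lp_unique_optimal A kappa.
Hypothesis nd : lp_nondegenerate n kappa.
Local Notation idx := (basis_idx nd).
Local Notation Ak := (basis_mx A nd).
Local Notation b := (dual_row A nd).
Local Notation beta := (moment_row A nd).
Local Notation expn n := (family_product (fun _ : 'I_n => @expm R)).
Context d {T : measurableType d} {P : probability T R}.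
Variable X : 'I_m -> {RV P >-> R}.
Hypothesis X_ge0 : forall j w, 0 <= X j w.
Hypothesis X_indep : mutually_independent X.
Hypothesis X_rv : forall j, 0 < kappa j 0 -> regularly_varying_RV (X j) (- 1).
Variable eps : R.
Hypothesis eps_gt0 : 0 < eps.
Hypothesis X_moment : forall j, kappa j 0 = 0 ->
  (\int[P]_w epow (X j w) (beta 0 j + eps)%R < +oo)%E /\
  (\int[P]_w epow (X j w) (beta 0 j - eps)%R < +oo)%E.

Local Notation M := (P \x expn n)%E.
Local Notation limit_powers := (limit_powers A nd X).
Local Notation rest_pos := (rest_pos (n := n) kappa X).
Local Notation mu := (limit_measure A nd X).
Local Notation nu := (law_orthant P (measurable_powprod A X)).
Local Notation norming := (fun x => (tail_product kappa X x)^-1).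

Lemma limit_powers_orthant p : @orthant R n (limit_powers p).
Proof. by move=> i; rewrite mxE expR_gt0. Qed.

Lemma closed_orthant_away (r : R) (B := @closed_orthant R n `\` boundary_nbhd r) :
  measurable (B : set (borel_rV R n)).
Proof.
apply: measurableD; first exact: measurable_closed_orthant.
by apply: measurable_open_rV; exact: open_boundary_nbhd.
Qed.

(** Away from the boundary all coordinates are at least [r], so the set is
    contained in the upper orthant with corner [r / 2]. *)
Lemma limit_measure_M_O : M_O mu.
Proof.
split.
  rewrite -[LHS]/(M (limit_powers @^-1` (~` orthant) `&` rest_pos)).
  rewrite (_ : _ `&` _ = set0) ?measure0 //; apply/seteqP; split=> // p [np _].
  by apply: np; exact: limit_powers_orthant.
move=> r r0; have r20 : 0 < r / 2 by rewrite divr_gt0.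
apply: (@le_lt_trans _ _ (mu (orthant_above (fun=> r / 2)))).
  apply: le_measure; rewrite ?inE; [exact: closed_orthant_away|exact: measurable_orthant_above|].
  move=> y [y0 yr] i; apply: (@lt_le_trans _ _ r); first by rewrite ltr_pdivrMr // ltr_pMr // ltr1n.
  rewrite leNgt; apply/negP => yi; apply: yr; exact: coord_lt_boundary_nbhd yi.
rewrite [X in (X < _)%E](limit_measure_above kappa_opt X_ge0 X_indep eps_gt0 X_moment) //.
by rewrite ltey_eq (limit_value_fin X_ge0 eps_gt0 X_moment).
Qed.

Lemma law_orthant_M_O : M_O nu.
Proof.
split.
  rewrite [LHS]law_orthantE (_ : [set w | _] = set0) ?measure0 //.
  by apply/seteqP; split=> // w [y [ny y0] _]; exact: ny.
move=> r r0; apply: (@le_lt_trans _ _ 1%E); last exact: ltry.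
rewrite [X in (X <= _)%E]/(law_orthant _ _ _) /law_orthant /pushforward /mrestr.
apply: probability_le1; apply: measurableI.
  rewrite -[X in measurable X]setTI.
  by apply: (measurable_fine_row (measurable_powprod A X)) => //; exact: closed_orthant_away.
exact: (measurable_pos_finite (measurable_powprod A X)).
Qed.

(** The integral of a test function against the rescaled law is an expectation over
    [P], of the form treated in [rescaled_integral_cvg]. *)
Lemma integral_rescaled_law (f : 'rV[R]_n -> R) (x : R) : 0 < x ->
  (forall y, orthant y -> 0 <= f y) -> {within orthant, continuous f} ->
  (\int[rescaled nu (norming x) x]_(y in orthant) (f y)%:E)%E =
  ((tail_product kappa X x)^-1%:E *
     \int[P]_w test_value A (f \_ (@orthant R n)) x (Xrow X w))%E.
Proof.
move=> x0 f0 fc; set g : borel_rV R n -> R := f \_ (@orthant R n).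
have mg : measurable_fun setT g by exact: measurable_patch_orthant.
have g0 y : 0 <= g y by rewrite /g patchE; case: ifPn => // /set_mem /f0.
have mEg : measurable_fun setT (fun y => (g y)%:E) by exact/measurable_EFinP.
have Eg0 y : (0 <= (g y)%:E)%E by rewrite lee_fin.
have t0 : 0 <= norming x by rewrite invr_ge0 ltW // (tail_product_gt0 nd).
rewrite -[norming x]/((NngNum t0)%:num) (rescaledE _ _ x0) integral_mkcond.
rewrite (_ : _ \_ _ = (fun y => (g y)%:E)); last first.
  by apply/funext => y; rewrite /g !patchE; case: ifP.
have ms := @measurable_scale R n x^-1.
rewrite [LHS](ge0_integral_mscale _ measurableT) //; congr (_ * _)%E.
rewrite [LHS](ge0_integral_image _ ms mEg Eg0).
have mgs : measurable_fun setT (fun y : borel_rV R n => (g (x^-1 *: (y : 'rV[R]_n)))%:E).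
  exact: (measurableT_comp mEg ms).
transitivity (\int[image_measure (mrestr P (measurable_sample_pos X))
    (measurable_sample_powers A X)]_y (g (x^-1 *: (y : 'rV[R]_n)))%:E)%E.
  apply: eq_measure_integral => B mB _.
  exact: (law_orthant_sample kappa_opt X_ge0 eps_gt0 X_moment).
rewrite [LHS](ge0_integral_image _ (measurable_sample_powers A X) mgs (fun=> Eg0 _)).
rewrite [LHS](ge0_integral_mrestr P (measurable_sample_pos X)
  (measurableT_comp mgs (measurable_sample_powers A X)) (fun=> Eg0 _)).
rewrite integral_mkcond; apply: eq_integral => w _.
rewrite patchE /test_value indicE.
have -> : (Xrow X w \in @all_pos R m) = (w \in Xrow X @^-1` @all_pos R m) by [].
by case: ifPn; rewrite ?mulr1 ?mulr0.
Qed.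

Lemma law_scaling_limit : M_O_scaling_limit nu norming mu.
Proof.
move=> f [f0 [K fK] fc [r r0 fr]]; set g : borel_rV R n -> R := f \_ (@orthant R n).
have mg : measurable_fun setT g by exact: measurable_patch_orthant.
have g0 y : 0 <= g y by rewrite /g patchE; case: ifPn => // /set_mem /f0.
have -> : (\int[mu]_(y in orthant) (f y)%:E)%E =
    (\int[M]_p limit_test_value A nd X g p)%E.
  rewrite -(ge0_integral_limit_measure A nd X mg g0) integral_mkcond.
  by apply: eq_integral => y _; rewrite /g !patchE; case: ifP.
apply: (cvg_trans _ (rescaled_integral_cvg kappa_opt X_indep X_rv eps_gt0 X_moment (K := `|K|) mg _ r0 _ _)).
- apply: near_eq_cvg; near=> x.
  have x0 : 0 < x by near: x; apply: nbhs_pinfty_gt; exact: num_real.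
  by rewrite integral_rescaled_law.
- move=> y; rewrite g0 /= /g patchE; case: ifPn => [/set_mem y0|_]; last exact: normr_ge0.
  exact: le_trans (fK y y0) (ler_norm K).
- move=> y i yi; rewrite /g patchE; case: ifPn => // /set_mem y0.
  by apply: fr => //; apply: coord_lt_boundary_nbhd yi; exact: orthant_closed.
by apply: aeW => p _; apply: patch_orthant_continuous => //; exact: limit_powers_orthant.
Unshelve. all: by end_near.
Qed.

Lemma tail_product_noninc (x y : R) : 0 <= x -> x <= y ->
  tail_product kappa X y <= tail_product kappa X x.
Proof.
move=> x0 xy; apply: ler_prod => j kj; apply/andP; split; first exact: survival_ge0.
apply: survival_noninc; apply: ge0_ler_powR; rewrite ?nnegrE ?(ltW kj) //.
exact: le_trans xy.
Qed.

(** Each factor [G_j (x^kappa_j)] is regularly varying with index [- kappa_j]. *)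
Lemma norming_regularly_varying : regularly_varying norming (\sum_j kappa j 0).
Proof.
move=> l l0.
have -> : l `^ (\sum_j kappa j 0) = \prod_k (l `^ kappa (idx k) 0).
  rewrite (big_basisC kappa_opt nd) /= [X in _ + X]big1 ?addr0 => [|j /eqP //].
  by rewrite /powR gt_eqF // mulr_suml expR_sum.
pose ratio (k : 'I_n) (x : R) := (survival (X (idx k)) (l `^ kappa (idx k) 0 * levels nd x k) /
    survival (X (idx k)) (levels nd x k))^-1.
apply: (@cvg_trans _ (\prod_k ratio k x @[x --> +oo])).
  apply: near_eq_cvg; near=> x.
  have x0 : 0 <= x by near: x; apply: nbhs_pinfty_ge; exact: num_real.
  rewrite !(tail_productE nd) /levels_tail invrK -prodfV -big_split /=.
  apply: eq_bigr => k _.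
  by rewrite /ratio invf_div /levels powRM ?(ltW l0) // mulrC.
apply: cvg_prodr => k; have lk0 : 0 < l `^ kappa (idx k) 0 by exact: powR_gt0.
rewrite -[l `^ _ in X in _ --> X]invrK; apply: cvgV; first by rewrite invr_eq0 gt_eqF.
have := X_rv (kappa_basis_gt0 nd k) lk0; rewrite powRN powRr1 ?ltW // => rv.
exact: cvg_comp (levels_cvg nd k) rv.
Unshelve. all: by end_near.
Qed.

Lemma norming_normalizing : normalizing_function norming.
Proof.
split.
- by move=> x _; rewrite invr_gt0 (tail_product_gt0 nd).
- move=> x y x0 xy; rewrite lef_pV2 ?posrE ?(tail_product_gt0 nd) //.
  exact: tail_product_noninc.
by exists (\sum_j kappa j 0); exact: norming_regularly_varying.
Qed.

End regular_variation_of_products.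

(** * Homogeneity and positivity of the limit measure *)

Section limit_measure_index.
Context {R : realType} {m n : nat}.
Variables (A : 'M[R]_(n, m)) (kappa : 'cV[R]_m).
Hypothesis kappa_opt : lp_unique_optimal A kappa.
Hypothesis nd : lp_nondegenerate n kappa.
Local Notation idx := (basis_idx nd).
Local Notation Ak := (basis_mx A nd).
Local Notation b := (dual_row A nd).
Local Notation beta := (moment_row A nd).
Local Notation expn n := (family_product (fun _ : 'I_n => @expm R)).
Context d {T : measurableType d} {P : probability T R}.
Variable X : 'I_m -> {RV P >-> R}.

Local Notation M := (P \x expn n)%E.
Local Notation limit_powers := (limit_powers A nd X).
Local Notation mu := (limit_measure A nd X).

(** Translating the exponential coordinates by [- kappa ln l] divides the
    limiting power products by [l], because [A_kappa kappa = 1]. *)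
Lemma limit_powers_translate (l : R) w (u : 'rV[R]_n) : 0 < l ->
  limit_powers (w, u + \row_k (- (kappa (idx k) 0 * ln l))) =
  l^-1 *: (limit_powers (w, u) : 'rV[R]_n).
Proof.
move=> l0; apply/rowP => i; rewrite !mxE /= -{2}(lnK l0) -expRN -expRD; congr expR.
rewrite addrA; congr (_ + _).
have lnE : \sum_k Ak i k * (kappa (idx k) 0 * ln l) = ln l.
  rewrite -[RHS]mul1r -(basis_mx_kappa kappa_opt nd i) mulr_suml.
  by apply: eq_bigr => k _; rewrite mulrA.
rewrite -[in RHS]lnE -sumrN -big_split; apply: eq_bigr => k _ /=.
by rewrite !mxE mulrDr mulrN addrC.
Qed.

Lemma limit_measure_homogeneous : homogeneous_index mu (- \sum_j kappa j 0).
Proof.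
split; first by rewrite oppr_le0 sumr_ge0 // => j _; exact: (kappa_ge0 kappa_opt).
move=> l B l0 mB _.
pose g : borel_rV R n -> R := \1_B.
have mg : measurable_fun setT g by exact: measurable_indic.
have g0 y : 0 <= g y by rewrite /g indicE.
pose gl : borel_rV R n -> R := g \o (fun y => l^-1 *: (y : 'rV[R]_n)).
have mgl : measurable_fun setT gl by exact: (measurableT_comp mg (@measurable_scale R n l^-1)).
have gl0 y : 0 <= gl y by exact: g0.
have mlim f : measurable_fun setT f -> measurable_fun setT (limit_test_value A nd X f).
  move=> mf; apply/measurable_EFinP; apply: measurable_funM.
    by apply: (measurableT_comp mf); exact: measurable_limit_powers.
  by apply: measurable_indic; exact: measurable_rest_pos.
have lim0 f p : (forall y, 0 <= f y) -> (0 <= limit_test_value A nd X f p)%E.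
  by move=> f0; rewrite lee_fin mulr_ge0.
have muE : mu B = (\int[M]_p limit_test_value A nd X g p)%E.
  by rewrite -(ge0_integral_limit_measure A nd X mg g0) integral_indic // setIT.
have mulE : mu [set l *: (y : 'rV[R]_n) | y in B] =
    (\int[M]_p limit_test_value A nd X gl p)%E.
  have E : [set l *: (y : 'rV[R]_n) | y in B] =
      (fun y : borel_rV R n => (l^-1 *: (y : 'rV[R]_n) : borel_rV R n)) @^-1` B.
    apply/seteqP; split=> [_ /= [y By <-]|y /= By].
      by rewrite scalerA mulVf ?gt_eqF // scale1r.
    by exists (l^-1 *: (y : 'rV[R]_n)) => //; rewrite scalerA divff ?gt_eqF // scale1r.
  have mlB : measurable ([set l *: (y : 'rV[R]_n) | y in B] : set (borel_rV R n)).
    by rewrite E -[X in measurable X]setTI; exact: (@measurable_scale R n l^-1).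
  rewrite -(ge0_integral_limit_measure A nd X mgl gl0).
  rewrite -[in LHS](setIT [set _ | _ in B]) -integral_indic //.
  apply: eq_integral => y _; congr (_%:E).
  by rewrite /gl /g /= !indicE E.
rewrite [LHS]mulE [X in (_ * X)%E]muE !fubini_tonelli1 //; try (exact: mlim); try by move=> p; exact: lim0.
rewrite -ge0_integralZl //; last 3 first.
- by apply: measurable_fun_fubini_tonelli_F => //; [exact: mlim|move=> p; exact: lim0].
- by move=> w _; apply: integral_ge0 => u _; exact: lim0.
- by rewrite lee_fin powR_ge0.
apply: eq_integral => w _; rewrite /fubini_F.
pose s : 'rV[R]_n := \row_k (- (kappa (idx k) 0 * ln l)).
have -> : l `^ (- \sum_j kappa j 0) = expR (\sum_k s 0 k).
  rewrite /powR gt_eqF // (big_basisC kappa_opt nd) /= [X in _ + X]big1 ?addr0 => [|j /eqP //].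
  by congr expR; rewrite -sumrN mulr_suml; apply: eq_bigr => k _; rewrite mxE mulNr.
have msec : measurable_fun setT (fun u : borel_rV R n => limit_test_value A nd X g (w, u)).
  exact: (measurableT_comp (mlim _ mg) (pair1_measurable w)).
rewrite -[RHS](expn_translate s msec) => [|u]; last exact: lim0.
apply: eq_integral => u _; rewrite /limit_test_value /gl /= limit_powers_translate //.
Qed.

Hypothesis X_ge0 : forall j w, 0 <= X j w.
Hypothesis X_indep : mutually_independent X.
Variable eps : R.
Hypothesis eps_gt0 : 0 < eps.
Hypothesis X_moment : forall j, kappa j 0 = 0 ->
  (\int[P]_w epow (X j w) (beta 0 j + eps)%R < +oo)%E /\
  (\int[P]_w epow (X j w) (beta 0 j - eps)%R < +oo)%E.

(** A vanishing expectation would make the power zero almost surely, but it is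
    positive wherever [X_j] is. *)
Lemma expectation_epow_gt0 j a : (0 < P [set w | (0 < X j w)%R])%E ->
  (0 < \int[P]_w epow (X j w) a)%E.
Proof.
have mX := @measurable_funPT _ _ _ _ (X j).
have me : measurable_fun setT (fun w => epow (X j w) a).
  exact: (measurableT_comp (measurable_epow a) mX).
move=> Ppos; rewrite lt0e integral_ge0 ?andbT => [|w _]; last exact: epow_ge0.
apply/eqP => int0; move: Ppos.
have [N [mN N0 subN]] : ae_eq P setT (fun w => epow (X j w) a) (cst 0%E).
  apply/ae_eq_integral_abs => //.
  by rewrite -[RHS]int0; apply: eq_integral => w _; rewrite gee0_abs ?epow_ge0.
rewrite lt0e => /andP[+ _]; apply/negP; rewrite negbK -measure_le0 -N0.
apply: le_measure; rewrite ?inE //.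
  rewrite (_ : [set w | _] = X j @^-1` `]0, +oo[).
    by apply: measurable_funPTI; exact: measurable_itv.
  by apply/seteqP; split=> w /=; rewrite in_itv /= andbT.
move=> w /= Xw; apply: subN => /= /(_ I).
by rewrite epow_gt0E // => /eqP; rewrite eqe gt_eqF ?expR_gt0.
Qed.

Lemma limit_value_gt0 (c : 'I_n -> R) : (forall i, 0 < c i) ->
  (forall j, kappa j 0 = 0 -> (0 < P [set w | (0 < X j w)%R])%E) ->
  (0 < limit_value A nd X c)%E.
Proof.
move=> c0 Xpos; have [uA _] := optimal_basis_unit kappa_opt nd.
apply: mule_gt0.
  rewrite lte_fin mulr_gt0 ?invr_gt0 ?normr_gt0 -?unitfE -?unitmxE //.
  apply: divr_gt0; apply: prodr_gt0 => i _; first exact: powR_gt0.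
  exact: (dual_row_gt0 kappa_opt nd).
apply: (big_ind (fun x => (0 < x)%E)) => [||j /eqP kj]; first by rewrite lte01.
  by move=> x y; exact: mule_gt0.
by apply: expectation_epow_gt0; exact: Xpos.
Qed.

Lemma limit_measure_neq0 :
  (forall j, kappa j 0 = 0 -> (0 < P [set w | (0 < X j w)%R])%E) ->
  mu (@orthant R n) != 0%E.
Proof.
move=> Xpos; rewrite gt_eqF //.
have c0 (i : 'I_n) : 0 < (1 : R) by exact: ltr01.
apply: (lt_le_trans (limit_value_gt0 c0 Xpos)).
rewrite -(limit_measure_above kappa_opt X_ge0 X_indep eps_gt0 X_moment c0).
apply: le_measure; rewrite ?inE; first exact: measurable_orthant_above.
  by apply: measurable_open_rV; exact: open_orthant.
by move=> y y1 i; apply: lt_trans (y1 i).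
Qed.

End limit_measure_index.

(** * Regular variation of power products *)

Theorem theorem3p3 (R : realType) (m n : nat) (n_gt0 : (0 < n)%N)
    (le_nm : (n <= m)%N) (A : 'M[R]_(n, m)) (kappa : 'cV[R]_m)
    (kappa_opt : lp_unique_optimal A kappa)
    (nd : lp_nondegenerate n kappa) :
  basis_mx A nd \in unitmx /\
  forall (d : measure_display) (T : measurableType d) (P : probability T R)
      (X : 'I_m -> {RV P >-> R}),
    (forall j w, 0 <= X j w) ->
    mutually_independent X ->
    (exists2 eps : R, 0 < eps &
      (forall j, 0 < kappa j 0 -> regularly_varying_RV (X j) (- 1)) /\
      (forall j, kappa j 0 = 0 ->
        (\int[P]_w epow (X j w) (moment_row A nd 0 j + eps)%R < +oo)%E /\
        (\int[P]_w epow (X j w) (moment_row A nd 0 j - eps)%R < +oo)%E)) ->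
    (forall c : 'I_n -> R, (forall i, 0 < c i) ->
      (fine (P [set w | forall i, ((c i * x)%:E < powprod A X i w)%E])
        / tail_product kappa X x)%:E @[x --> +oo] --> limit_value A nd X c) /\
    exists mu : {measure set (borel_rV R n) -> \bar R},
      let nu : {measure set (borel_rV R n) -> \bar R} :=
        law_orthant P (measurable_powprod A X) in
      let norming := fun x => (tail_product kappa X x)^-1 in
      let rho := - \sum_j kappa j 0 in
      [/\ forall c : 'I_n -> R, (forall i, 0 < c i) ->
            mu [set y : 'rV[R]_n | forall i, c i < y 0 i] =
              limit_value A nd X c,
          scaling_convergence nu norming mu rho,
          (forall j, kappa j 0 = 0 -> (0 < P [set w | (0 < X j w)%R])%E) ->
            regularly_varying_O nu norming mu rho &
          rho = - (dual_row A nd *m (const_mx 1 : 'cV[R]_n)) 0 0].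
Proof.
split; first exact: (optimal_basis_unit kappa_opt nd).1.
move=> d T P X X_ge0 X_indep [eps eps_gt0 [X_rv X_moment]]; split.
  by move=> c c0; exact: (tail_limit kappa_opt X_ge0 X_indep X_rv eps_gt0 X_moment n_gt0 c0).
exists (limit_measure A nd X) => nu norming rho.
have conv : scaling_convergence nu norming (limit_measure A nd X) rho.
  split.
  - exact: law_orthant_M_O.
  - exact: (norming_normalizing kappa_opt nd X_rv).
  - exact: (limit_measure_M_O kappa_opt X_ge0 X_indep eps_gt0 X_moment).
  - exact: (law_scaling_limit kappa_opt X_ge0 X_indep X_rv eps_gt0 X_moment).
  - exact: (limit_measure_homogeneous kappa_opt nd X).
split=> //.
- by move=> c c0; exact: (limit_measure_above kappa_opt X_ge0 X_indep eps_gt0 X_moment c0).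
- move=> Xpos; split=> //.
  exact: (limit_measure_neq0 kappa_opt X_ge0 X_indep eps_gt0 X_moment Xpos).
- rewrite /rho (sum_kappaE kappa_opt nd) mxE; congr (- _).
  by apply: eq_bigr => i _; rewrite [const_mx 1 i 0]mxE mulr1.
Qed.
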